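(* Let ${\mathcal{O}}$ be the ring of integers of a number field, ${\mathfrak{p}}\trianglelefteq{\mathcal{O}}$ a non-zero prime ideal, and $q:=|{\mathcal{O}}/{\mathfrak{p}}|$. Let $G$ be a finite ${\mathfrak{p}}$-torsion ${\mathcal{O}}$-module of ${\mathfrak{p}}$-rank $r$. Then for every integer $u\ge0$, $$P_{1,q}^{(u)}(G)=\frac{(q^2)_u\,(q)_\infty}{(q)_u\,(q^2)_\infty}\cdot\frac{(q)_{r+u}\,q^{\binom{r}{2}}}{(q)_u\,|G|^u\,|{\operatorname{Aut}}_{\mathcal{O}}(G)|}.$$
   Context: For a real $x>1$ and integers $k\ge1$ set $(x)_k:=\prod_{i=1}^k(1-x^{-i})$, $(x)_0:=1$, and $(x)_\infty:=\prod_{i=1}^\infty(1-x^{-i})$. The ${\mathfrak{p}}$-rank of $G$ is $\dim_{{\mathcal{O}}/{\mathfrak{p}}}(G/{\mathfrak{p}}G)$. ${\operatorname{Aut}}_{\mathcal{O}}(G)$ is the group of ${\mathcal{O}}$-module automorphisms of $G$. Let ${\mathcal{P}}$ be the set of isomorphism classes of finite ${\mathfrak{p}}$-torsion ${\mathcal{O}}$-modules. For integers $0\le m\le f$ and $n\ge1$, the $m$-th symplectic group is ${\operatorname{Sp}}^{(m)}_{2n}({\mathcal{O}}/{\mathfrak{p}}^f):=\{h\in{\operatorname{GL}}_{2n}({\mathcal{O}}/{\mathfrak{p}}^f) : h^tJ_nh\equiv J_n \pmod{{\mathfrak{p}}^m}\}$, where $J_n=\begin{pmatrix}0&\mathbf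 1_n\\-\mathbf 1_n&0\end{pmatrix}$. For $G\in{\mathcal{P}}$ define $$P_{m,q}(G):=\lim_{n\to\infty}\frac{|\{g\in{\operatorname{Sp}}^{(m)}_{2n}({\mathcal{O}}/{\mathfrak{p}}^f) : \ker(g-\mathbf 1_{2n})\cong G\}|}{|{\operatorname{Sp}}^{(m)}_{2n}({\mathcal{O}}/{\mathfrak{p}}^f)|},$$ where $f\ge\max(m,1)$ is any integer with ${\mathfrak{p}}^{f-1}G=0$; it is known that this limit exists, is independent of such $f$, and that $P_{1,q}(G)=\frac{(q)_\infty}{(q^2)_\infty}\cdot\frac{(q)_r\,q^{\binom r2}}{|{\operatorname{Aut}}_{\mathcal{O}}(G)|}$ for $G$ of ${\mathfrak{p}}$-rank $r$. For a probability distribution $P$ on ${\mathcal{P}}$, its $u$-probability distribution is defined recursively by $P^{(0)}:=P$ and, for $u\ge1$, $$P^{(u)}(G):=\sum_{H\in{\mathcal{P}}}\ \sum_{y\in H,\ H/\langle y\rangle\cong G}\frac{P^{(u-1)}(H)}{|H|},$$ where $\langle y\rangle$ is the ${\mathcal{O}}$-submodule generated by $y$ (one representative $H$ taken per isomorphism class). *)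

(* Defs.v *)
From HB Require Import structures.
From mathcomp Require Import all_boot all_order all_algebra perm fieldext.
From mathcomp Require Import generic_quotient ring_quotient finmap.
From mathcomp Require Import all_classical all_reals all_analysis.

Set Implicit Arguments.
Unset Strict Implicit.
Unset Printing Implicit Defensive.

Import Order.TTheory GRing.Theory Num.Theory numFieldNormedType.Exports.

Local Open Scope classical_set_scope.
Local Open Scope ring_scope.
Local Open Scope quotient_scope.

(* Size of a finite set; every set to which it is applied below is finite (the
   quotients O/p^f of a ring of integers are), on infinite sets it is 0. *)
Definition set_card (T : choiceType) (A : set T) : nat := #|` fset_set A|%fset.

Section RingOfIntegers.
Variable K : fieldExtType rat.

Definition integral_pred : {pred K} :=
  fun x => `[< integralOver (intr : int -> K) x >].

Lemma integral_predP : subring_closed integral_pred.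
Proof.
split; rewrite ?unfold_in.
- by apply/asboolP; exact: integral1.
- by move=> x y /asboolP ? /asboolP ?; apply/asboolP; exact: integral_sub.
- by move=> x y /asboolP ? /asboolP ?; apply/asboolP; exact: integral_mul.
Qed.

HB.instance Definition _ :=
  GRing.isSubringClosed.Build K integral_pred integral_predP.

Record ringint := RingInt { ringint_val : K; _ : ringint_val \in integral_pred }.

HB.instance Definition _ := [isSub for ringint_val].
HB.instance Definition _ := [Choice of ringint by <:].
HB.instance Definition _ := [SubChoice_isSubComNzRing of ringint by <:].

End RingOfIntegers.

(* V / N, on top of the library's quotient of additive groups *)
Section QuotientModule.
Variables (R : nzRingType) (V : lmodType R) (N : submodClosed V).

(* the library does not see that a submodule is closed under opposite *)
Definition submod_pred : {pred V} := N.

Lemma submod_predP : zmod_closed submod_pred.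
Proof.
split=> [|u v Nu Nv]; first exact: (rpred0 N).
by rewrite /submod_pred -scaleN1r; apply: (rpredD Nu); exact: rpredZ.
Qed.

HB.instance Definition _ := GRing.isZmodClosed.Build V submod_pred submod_predP.

Definition lquot : Type := Quotient.quot submod_pred.
HB.instance Definition _ := GRing.Zmodule.on lquot.

Definition lquot_scale (a : R) (x : lquot) : lquot :=
  \pi_(Quotient.quot submod_pred) (a *: repr (x : Quotient.quot submod_pred)).

Definition lquot_pi (v : V) : lquot := \pi_(Quotient.quot submod_pred) v.

Lemma lquot_piP (u v : V) : lquot_pi u = lquot_pi v <-> u - v \in N.
Proof.
have <- : (u - v \in submod_pred) = (u - v \in N) by [].
by rewrite Quotient.idealrBE; split=> /eqP.
Qed.

Lemma lquot_piD (u v : V) : lquot_pi (u + v) = lquot_pi u + lquot_pi v.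
Proof. exact: (raddfD \pi_(Quotient.quot submod_pred)). Qed.

Lemma lquot_piZ a v : lquot_scale a (lquot_pi v) = lquot_pi (a *: v).
Proof.
apply/lquot_piP; rewrite -scalerBr; apply: rpredZ.
by apply/lquot_piP; rewrite /lquot_pi reprK.
Qed.

Lemma lquot_ind (Q : lquot -> Prop) : (forall v, Q (lquot_pi v)) -> forall x, Q x.
Proof. by move=> h x; rewrite -[x](@reprK V (Quotient.quot submod_pred)); exact: h. Qed.

Lemma lquot_scalerA a b x :
  lquot_scale a (lquot_scale b x) = lquot_scale (a * b) x.
Proof. by elim/lquot_ind: x => v; rewrite !lquot_piZ scalerA. Qed.

Lemma lquot_scale1r : left_id 1 lquot_scale.
Proof. by elim/lquot_ind => v; rewrite lquot_piZ scale1r. Qed.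

Lemma lquot_scalerDr : right_distributive lquot_scale +%R.
Proof.
move=> a x y; elim/lquot_ind: x => u; elim/lquot_ind: y => v.
by rewrite -lquot_piD !lquot_piZ scalerDr lquot_piD.
Qed.

Lemma lquot_scalerDl x : {morph lquot_scale^~ x : a b / a + b}.
Proof. by move=> a b; elim/lquot_ind: x => v; rewrite !lquot_piZ scalerDl lquot_piD. Qed.

HB.instance Definition _ := GRing.Zmodule_isLmodule.Build R lquot
  lquot_scalerA lquot_scale1r lquot_scalerDr lquot_scalerDl.

End QuotientModule.

Definition cyclic_submod (R : comNzRingType) (V : lmodType R) (y : V) : {pred V} :=
  fun z => `[< exists a : R, z = a *: y >].

Section CyclicSubmodule.
Variables (R : comNzRingType) (V : lmodType R) (y : V).

Lemma cyclic_submodP : submod_closed (cyclic_submod y).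
Proof.
split; first by apply/asboolP; exists 0; rewrite scale0r.
move=> c u v /asboolP[a ->] /asboolP[b ->]; apply/asboolP.
by exists (c * a + b); rewrite scalerDl scalerA.
Qed.

HB.instance Definition _ :=
  GRing.isSubmodClosed.Build R V (cyclic_submod y) cyclic_submodP.
End CyclicSubmodule.

(* I A: the finite sums of products a *: v with a in I and v in A *)
Definition span_prod (R : comNzRingType) (V : lmodType R)
    (I : {pred R}) (A : {pred V}) : {pred V} :=
  fun z => `[< exists (k : nat) (a : 'I_k -> R) (v : 'I_k -> V),
    [/\ forall i, a i \in I, forall i, v i \in A & z = \sum_i a i *: v i] >].

Section SpanProd.
Variables (R : comNzRingType) (V : lmodType R) (I : idealr R) (A : {pred V}).

Lemma span_prodP : submod_closed (span_prod I A).
Proof.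
split.
  apply/asboolP; exists 0%N, (fun=> 0), (fun=> 0).
  by split; [case|case|rewrite big_ord0].
move=> c x y /asboolP[k [a [v [aI vA ->]]]] /asboolP[l [b [w [bI wA ->]]]].
apply/asboolP; exists (k + l)%N,
  (fun i => match fintype.split i with inl j => c * a j | inr j => b j end),
  (fun i => match fintype.split i with inl j => v j | inr j => w j end).
split=> [i|i|]; first by case: (fintype.split i) => j; rewrite ?idealMr.
  by case: (fintype.split i).
rewrite big_split_ord/= scaler_sumr; congr (_ + _); apply: eq_bigr => i _.
  by rewrite (unsplitK (inl i)) scalerA.
by rewrite (unsplitK (inr i)).
Qed.

HB.instance Definition _ :=
  GRing.isSubmodClosed.Build R V (span_prod I A) span_prodP.
End SpanProd.

(* I ^ k, with I ^ 0 = R *)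
Fixpoint idealX (R : comNzRingType) (I : {pred R}) (k : nat) : {pred R} :=
  if k is j.+1 then @span_prod R R^o I (idealX I j) else predT.

Definition idealXS (R : comNzRingType) (I : {pred R}) (k : nat) : {pred R} :=
  idealX I k.+1.

Section IdealPower.
Variables (R : comNzRingType) (I : idealr R) (k : nat).

Lemma idealXS_closed : idealr_closed (idealXS I k).
Proof.
have [h0 hZ] := @span_prodP R R^o I (idealX I k).
split=> //; apply/negP => /asboolP[l [a [v [aI _ /esym e]]]].
have : 1 \in (I : {pred R}).
  rewrite -e; apply: rpred_sum => i _.
  by rewrite /GRing.scale/= mulrC idealMr.
by rewrite idealr1.
Qed.

HB.instance Definition _ := isIdealr.Build R (idealXS I k) idealXS_closed.
End IdealPower.

(* R / I ^ f for f >= 1. The exponent is spelled (f.-1).+1 because the library's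
   quotient rings are nontrivial; f = 0 is never used. *)
Definition quotX (R : comNzRingType) (I : idealr R) (f : nat) : Type :=
  {ideal_quot (idealXS I f.-1)}.
HB.instance Definition _ (R : comNzRingType) (I : idealr R) (f : nat) :=
  GRing.ComNzRing.on (quotX I f).

Definition piX (R : comNzRingType) (I : idealr R) (f : nat) (a : R) : quotX I f :=
  \pi_{ideal_quot (idealXS I f.-1)} a.

Section PiX.
Variables (R : comNzRingType) (I : idealr R) (f : nat).
Lemma piX_is_zmod_morphism : zmod_morphism (@piX R I f).
Proof. exact: (raddfB \pi_{ideal_quot (idealXS I f.-1)}). Qed.
Lemma piX_is_monoid_morphism : monoid_morphism (@piX R I f).
Proof.
split; first exact: (rmorph1 \pi_{ideal_quot (idealXS I f.-1)}).
exact: (rmorphM \pi_{ideal_quot (idealXS I f.-1)}).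
Qed.
HB.instance Definition _ :=
  GRing.isZmodMorphism.Build R (quotX I f) (@piX R I f) piX_is_zmod_morphism.
HB.instance Definition _ :=
  GRing.isMonoidMorphism.Build R (quotX I f) (@piX R I f) piX_is_monoid_morphism.
End PiX.

Section Modules.
Variable O : comNzRingType.

Definition lmod_iso (V W : lmodType O) : Prop :=
  exists phi : {linear V -> W}, bijective phi.

Definition card_Aut (G : finLmodType O) : nat :=
  #|[pred s : {perm G} | `[< linear (s : G -> G) >] ]|.

Variable p : idealr O.

(* p ^ k annihilates G *)
Definition pkills (k : nat) (G : lmodType O) : Prop :=
  forall a (x : G), a \in idealX p k -> a *: x = 0.

Definition ptorsion (G : lmodType O) : Prop := exists k, pkills k G.

(* dim_(O/p) (G / pG) = r: G / pG is (O/p)-linearly isomorphic to (O/p)^r *)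
Definition has_prank (G : lmodType O) (r : nat) : Prop :=
  exists phi : {linear lquot (span_prod p (predT : {pred G}))
                 -> 'rV[{ideal_quot p}]_r | \pi_{ideal_quot p} \; *:%R},
    bijective phi.

Definition symplJ (S : pzRingType) (n : nat) : 'M[S]_(n + n) :=
  block_mx 0 1%:M (- 1%:M) 0.

(* Sp^(m)_2n (O / p ^ f): invertible matrices preserving J modulo the image of
   p ^ m in O / p ^ f *)
Definition Spm (m f n : nat) : set 'M[quotX p f]_(n + n) :=
  [set h | (exists h', h *m h' = 1%:M /\ h' *m h = 1%:M) /\
     forall i j, exists2 a, a \in idealX p m &
       (h^T *m symplJ _ n *m h - symplJ _ n) i j = piX p f a].

(* ker (g - 1) and G are isomorphic O-modules, (O / p ^ f)^2n being an O-module
   through O -> O / p ^ f *)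
Definition ker_iso (f n : nat) (G : lmodType O) (g : 'M[quotX p f]_(n + n)) : Prop :=
  exists phi : {linear G -> 'cV[quotX p f]_(n + n) | (@piX O p f) \; *:%R},
    set_bij [set: G] [set v | (g - 1%:M) *m v = 0] phi.

Variable R : realType.

Definition ker_freq (m f : nat) (G : lmodType O) (n : nat) : R :=
  (set_card (@Spm m f n `&` [set g | ker_iso G g]))%:R / (set_card (@Spm m f n))%:R.

(* P_(m,q) (G), computed at level f *)
Definition Pmf (m f : nat) (G : lmodType O) : R := limn (ker_freq m f G).

(* f chooses, for each G, one of the integers allowed in the definition of
   P_(m,q) (G) *)
Definition levels (m : nat) (f : finLmodType O -> nat) : Prop :=
  forall G : finLmodType O, ptorsion G -> (maxn m 1 <= f G)%N /\ pkills (f G).-1 G.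

Definition Pmq (m : nat) (f : finLmodType O -> nat) (G : finLmodType O) : R :=
  Pmf m (f G) G.

(* M lists one representative of each isomorphism class of finite p-torsion
   modules *)
Definition representatives (I : choiceType) (M : I -> finLmodType O) : Prop :=
  (forall i, ptorsion (M i)) /\
  (forall H : finLmodType O, ptorsion H -> exists! i, lmod_iso H (M i)).

Fixpoint udist (I : choiceType) (M : I -> finLmodType O)
    (P : finLmodType O -> R) (u : nat) (G : finLmodType O) : \bar R :=
  if u is v.+1 then
    \esum_(i in [set: I])
      (\sum_(y : M i | `[< lmod_iso (lquot (cyclic_submod y)) G >])
         (udist M P v (M i) * (#|M i|%:R^-1)%:E))%E
  else (P G)%:E.

End Modules.

(* The data quantified over in levels and representatives exist. *)
Lemma levels_exists (O : comNzRingType) (p : idealr O) m : exists f, levels p m f.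
Proof.
have mono k l (G : lmodType O) : (k <= l)%N -> pkills p k G -> pkills p l G.
  move=> /subnK <-; elim: (l - k)%N => // d IH /IH h a x.
  rewrite addSn /= => /asboolP[n [b [c [_ cI ->]]]].
  rewrite scaler_suml; apply: big1 => i _.
  have -> : b i *: c i = b i * c i by []. by rewrite -scalerA (h (c i)) ?scaler0//; exact: cI.
have h (G : finLmodType O) : exists f, ptorsion p G -> (maxn m 1 <= f)%N /\ pkills p f.-1 G.
  have [[k hk]|//] := pselect (ptorsion p G); last by exists 0%N.
  exists (maxn (maxn m 1) k.+1) => _; split; first exact: leq_maxl.
  apply: mono hk. by rewrite -ltnS (leq_trans (leq_maxr (maxn m 1) k.+1) (leqSpred _)).
by have [f hf] := @choice (finLmodType O) nat _ h; exists f.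
Qed.

Lemma lmod_iso_refl (O : comNzRingType) (G : lmodType O) : lmod_iso G G.
Proof. by exists (GRing.Linear.clone _ _ _ _ (@idfun G) _); exists idfun. Qed.

Lemma lmod_iso_sym (O : comNzRingType) (G H : lmodType O) : lmod_iso G H -> lmod_iso H G.
Proof.
move=> [f [g fg gf]].
have lg : linear g by move=> a x y; apply: (can_inj fg); rewrite linearP !gf.
pose gl := HB.pack_for {linear H -> G} g (GRing.isLinear.Build _ _ _ _ g lg).
by exists gl; exists f.
Qed.
Lemma lmod_iso_trans (O : comNzRingType) (G H K : lmodType O) : lmod_iso G H -> lmod_iso H K -> lmod_iso G K.
Proof. by move=> [f fb] [g gb]; exists (g \o f : {linear _ -> _}); exact: bij_comp gb fb. Qed.


(* module structures transported to 'I_n *)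
Definition modcode (O : Type) : Type :=
  {n : nat & (('I_n -> 'I_n -> 'I_n) * (O -> 'I_n -> 'I_n))%type}.

Definition encodes (O : comNzRingType) (c : modcode O) (G : lmodType O) : Prop :=
  exists2 e : G -> 'I_(tag c), bijective e &
    (forall x y, e (x + y) = (tagged c).1 (e x) (e y)) /\
    (forall a x, e (a *: x) = (tagged c).2 a (e x)).

Lemma encodes_ex (O : comNzRingType) (G : finLmodType O) :
  exists c, encodes c G.
Proof.
exists (Tagged (fun n => (('I_n -> 'I_n -> 'I_n) * (O -> 'I_n -> 'I_n))%type)
  ((fun i j => enum_rank (enum_val i + enum_val j : G)),
   (fun a i => enum_rank (a *: enum_val i : G)))).
exists enum_rank; first exact: enum_rank_bij.
by split=> [x y|a x] /=; rewrite !enum_rankK.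
Qed.

Lemma encodes_iso (O : comNzRingType) (c : modcode O) (G H : lmodType O) :
  lmod_iso G H -> encodes c G -> encodes c H.
Proof.
move=> /lmod_iso_sym[f fb] [e eb [eD eZ]].
exists (e \o f); first exact: bij_comp.
by split=> [x y|a x] /=; rewrite ?linearD ?linearZ ?eD ?eZ.
Qed.

Lemma encodes_inj (O : comNzRingType) (c : modcode O) (G H : lmodType O) :
  encodes c G -> encodes c H -> lmod_iso G H.
Proof.
move=> [e [e' ee' e'e] [eD eZ]] [g [g' gg' g'g] [gD gZ]].
have lf : linear (g' \o e).
  by move=> a x y /=; apply: (can_inj gg'); rewrite g'g gD gZ !g'g eD eZ.
pose f := HB.pack_for {linear G -> H} (g' \o e)
  (GRing.isLinear.Build _ _ _ _ (g' \o e) lf).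
exists f; exists (e' \o g) => x /=; first by rewrite g'g ee'.
by rewrite e'e gg'.
Qed.

Lemma representatives_exist (O : comNzRingType) (p : idealr O) :
  exists (I : choiceType) (M : I -> finLmodType O), representatives p M.
Proof.

pose C : choiceType := {classic modcode O}.
pose c0 : C := existT _ 1%N ((fun _ _ => ord0), (fun _ _ => ord0)).
pose code (G : lmodType O) : C := xget c0 [set c : C | encodes c G].
have codeP (G : finLmodType O) : encodes (code G) G.
  by have [c hc] := encodes_ex G; exact: (@xgetPex _ c0 [set c : C | encodes c G]) (ex_intro _ c hc).
have codeE (G H : lmodType O) : lmod_iso G H -> code G = code H.
  move=> e; congr xget; apply/seteqP; split=> c; first exact: encodes_iso.
  exact/encodes_iso/lmod_iso_sym.
pose T := {c : C | exists G : finLmodType O, ptorsion p G /\ c = code G}.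
pose M (i : {classic T}) := projT1 (cid (proj2_sig i)).
have MP (i : {classic T}) : ptorsion p (M i) /\ sval i = code (M i) by rewrite /M; case: cid.
exists {classic T}, M; split=> [i|H tH]; first exact: (MP i).1.
pose i : {classic T} := exist _ (code H) (ex_intro _ H (conj tH erefl)).
exists i; split.
  have [_ e] := MP i; apply: (encodes_inj (codeP H)).
  by have := codeP (M i); rewrite -e.
move=> j /codeE e; have [_ ej] := MP j.
have {ej}e : code H = sval j by rewrite ej.
by rewrite /i; case: j e => c hc /= e; subst c; congr exist; exact: Prop_irrelevance.
Qed.

Definition qpoch (R : realType) (x : R) (k : nat) : R :=
  \prod_(1 <= i < k.+1) (1 - x ^- i).

Definition qpoch_oo (R : realType) (x : R) : R := limn (qpoch x).

(* Main.v *)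
(* The case u = 0. As m = 1, an element of the group at level f is any lift of an
   element of Sp_2n (F_q), F_q = O/p. Let R = O/p^f, a finite chain ring with
   uniformizer t. A square matrix X over R has kernel G exactly when its row
   module presents G, so the number of lifts X of a matrix of corank r over F_q
   with kernel G depends only on r, and equals a constant times 1/|Aut G|.
   What remains is the law of the corank of g - 1 for g in Sp_2n (F_q). By Witt's
   theorem the number of pairs (g, Y) with Y a k-tuple of independent vectors
   fixed by g is |Sp| times the number of Gram matrices of such tuples, which is
   q^(k(k-1)/2) for k <= n: these are the q-factorial moments of the corank,
   and a Bonferroni type inversion recovers the law, with an error that vanishes
   as n grows.

   The step from u to u + 1. The modules H with a y such that H/<y> = G have
   order q^j |G|, and over the chain ring they are presented by the matrices
   [[B, c], [0, t^j]], B being an r x r presentation matrix of G and c a column.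
   By a double count, the number of such y divided by |Aut H| is proportional to
   the number of c giving H. For j > 0 the module has rank r + 1 if c = 0 mod t, a
   proportion q^-r of the columns, and rank r otherwise; for j = 0 it is G. The sum
   over H is thus a geometric series in j with ratio q^-(u+1), which evaluates to
   the closed form at u + 1. *)

From HB Require Import structures.
Require Import Defs.
From mathcomp Require Import all_boot all_order all_algebra perm fieldext.
From mathcomp Require Import generic_quotient ring_quotient finmap.
From mathcomp Require Import all_classical all_reals all_analysis.
From mathcomp Require Import ring lra zify.

Set Implicit Arguments.
Unset Strict Implicit.
Unset Printing Implicit Defensive.

Import Order.TTheory GRing.Theory Num.Theory numFieldNormedType.Exports.

Local Open Scope quotient_scope.
Local Open Scope ring_scope.

(** * Counting matrices by rank *)

(** That O/p^f is a chain ring is derived from scratch: O/l is finite for a prime number l in p, so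
    pigeonhole arguments modulo l stand in for Noetherian ones, and integral closedness of O yields
    t in p and s outside p with s p contained in t O.

    The limit speaks of kernels while presentations describe cokernels. Over a chain ring every
    square matrix X has a partner E with image and kernel exchanged, whence coker X and ker X are
    isomorphic, and all counting is done with presentations.

    The condition p^(f-1) G = 0, one power more than is needed to see G over O/p^f, makes these
    counts uniform: every t-torsion vector is then a relation, so the relations among n generators
    of G need exactly n generators themselves, and square presentation matrices are precisely their
    generating tuples.

    The Gram count is exact only for k <= n, whereas the corank can reach 2n. For larger k it is
    merely bounded by the number q^(k(k-1)/2) of alternating matrices; since the inversion terms
    decay like q^-j, the bound suffices. The factor (q)_oo / (q^2)_oo is the value at -1/q of
    Euler's series, the sum of x^j / (q)_j. *)

Lemma card_fibers (A B : finType) (S : pred A) (f : A -> B) (P : pred B) k :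
  (forall b, P b -> #|[pred x | S x && (f x == b)]| = k) ->
  #|[pred x | S x && P (f x)]| = (#|P| * k)%N.
Proof.
move=> h; rewrite -[LHS]sum1_card (partition_big f P)/= => [|x /andP[]//].
rewrite -sum_nat_const; apply: eq_bigr => b Pb; rewrite -(h b Pb) -[RHS]sum1_card.
apply: eq_bigl => x; rewrite !inE.
by case: (f x =P b) => [->|]; rewrite ?andbF// Pb !andbT.
Qed.

Lemma card_pairs (A B : finType) (P : pred A) (Q : A -> pred B) k :
  (forall a, P a -> #|Q a| = k) ->
  #|[pred x : A * B | P x.1 && Q x.1 x.2]| = (#|P| * k)%N.
Proof.
move=> h; rewrite -[LHS]sum1_card -(pair_big_dep P Q (fun _ _ => 1%N))/=.
rewrite -sum_nat_const; apply: eq_bigr => a Pa; rewrite -(h a Pa) -[RHS]sum1_card.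
exact: eq_bigl.
Qed.

Lemma card_bij_pred (A B : finType) (f : A -> B) (g : B -> A) (P : pred A) (Q : pred B) :
  (forall x, P x -> Q (f x) /\ g (f x) = x) ->
  (forall y, Q y -> P (g y) /\ f (g y) = y) -> #|P| = #|Q|.
Proof.
move=> hP hQ; have inj : {in P &, injective f}.
  by move=> x y /hP[_ e] /hP[_ e'] /(congr1 g); rewrite e e'.
rewrite -(card_in_image inj); apply: eq_card => y; apply/fintype.imageP/idP.
  by move=> [x Px ->]; apply: (hP x Px).1.
by move=> Qy; exists (g y); [exact: (hQ y Qy).1 | rewrite (hQ y Qy).2].
Qed.

Lemma card_swap (A B : finType) (P : pred (A * B)) :
  #|P| = #|[pred x : B * A | P (x.2, x.1)]|.
Proof.
apply: (@card_bij_pred _ _ (fun x => (x.2, x.1)) (fun x => (x.2, x.1))) => -[x y] /=;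
  by rewrite ?inE/=.
Qed.

Lemma card_row_forall (A : finType) n (T : 'I_n -> pred A) :
  #|[pred h : 'rV[A]_n | [forall i, T i (h 0 i)]]| = (\prod_i #|T i|)%N.
Proof.
rewrite -(big_map (fun i => #|T i|) xpredT id)/=.
have -> : (\prod_(i <- [seq #|T i| | i <- index_enum 'I_n]) i)%N =
   #|(family T : simpl_pred {ffun 'I_n -> A})|.
  rewrite card_family /image_mem enumT.
  by elim: [seq _ | _ <- _] => [|a s IH]/=; rewrite ?big_nil// big_cons IH.
apply: (@card_bij_pred _ _ (fun h : 'rV[A]_n => [ffun i => h 0 i])
  (fun g : {ffun 'I_n -> A} => \row_i g i)) => [h /forallP hT|g /familyP hT].
  split; first by apply/familyP => i; rewrite ffunE; apply: hT.
  by apply/rowP => i; rewrite mxE ffunE.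
split; first by apply/forallP => i; rewrite mxE; apply: hT.
by apply/ffunP => i; rewrite ffunE mxE.
Qed.

Section AdditiveFibers.
Variables (A B : finZmodType) (S : pred A) (f : A -> B).
Hypothesis S0 : S 0.
Hypothesis SB : forall x y, S x -> S y -> S (x - y).
Hypothesis fB : forall x y, S x -> S y -> f (x - y) = f x - f y.

(** Fibres are translates of the kernel. Additivity is asked on [S] only, because coordinates of a
    submodule are controlled on that submodule alone. *)
Lemma card_fiber_additive (a : A) : S a ->
  #|[pred x | S x && (f x == f a)]| = #|[pred x | S x && (f x == 0)]|.
Proof.
move=> Sa; have SN x : S x -> S (- x) by move=> Sx; rewrite -sub0r; apply: SB.
have SD x y : S x -> S y -> S (x + y) by move=> Sx Sy; rewrite -[y]opprK; apply/SB/SN.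
apply: (@card_bij_pred _ _ (fun x => x - a) (fun x => x + a)) => x /=/andP[Sx /eqP e].
  by rewrite SB// fB// e subrr eqxx subrK.
rewrite SD// addrK; split=> //=.
by have := fB (SD _ _ Sx Sa) Sa; rewrite addrK e => /esym/eqP; rewrite subr_eq0.
Qed.

Lemma card_preim_additive (P : pred B) :
  (forall b, P b -> exists2 a, S a & f a = b) ->
  #|[pred x | S x && P (f x)]| = (#|P| * #|[pred x | S x && (f x == 0%R)]|)%N.
Proof.
move=> hP; apply: card_fibers => b /hP[a Sa <-]; exact: card_fiber_additive.
Qed.

End AdditiveFibers.

Section RowFree.
Variable F : fieldType.

Lemma row_free_col_mx1 k n (X : 'M[F]_(k, n)) (v : 'rV_n) :
  row_free (col_mx X v) = row_free X && ~~ (v <= X)%MS.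
Proof.
apply/idP/andP => [h|[hX hv]].
  split.
    apply: inj_row_free => u uX; suff : row_mx u (0 : 'M[F]_1) = 0.
      by rewrite -row_mx0 => /eq_row_mx[].
    by apply: (row_free_inj h); rewrite /= mul_row_col uX !mul0mx addr0.
  apply/negP => /submxP[u e]; suff : row_mx u (- 1%:M : 'M[F]_1) = 0.
    rewrite -row_mx0 => /eq_row_mx[_ /matrixP/(_ 0 0)/eqP].
    by rewrite !mxE eqxx oppr_eq0 oner_eq0.
  by apply: (row_free_inj h); rewrite /= mul_row_col mulNmx mul1mx e subrr mul0mx.
apply: inj_row_free => w; rewrite -[w]hsubmxK mul_row_col [rsubmx w]mx11_scalar.
set u := lsubmx w; set c := _ 0 0; rewrite mul_scalar_mx => e.
have [c0|c0] := eqVneq c 0.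
  move: e; rewrite c0 scale0r addr0 => e; suff -> : u = 0 by rewrite raddf0 row_mx0.
  by apply: (row_free_inj hX); rewrite /= e mul0mx.
case/negP: hv; apply/submxP; exists (- c^-1 *: u).
move/eqP: e; rewrite addr_eq0 => /eqP e.
by rewrite -scalemxAl e scalerN scaleNr opprK scalerA mulVf// scale1r.
Qed.

End RowFree.

Section FullRank.
Variable F : finFieldType.

Lemma card_rowspace m n (A : 'M[F]_(m, n)) :
  #|[pred v : 'rV[F]_n | (v <= A)%MS]| = (#|F| ^ \rank A)%N.
Proof.
have -> : (#|F| ^ \rank A)%N = #|[pred v : 'rV[F]_(\rank A) | true]|.
  by rewrite [RHS]card_mx mul1n.
symmetry; apply: (@card_bij_pred _ _ (fun v => v *m row_base A)
  (fun v => v *m pinvmx (row_base A))) => v /= hv.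
  split; first by rewrite -(eq_row_base A) submxMl.
  by rewrite -mulmxA mulmxVp ?mulmx1// row_base_free.
by split=> //; rewrite mulmxKpV// eq_row_base.
Qed.

(** Number of injective linear maps from F_q^k to F_q^n. For k > n the factor i = n makes it 0, so
    the truncated subtraction does no harm. *)
Definition full_count (q n k : nat) := (\prod_(i < k) (q ^ n - q ^ i))%N.

Lemma card_row_free k n :
  #|[pred X : 'M[F]_(k, n) | row_free X]| = full_count #|F| n k.
Proof.
elim: k => [|k IH].
  rewrite /full_count big_ord0 -(expn0 #|F|) -(card_mx F 0 n).
  by apply: eq_card => X; rewrite !inE /row_free flatmx0 mxrank0.
rewrite /full_count big_ord_recr/= -/(full_count _ _ _) -IH.
pose P (X : 'M[F]_(k, n)) : pred 'rV[F]_n := fun v => ~~ (v <= X)%MS.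
rewrite -(@card_pairs _ _ (fun X : 'M[F]_(k, n) => row_free X) P) => [|X /eqP rX].
  rewrite -addn1.
  apply: (@card_bij_pred _ _ (fun X : 'M[_]_(k + 1, n) => (usubmx X, dsubmx X))
     (fun x => col_mx x.1 x.2)) => [X|[X v]] /= h.
    by rewrite /P -row_free_col_mx1 vsubmxK.
  by rewrite row_free_col_mx1 col_mxKu col_mxKd.
have e : (#|[pred v : 'rV[F]_n | (v <= X)%MS]| + #|P X|)%N = (#|F| ^ n)%N.
  have := cardC [pred v : 'rV[F]_n | (v <= X)%MS]; rewrite card_mx mul1n => <-.
  by congr (_ + _)%N; apply: eq_card => v; rewrite !inE.
by rewrite -e card_rowspace rX addKn.
Qed.

Lemma card_row_full k n :
  #|[pred X : 'M[F]_(n, k) | row_full X]| = full_count #|F| n k.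
Proof.
rewrite -card_row_free; apply: (@card_bij_pred _ _ trmx trmx) => X /= h;
  by rewrite trmxK /row_free /row_full mxrank_tr.
Qed.

(* The pairs (Y, Z) with Y Z = X form a torsor under GL_k. *)
Lemma card_rank_factor n k (X : 'M[F]_n) : \rank X = k ->
  #|[pred p : 'M[F]_(n, k) * 'M[F]_(k, n) |
     [&& row_full p.1, row_free p.2 & p.1 *m p.2 == X]]| = full_count #|F| k k.
Proof.
move=> rX; have [Y0 [Z0 [fY0 fZ0 X0]]] : exists (Y0 : 'M[F]_(n, k)) (Z0 : 'M[_]_(k, n)),
    [/\ row_full Y0, row_free Z0 & Y0 *m Z0 = X].
  case: _ / rX; exists (col_base X), (row_base X).
  by rewrite col_base_full row_base_free mulmx_base.
rewrite -card_row_free; symmetry.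
apply: (@card_bij_pred _ _ (fun g : 'M[F]_k => (Y0 *m invmx g, g *m Z0))
   (fun p => p.2 *m pinvmx Z0)) => [g|[Y Z]] /=.
  rewrite row_free_unit => ug; split; last by rewrite -mulmxA mulmxVp ?mulmx1.
  rewrite -X0 mulmxA mulmxKV// eqxx andbT.
  by rewrite /row_full mxrankMfree ?row_free_unit ?unitmx_inv// -/(row_full _) fY0
    /row_free eqmxMfull ?row_full_unit.
move=> /and3P[fY fZ /eqP e].
have ZZ0 : (Z <= Z0)%MS.
  have <- : (Y *m Z :=: Z)%MS by exact: eqmxMfull.
  by rewrite e -X0 submxMl.
have eZ := mulmxKpV ZZ0; set g := Z *m _ in eZ *; clearbody g.
have ug : row_free g.
  by move: fZ; rewrite -eZ /row_free mxrankMfree.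
split=> //; rewrite eZ; congr pair.
move: ug; rewrite row_free_unit => ug.
by apply: (row_free_inj fZ); rewrite /= e -X0 -[in LHS]eZ !mulmxA mulmxKV.
Qed.

(** Double count of the factorizations X = Y Z through F^k: each X of rank k has |GL_k| of them. *)
Lemma card_rank n k :
  (#|[pred X : 'M[F]_n | \rank X == k]| * full_count #|F| k k = full_count #|F| n k ^ 2)%N.
Proof.
pose S (p : 'M[F]_(n, k) * 'M[F]_(k, n)) := row_full p.1 && row_free p.2.
rewrite -(@card_fibers _ _ S (fun p => p.1 *m p.2)); last first.
  by move=> X /= /eqP /card_rank_factor <-; apply: eq_card => p; rewrite !inE -andbA.
rewrite expnS expn1 -{1}card_row_full -(@card_row_free k n).
rewrite -(@card_pairs _ _ _ (fun _ => [pred X | row_free X]) _ (fun _ _ => erefl)).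
apply: eq_card => -[Y Z]; rewrite !inE /S/=.
case fY: (row_full Y); case fZ: (row_free Z) => //=; rewrite mxrankMfree//.
Qed.
End FullRank.

(** * Finite chain rings *)

(* R is a finite local ring with residue map rho, maximal ideal (t), t^l = 0 and
   t^(l-1) != 0. *)
Definition uniformizer (R : finComNzRingType) (F : finFieldType)
    (rho : {rmorphism R -> F}) (t : R) (l : nat) : Prop :=
  [/\ forall x, exists a, rho a = x, forall a, rho a = 0 <-> exists b, a = t * b,
      (0 < l)%N, t ^+ l = 0 & t ^+ l.-1 != 0].

Section ChainRing.
Variables (R : finComNzRingType) (F : finFieldType) (rho : {rmorphism R -> F}).
Variables (t : R) (l : nat).
Hypothesis ut : uniformizer rho t l.

Let rho_surj x : exists a, rho a = x. Proof. by have [] := ut. Qed.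
Let rho_ker a : rho a = 0 <-> exists b, a = t * b. Proof. by have [_ h _ _ _] := ut; exact: h. Qed.
Let l_gt0 : (0 < l)%N. Proof. by have [] := ut. Qed.
Let t_nil : t ^+ l = 0. Proof. by have [] := ut. Qed.
Let t_last : t ^+ l.-1 != 0. Proof. by have [] := ut. Qed.

Lemma rho_t : rho t = 0.
Proof. by apply/rho_ker; exists 1; rewrite mulr1. Qed.

(** Dividing by a lift of the residue inverse leaves 1 - t c with t c nilpotent, which a finite
    geometric series inverts. *)
Lemma chain_unit a : rho a != 0 -> exists b, a * b = 1.
Proof.
move=> ra; have [b0 hb] := rho_surj (rho a)^-1.
have /rho_ker[c e] : rho (1 - a * b0) = 0 by rewrite rmorphB rmorph1 rmorphM hb mulfV// subrr.
exists (b0 * \sum_(i < l) (t * c) ^+ i).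
have -> : a * (b0 * \sum_(i < l) (t * c) ^+ i) = (1 - t * c) * \sum_(i < l) (t * c) ^+ i.
  by rewrite mulrA; congr (_ * _); rewrite -e opprB addrC subrK.
have := subrX1 (t * c) l; rewrite exprMn t_nil mul0r sub0r => h.
by rewrite -[1 - _]opprB mulNr -h opprK.
Qed.

(** Factors t are split off until the cofactor is a unit; after l of them nothing is left. *)
Lemma chain_factor a : a = 0 \/ exists k u, [/\ (k < l)%N, rho u != 0 & a = u * t ^+ k].
Proof.
have h n : (exists b, a = t ^+ n * b) \/ exists k u, [/\ (k < n)%N, rho u != 0 & a = u * t ^+ k].
  elim: n => [|n [[b e]|[k [u [kn ru e]]]]].
  - by left; exists a; rewrite mul1r.
  - have [/rho_ker[c ec]|rb] := eqVneq (rho b) 0.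
      by left; exists c; rewrite e ec mulrA exprSr.
    by right; exists n, b; rewrite ltnSn mulrC.
  - by right; exists k, u; split=> //; exact: ltnW.
have [[b e]|//] := h l; last by right.
by left; rewrite e t_nil mul0r.
Qed.

Lemma unit_mulI u a : rho u != 0 -> u * a = 0 -> a = 0.
Proof.
by move=> /chain_unit[b e] h; rewrite -[a]mul1r -e mulrAC h mul0r.
Qed.

Lemma tpow_eq0 k : (t ^+ k == 0) = (l <= k)%N.
Proof.
apply/eqP/idP => [h|/subnKC <-]; last by rewrite exprD t_nil mul0r.
rewrite leqNgt; apply/negP => kl; move: t_last.
have /subnKC <- : (k <= l.-1)%N by rewrite -ltnS prednK.
by rewrite exprD h mul0r eqxx.
Qed.

Lemma annih_tpow k a : (k <= l)%N -> t ^+ k * a = 0 <-> exists b, a = t ^+ (l - k) * b.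
Proof.
move=> kl; split=> [|[b ->]]; last by rewrite mulrA -exprD subnKC// t_nil mul0r.
have [->|[m [u [ml ru ->]]]] := chain_factor a; first by exists 0; rewrite mulr0.
rewrite mulrCA -exprD => /(unit_mulI ru)/eqP; rewrite tpow_eq0 -leq_subLR => h.
by exists (t ^+ (m - (l - k)) * u); rewrite mulrA -exprD subnKC// mulrC.
Qed.

Lemma dvd_total (a b : R) : (exists c, a = b * c) \/ (exists c, b = a * c).
Proof.
have [->|[k [u [_ ru ->]]]] := chain_factor a; first by left; exists 0; rewrite mulr0.
have [->|[m [v [_ rv ->]]]] := chain_factor b; first by right; exists 0; rewrite mulr0.
have [u' hu] := chain_unit ru; have [v' hv] := chain_unit rv.
have [h|/ltnW h] := leqP k m; [right; exists (v * u' * t ^+ (m - k))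
  |left; exists (u * v' * t ^+ (k - m))]; rewrite -{1}(subnKC h) exprD.
  by transitivity ((u * u') * (v * (t ^+ k * t ^+ (m - k)))); [rewrite hu mul1r | ring].
by transitivity ((v * v') * (u * (t ^+ m * t ^+ (k - m)))); [rewrite hv mul1r | ring].
Qed.

(* A matrix E complementary to X: the image of each is the kernel of the other. *)
Definition dual_mx n (X E : 'M[R]_n) : Prop :=
  (forall v : 'rV_n, v *m X = 0 <-> exists u, v = u *m E) /\
  (forall v : 'rV_n, v *m E = 0 <-> exists u, v = u *m X).

Lemma dual_mx_equiv n (X E P P' Q Q' : 'M[R]_n) :
  P *m P' = 1%:M -> P' *m P = 1%:M -> Q *m Q' = 1%:M -> Q' *m Q = 1%:M ->
  dual_mx X E -> dual_mx (P *m X *m Q) (Q' *m E *m P').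
Proof.
have h (A B C D G H : 'M[R]_n) : A *m B = 1%:M -> B *m A = 1%:M ->
    C *m D = 1%:M -> D *m C = 1%:M ->
    (forall v : 'rV_n, v *m G = 0 <-> exists u, v = u *m H) ->
    forall v : 'rV_n, v *m (A *m G *m C) = 0 <-> exists u, v = u *m (D *m H *m B).
  move=> AB BA CD DC GH v; split.
    rewrite !mulmxA => e; have : v *m A *m G = 0 by rewrite -[LHS]mulmx1 -CD mulmxA e mul0mx.
    move=> /GH[u hu]; exists (u *m C).
    by rewrite !mulmxA -(mulmxA u) CD mulmx1 -hu -mulmxA AB mulmx1.
  move=> [u ->]; rewrite !mulmxA -(mulmxA _ B) BA mulmx1.
  have /GH e : exists w, u *m D *m H = w *m H by exists (u *m D).
  by rewrite e mul0mx.
by move=> PP' P'P QQ' Q'Q [h1 h2]; split; apply: h.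
Qed.

(** The annihilator of a unit times t^k is (t^(l-k)), and taking annihilators twice gives back
    (t^k). The element 0 is paired with 1. *)
Lemma dual_scalar (a : R) : exists e,
  (forall v, v * a = 0 <-> exists u, v = u * e) /\
  (forall v, v * e = 0 <-> exists u, v = u * a).
Proof.
have [->|[k [u [/ltnW kl ru ->]]]] := chain_factor a.
  exists 1; split=> v; first by split=> [_|_]; [exists v; rewrite mulr1 | rewrite mulr0].
  by rewrite mulr1; split=> [->|[u ->]]; [exists 0; rewrite mul0r | rewrite mulr0].
have [w uw] := chain_unit ru.
exists (t ^+ (l - k)); split=> v; split.
- move=> h.
  have /annih_tpow[//|b ->] : t ^+ k * v = 0 by apply: (unit_mulI ru); rewrite -h; ring.
  by exists b; rewrite mulrC.
- move=> [b ->]; transitivity (b * u * (t ^+ k * t ^+ (l - k))); first by ring.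
  by rewrite -exprD subnKC// t_nil mulr0.
- rewrite mulrC => /annih_tpow[|b]; first exact: leq_subr.
  rewrite subKn// => ->; exists (b * w).
  by transitivity ((u * w) * (t ^+ k * b)); [rewrite uw mul1r | ring].
- move=> [b ->]; transitivity (b * u * (t ^+ k * t ^+ (l - k))); first by ring.
  by rewrite -exprD subnKC// t_nil mulr0.
Qed.

Lemma dual_mx_block n (a e : R) (X E : 'M[R]_n) :
  (forall v, v * a = 0 <-> exists u, v = u * e) ->
  (forall v, v * e = 0 <-> exists u, v = u * a) ->
  dual_mx X E -> dual_mx (block_mx a%:M 0 0 X : 'M[_]_(1 + n)) (block_mx e%:M 0 0 E).
Proof.
have h (a' e' : R) (Y D : 'M[R]_n) : (forall v, v * a' = 0 <-> exists u, v = u * e') ->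
    (forall v : 'rV_n, v *m Y = 0 <-> exists u, v = u *m D) ->
    forall v : 'rV_(1 + n), v *m (block_mx a'%:M 0 0 Y : 'M[_]_(1 + n)) = 0 <->
      exists u : 'rV_(1 + n), v = u *m (block_mx e'%:M 0 0 D : 'M[_]_(1 + n)).
  move=> ha hY v; rewrite -[v]hsubmxK [lsubmx v]mx11_scalar.
  set x := lsubmx v 0 0; set w := rsubmx v.
  rewrite mul_row_block !mulmx0 addr0 add0r -scalar_mxM; split.
    rewrite -row_mx0 => /eq_row_mx[/matrixP/(_ 0 0) /[!mxE] /= /[!mulr1n] /ha[u ->]].
    move=> /hY[z ->]; exists (row_mx u%:M z).
    by rewrite mul_row_block !mulmx0 addr0 add0r -scalar_mxM.
  move=> [u]; rewrite -[u]hsubmxK [lsubmx u]mx11_scalar mul_row_block !mulmx0 addr0 add0r.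
  rewrite -scalar_mxM => /eq_row_mx[/matrixP/(_ 0 0) /[!mxE] /= /[!mulr1n] hx hw].
  have /ha -> : exists u0, x = u0 * e' by eexists; exact: hx.
  have /hY -> : exists u0, w = u0 *m D by eexists; exact: hw.
  by rewrite raddf0 row_mx0.
by move=> h1 h2 [h3 h4]; split; apply: h.
Qed.

(** The principal ideals form a chain, so an entry generating the largest one divides all the
    others. This entry is the pivot of the diagonalization. *)
Lemma dvd_all_entry n (X : 'M[R]_n.+1) :
  exists i j, forall i' j', exists c, X i' j' = X i j * c.
Proof.
pose I (a : R) : pred R := fun b => [exists c, b == a * c].
pose m (p : 'I_n.+1 * 'I_n.+1) := #|I (X p.1 p.2)|.
case: (@arg_maxnP _ (0, 0) xpredT m) => // -[i j] _ hmax.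
exists i, j => i' j'; have [//|[c ec]] := dvd_total (X i' j') (X i j).
have sub : I (X i j) \subset I (X i' j').
  by apply/fintype.subsetP => b /existsP[d /eqP ->]; apply/existsP; exists (c * d);
    rewrite ec mulrA.
have e : #|I (X i j)| = #|I (X i' j')|.
  by apply/eqP; rewrite eqn_leq subset_leq_card//=; exact: (hmax (i', j')).
have : X i' j' \in I (X i j) by rewrite (subset_cardP e sub); apply/existsP; exists 1;
  rewrite mulr1.
by move=> /existsP[d /eqP ->]; exists d.
Qed.

Lemma tperm_mxK n (i j : 'I_n) : tperm_mx i j *m tperm_mx i j = 1%:M :> 'M[R]_n.
Proof. by rewrite /tperm_mx -perm_mxM tperm2 perm_mx1. Qed.

(** Smith reduction: a pivot dividing every entry is moved to the corner, its row and column are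
    cleared, and the induction continues on the Schur complement. Duality is blockwise on diagonal
    blocks and transported by equivalence. *)
Lemma dual_mx_exists n (X : 'M[R]_n) : exists E, dual_mx X E.
Proof.
elim: n X => [|n IH] X.
  by exists 0; split=> v; rewrite [v]thinmx0 mul0mx; split=> // _; exists 0; rewrite mul0mx.
have [i [j hX]] := dvd_all_entry X.
(* [Y] is X with the pivot moved to position (0, 0). *)
pose Y : 'M[_]_(1 + n) := xcol 0 j (xrow 0 i X); pose a := X i j.
have XY : X = tperm_mx 0 i *m Y *m tperm_mx 0 j.
  by rewrite /Y xcolE xrowE !mulmxA tperm_mxK mul1mx -mulmxA tperm_mxK mulmx1.
have hY i' j' : exists c, Y i' j' = a * c by rewrite /Y !mxE; exact: hX.
have Y00 : ulsubmx Y = a%:M.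
  by rewrite [LHS]mx11_scalar !mxE !lshift0 !tpermL.
have [r hr] : exists r, ursubmx Y = a *: r.
  have [c hc] := fin_all_exists (fun k => hY (lshift n (0 : 'I_1)) (rshift 1 k)).
  by exists (\row_k c k); apply/rowP => k; rewrite !mxE -hc !mxE.
have [s hs] : exists s, dlsubmx Y = a *: s.
  have [c hc] := fin_all_exists (fun k => hY (rshift 1 k) (lshift n (0 : 'I_1))).
  by exists (\col_k c k); apply/colP => k; rewrite !mxE -hc !mxE.
have [E hE] := IH (drsubmx Y - a *: (s *m r)).
have [e [h1 h2]] := dual_scalar a.
have {hE}hE := dual_mx_block h1 h2 hE.
pose L (s : 'cV[R]_n) : 'M[_]_(1 + n) := block_mx 1%:M 0 s 1%:M.
pose U (r : 'rV[R]_n) : 'M[_]_(1 + n) := block_mx 1%:M r 0 1%:M.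
have LL x y : L x *m L y = L (x + y).
  by rewrite /L mulmx_block !mul0mx !mulmx0 !mul1mx !mulmx1 !addr0 add0r.
have UU x y : U x *m U y = U (x + y).
  by rewrite /U mulmx_block !mul0mx !mulmx0 !mul1mx !mulmx1 !addr0 add0r addrC.
have L0 : L 0 = 1%:M by rewrite /L -scalar_mx_block.
have U0 : U 0 = 1%:M by rewrite /U -scalar_mx_block.
have YLU : Y = L s *m block_mx a%:M 0 0 (drsubmx Y - a *: (s *m r)) *m U r.
  rewrite /L /U !mulmx_block !mul0mx !mulmx0 !mul1mx !mulmx1 !addr0 !add0r.
  rewrite -{1}[Y]submxK Y00 hr hs mul_scalar_mx mul_mx_scalar -scalemxAl.
  by rewrite addrC subrK.
have := dual_mx_equiv (P := L s) (P' := L (- s)) (Q := U r) (Q' := U (- r)).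
rewrite !LL !UU subrr addNr subrr addNr L0 U0 => /(_ _ _ erefl erefl erefl erefl hE).
rewrite -YLU => hYE.
have := dual_mx_equiv (tperm_mxK 0 i) (tperm_mxK 0 i) (tperm_mxK 0 j) (tperm_mxK 0 j) hYE.
by rewrite -XY => ?; eexists; eassumption.
Qed.

End ChainRing.

(** * Modules over a finite chain ring: generators and Nakayama's lemma *)

Section Submodules.
Variables (R : finComNzRingType) (M : finLmodType R).

(** The product of a coefficient row with a tuple of module elements, which is not a matrix product
    because [M] is no ring. *)
Definition lc n (v : 'rV[R]_n) (h : 'rV[M]_n) : M := \sum_i v 0 i *: h 0 i.

Definition is_submod (S : pred M) : Prop :=
  S 0 /\ forall a x y, S x -> S y -> S (a *: x + y).

Definition lspan n (h : 'rV[M]_n) : pred M := fun x => [exists v, lc v h == x].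

Definition tmul (t : R) (S : pred M) : pred M := fun x => [exists y, S y && (x == t *: y)].

Lemma lcP n (a : R) (u v : 'rV[R]_n) (h : 'rV[M]_n) : lc (a *: u + v) h = a *: lc u h + lc v h.
Proof.
rewrite /lc scaler_sumr -big_split/=; apply: eq_bigr => i _.
by rewrite !mxE scalerDl scalerA.
Qed.

Lemma lcZ n (a : R) (u : 'rV[R]_n) (h : 'rV[M]_n) : lc (a *: u) h = a *: lc u h.
Proof. by rewrite /lc scaler_sumr; apply: eq_bigr => i _; rewrite mxE scalerA. Qed.

Lemma lc0 n (h : 'rV[M]_n) : lc 0 h = 0.
Proof. by rewrite -[0](scale0r 0) lcZ scale0r. Qed.

Lemma lcD n (u v : 'rV[R]_n) (h : 'rV[M]_n) : lc (u + v) h = lc u h + lc v h.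
Proof. by rewrite -[u in LHS]scale1r lcP scale1r. Qed.

Lemma lcN n (u : 'rV[R]_n) (h : 'rV[M]_n) : lc (- u) h = - lc u h.
Proof. by rewrite -[- u]scaleN1r lcZ scaleN1r. Qed.

Lemma lcB n (u v : 'rV[R]_n) (h : 'rV[M]_n) : lc (u - v) h = lc u h - lc v h.
Proof. by rewrite lcD lcN. Qed.

Lemma lc_row n m (u : 'rV[R]_n) (v : 'rV[R]_m) (h : 'rV[M]_n) (k : 'rV[M]_m) :
  lc (row_mx u v) (row_mx h k) = lc u h + lc v k.
Proof.
by rewrite /lc big_split_ord/=; congr (_ + _); apply: eq_bigr => i _;
  rewrite ?row_mxEl ?row_mxEr.
Qed.

Lemma lc1 (a : R) (x : M) : lc (a%:M : 'rV_1) (const_mx x) = a *: x.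
Proof. by rewrite /lc big_ord1 !mxE eqxx. Qed.

Lemma lc_delta n (i : 'I_n) (h : 'rV[M]_n) : lc (delta_mx 0 i) h = h 0 i.
Proof.
rewrite /lc (bigD1 i)//= mxE !eqxx scale1r big1 ?addr0// => j ji.
by rewrite mxE (negPf ji) andbF scale0r.
Qed.

Lemma submodD (S : pred M) x y : is_submod S -> S x -> S y -> S (x + y).
Proof. by move=> [_ h] Sx Sy; rewrite -[x]scale1r; apply: h. Qed.

Lemma submodZ (S : pred M) a x : is_submod S -> S x -> S (a *: x).
Proof. by move=> [S0 h] Sx; rewrite -[a *: x]addr0; apply: h. Qed.

Lemma submodN (S : pred M) x : is_submod S -> S x -> S (- x).
Proof. by move=> sS Sx; rewrite -scaleN1r; apply: submodZ. Qed.

Lemma submodB (S : pred M) x y : is_submod S -> S x -> S y -> S (x - y).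
Proof. by move=> sS Sx Sy; apply: submodD => //; apply: submodN. Qed.

Lemma submod_lc (S : pred M) n (v : 'rV[R]_n) (h : 'rV[M]_n) :
  is_submod S -> (forall i, S (h 0 i)) -> S (lc v h).
Proof.
move=> sS Sh; rewrite /lc; elim/big_rec: _ => [|i x _ Sx]; first by case: sS.
by apply: submodD => //; apply: submodZ.
Qed.

Lemma tmul_submod t (S : pred M) : is_submod S -> is_submod (tmul t S).
Proof.
move=> sS; split.
  by apply/existsP; exists 0; rewrite scaler0 eqxx andbT; case: sS.
move=> a x y /existsP[u /andP[Su /eqP ->]] /existsP[v /andP[Sv /eqP ->]].
apply/existsP; exists (a *: u + v); rewrite scalerDr !scalerA mulrC eqxx andbT.
by case: sS => _; apply.
Qed.

Lemma tmul_sub t (S : pred M) x : is_submod S -> tmul t S x -> S x.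
Proof. by move=> sS /existsP[y /andP[Sy /eqP ->]]; apply: submodZ. Qed.

Lemma tmulI t (S : pred M) x : S x -> tmul t S (t *: x).
Proof. by move=> Sx; apply/existsP; exists x; rewrite Sx eqxx. Qed.

End Submodules.

Section ChainModules.
Variables (R : finComNzRingType) (F : finFieldType) (rho : {rmorphism R -> F}).
Variables (t : R) (l : nat).
Hypothesis ut : uniformizer rho t l.
Variable M : finLmodType R.
Implicit Type S : pred M.

Let rho_surj x : exists a, rho a = x. Proof. by have [] := ut. Qed.
Let rho_ker a : rho a = 0 <-> exists b, a = t * b.
Proof. by have [_ h _ _ _] := ut; exact: h. Qed.

Local Notation red := (map_mx rho).

Lemma red_surj m n (A : 'M[F]_(m, n)) : exists B, red B = A.
Proof.
have [f hf] := fin_all_exists (fun p : 'I_m * 'I_n => rho_surj (A p.1 p.2)).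
by exists (\matrix_(i, j) f (i, j)); apply/matrixP => i j; rewrite !mxE hf.
Qed.

Lemma red_ker m n (A : 'M[R]_(m, n)) : red A = 0 <-> exists B, A = t *: B.
Proof.
split=> [/matrixP h|[B ->]]; last first.
  by apply/matrixP => i j; rewrite !mxE rmorphM (rho_t ut) mul0r.
have hA (p : 'I_m * 'I_n) : exists b, A p.1 p.2 = t * b.
  by apply/rho_ker; have := h p.1 p.2; rewrite !mxE.
have [f hf] := fin_all_exists hA.
by exists (\matrix_(i, j) f (i, j)); apply/matrixP => i j; rewrite !mxE -hf.
Qed.

(* phi identifies S / tS with F^r *)
Definition coords (S : pred M) r (phi : M -> 'rV[F]_r) : Prop :=
  [/\ forall a x y, S x -> S y -> phi (a *: x + y) = rho a *: phi x + phi y,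
      forall w, exists2 x, S x & phi x = w
    & forall x, S x -> (phi x == 0) = tmul t S x].

(** A family of maximal length that is independent modulo tS is a basis of S / tS; the coordinates
    of x are the residues of the coefficients of x in it. *)
Lemma coords_exists S : is_submod S -> exists r (phi : M -> 'rV[F]_r), coords S phi.
Proof.
move=> sS.
pose indep n (h : 'rV[M]_n) := [forall i, S (h 0 i)] &&
  [forall v : 'rV[R]_n, tmul t S (lc v h) ==> (red v == 0)].
have stS := tmul_submod t sS.
have ex0 : exists n, [exists h : 'rV[M]_n, indep n h].
  exists 0%N; apply/existsP; exists 0; apply/andP; split.
    by apply/forallP => -[].
  by apply/forallP => v; apply/implyP => _; apply/eqP/rowP => -[].
(* An independent family of length n embeds F^n into [M], so n <= 2^n <= |M|. *)
have bnd n : [exists h : 'rV[M]_n, indep n h] -> (n <= #|M|)%N.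
  move=> /existsP[h /andP[_ /forallP hi]].
  have [g hg] := fin_all_exists (fun w : 'rV[F]_n => red_surj w).
  have inj : injective (fun w => lc (g w) h).
    move=> w w' e; apply/eqP; rewrite -subr_eq0 -(hg w) -(hg w') -raddfB/=.
    by apply: (implyP (hi _)); rewrite lcB e subrr; case: stS.
  have := leq_card _ inj; rewrite card_mx mul1n; apply: leq_trans.
  apply: ltnW; apply: (leq_trans (ltn_expl n (ltnSn 1))).
  by elim: n {h hi g hg inj} => // m IH; rewrite !expnS leq_mul ?card_finNzRing_gt1.
case: (ex_maxnP ex0 bnd) => n /existsP[h /andP[/forallP Sh /forallP hi]] nmax.
have hi' v : tmul t S (lc v h) -> red v = 0 by move=> /(implyP (hi v))/eqP.
(* Otherwise x could be appended: in a relation modulo tS a unit coefficient of x would express x by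
   the family, and a coefficient in (t) lets that term be dropped. *)
have gen x : S x -> exists v, tmul t S (x - lc v h).
  move=> Sx; apply/existsP; apply: contraT => /existsPn no; exfalso.
  suff : (n + 1 <= n)%N by rewrite addn1 ltnn.
  apply: nmax; apply/existsP; exists (row_mx h (const_mx x)); apply/andP; split.
    apply/forallP => i; case: (split_ordP i) => j ->; first by rewrite row_mxEl.
    by rewrite row_mxEr mxE.
  apply/forallP => w; apply/implyP; rewrite -[w]hsubmxK [rsubmx w]mx11_scalar.
  set v := lsubmx w; set c := _ 0 0; rewrite lc_row lc1 => tw.
  have [c0|c0] := eqVneq (rho c) 0; last first.
    have [d cd] := chain_unit ut c0; case/negP: (no (- (d *: v))).
    rewrite lcN opprK lcZ -[x in X in tmul _ _ X]scale1r -cd mulrC -scalerA -scalerDr addrC.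
    exact: submodZ.
  have [b eb] := (rho_ker c).1 c0.
  have tv : tmul t S (lc v h).
    rewrite -[lc v h](addrK (c *: x)); apply: submodB => //.
    by rewrite eb -scalerA; apply/tmulI/submodZ.
  rewrite map_row_mx (hi' _ tv) map_scalar_mx/= c0.
  by rewrite raddf0 row_mx0.
pose phi x : 'rV[F]_n := if [pick v | tmul t S (x - lc v h)] is Some v then red v else 0.
have phiE x v : S x -> tmul t S (x - lc v h) -> phi x = red v.
  move=> Sx hv; rewrite /phi; case: pickP => [u hu|/(_ v)]; last by rewrite hv.
  apply/eqP; rewrite -subr_eq0 -raddfB/=; apply/eqP/hi'; rewrite lcB.
  have -> : lc u h - lc v h = (x - lc v h) - (x - lc u h).
    by rewrite opprB [RHS]addrC addrA subrK.
  exact: submodB.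
have phiS v : phi (lc v h) = red v.
  by apply: phiE; [exact: submod_lc | rewrite subrr; case: stS].
exists n, phi; split.
- move=> a x y Sx Sy; have [u hu] := gen x Sx; have [v hv] := gen y Sy.
  rewrite (phiE x u)// (phiE y v)// (phiE _ (a *: u + v)).
  + by rewrite raddfD/= map_mxZ.
  + by case: sS => _; apply.
  + rewrite lcP opprD addrACA -scalerBr; case: stS => _; apply; exact: hu || exact: hv.
- by move=> w; have [v <-] := red_surj w; exists (lc v h); [exact: submod_lc|exact: phiS].
- move=> x Sx; have [v hv] := gen x Sx; rewrite (phiE _ v)//.
  apply/eqP/idP => [/red_ker[b e]|tx].
    rewrite -[x](subrK (lc v h)); apply: submodD => //.
    by rewrite e lcZ; apply: tmulI; exact: submod_lc.
  by apply: hi'; rewrite -[lc v h](subKr x); apply: submodB.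
Qed.

Lemma coords_card S r (phi : M -> 'rV[F]_r) : is_submod S -> coords S phi ->
  #|S| = (#|F| ^ r * #|tmul t S|)%N.
Proof.
move=> sS [lin surj ker].
have e x : tmul t S x = S x && (phi x == 0).
  case: (boolP (S x)) => [Sx|nSx] /=; first by rewrite ker.
  by apply/negbTE/negP => tx; rewrite (tmul_sub sS tx) in nSx.
have <- : #|[pred x : M | S x && (phi x == 0)]| = #|tmul t S|.
  by apply: eq_card => x; rewrite inE/= -topredE/= e.
have phiB x y : S x -> S y -> phi (x - y) = phi x - phi y.
  move=> Sx Sy; have := lin (-1) y x Sy Sx.
  by rewrite scaleN1r rmorphN rmorph1 scaleN1r addrC => ->; rewrite addrC.
have := @card_preim_additive M _ S phi _ _ phiB xpredT.
have -> : #|(xpredT : pred 'rV[F]_r)| = (#|F| ^ r)%N.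
  by rewrite -[in RHS](mul1n r) -card_mx.
move=> <-; first by apply: eq_card => x; rewrite inE/= andbT.
- by case: sS.
- by move=> x y; exact: submodB.
- by move=> b _; exact: surj.
Qed.

(** Approximating by the span of [h] pushes the error from t^k S into t^(k+1) S, and t^l = 0. *)
Lemma nakayama S n (h : 'rV[M]_n) : is_submod S -> (forall i, S (h 0 i)) ->
  (forall x, S x -> exists v, tmul t S (x - lc v h)) -> forall x, S x -> lspan h x.
Proof.
move=> sS Sh hS.
suff H k x : S x -> exists v y, S y /\ x = lc v h + t ^+ k *: y.
  move=> x Sx; have [v [y [_ ->]]] := H l x Sx.
  have [_ _ _ -> _] := ut; rewrite scale0r addr0.
  by apply/existsP; exists v.
elim: k x => [|k IH] x Sx.
  by exists 0, x; rewrite lc0 add0r scale1r.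
have [v [y [Sy ->]]] := IH x Sx.
have [u /existsP[z /andP[Sz /eqP e]]] := hS y Sy.
exists (v + t ^+ k *: u), z; split=> //.
by rewrite lcD lcZ -addrA exprSr -scalerA -scalerDr -e [lc u h + _]addrC subrK.
Qed.

Lemma coords_lc S r (phi : M -> 'rV[F]_r) n (v : 'rV[R]_n) (h : 'rV[M]_n) :
  is_submod S -> coords S phi -> (forall i, S (h 0 i)) ->
  phi (lc v h) = red v *m (\matrix_i phi (h 0 i)).
Proof.
move=> sS [lin surj ker] Sh.
have phi0 : phi 0 = 0.
  by apply/eqP; rewrite ker; [case: (tmul_submod t sS)|case: sS].
suff [_ ->] : S (lc v h) /\ phi (lc v h) = \sum_i rho (v 0 i) *: phi (h 0 i).
  by rewrite mulmx_sum_row; apply: eq_bigr => i _; rewrite rowK mxE.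
rewrite /lc; elim/big_rec2: _ => [|i y x _ [Sx <-]]; first by split=> //; case: sS.
by split; [apply: submodD => //; exact: submodZ | rewrite lin].
Qed.

(** By Nakayama a tuple generates S exactly when its coordinate matrix has full rank r, and each
    such matrix lifts to |tS|^n tuples. *)
Lemma card_gens S r (phi : M -> 'rV[F]_r) n : is_submod S -> coords S phi ->
  #|[pred h : 'rV[M]_n | [forall i, S (h 0 i)] && [forall x, S x ==> lspan h x]]| =
  (full_count #|F| n r * #|tmul t S| ^ n)%N.
Proof.
move=> sS cS; have [lin surj ker] := cS.
pose f (h : 'rV[M]_n) : 'M[F]_(n, r) := \matrix_i phi (h 0 i).
pose SS (h : 'rV[M]_n) := [forall i, S (h 0 i)].
have phiB x y : S x -> S y -> phi (x - y) = phi x - phi y.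
  move=> Sx Sy; have := lin (-1) y x Sy Sx.
  by rewrite scaleN1r rmorphN rmorph1 scaleN1r addrC => ->; rewrite addrC.
have -> : #|[pred h : 'rV[M]_n | SS h && [forall x, S x ==> lspan h x]]| =
   #|[pred h | SS h && row_full (f h)]|.
  apply: eq_card => h; rewrite !inE; case: (boolP (SS h)) => //= /forallP Sh.
  apply/forallP/idP => [gen|full x].
    rewrite -sub1mx; apply/row_subP => i; have [x Sx ex] := surj (row i 1%:M).
    have /existsP[v /eqP e] := implyP (gen x) Sx.
    by rewrite -ex -e (coords_lc _ sS cS Sh) submxMl.
  apply/implyP; apply: (nakayama sS Sh) => {}x Sx.
  have /submxP[w ew] : (phi x <= f h)%MS by rewrite submx_full.
  have [v ev] := red_surj w; exists v.
  have Sv : S (lc v h) by exact: submod_lc.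
  by rewrite -ker ?phiB ?(coords_lc _ sS cS Sh) ?ev -?ew ?subrr//; exact: submodB.
rewrite -card_row_full; apply: card_fibers => A _.
transitivity #|[pred h : 'rV[M]_n | [forall i, S (h 0 i) && (phi (h 0 i) == row i A)]]|.
  apply: eq_card => h; rewrite !inE; apply/andP/forallP => [[/forallP Sh /eqP <-] i|hh].
    by rewrite Sh rowK eqxx.
  split; first by apply/forallP => i; case/andP: (hh i).
  by apply/eqP/row_matrixP => i; rewrite rowK; case/andP: (hh i) => _ /eqP.
rewrite (@card_row_forall M n (fun i => [pred x | S x && (phi x == row i A)])).
rewrite -[RHS](_ : (\prod_(i < n) #|tmul t S| = _)%N); last by rewrite prod_nat_const card_ord.
apply: eq_bigr => i _; have [a Sa <-] := surj (row i A).
rewrite card_fiber_additive//.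
- apply: eq_card => x; rewrite inE/= -[in RHS]topredE/=.
  case: (boolP (S x)) => [Sx|nSx] /=; first by rewrite ker.
  by apply/esym/negbTE/negP => tx; rewrite (tmul_sub sS tx) in nSx.
- by case: sS.
- by move=> x y; exact: submodB.
Qed.

End ChainModules.

(** * Presentations of modules over a chain ring *)

Section Presentations.
Variable R : finComNzRingType.

(** Exactness of R^m -> R^n -> M -> 0, the first map being v -> v X and the second given by the
    generators [h]. *)
Definition pres (M : finLmodType R) m n (X : 'M[R]_(m, n)) (h : 'rV[M]_n) : bool :=
  [forall x, lspan h x] &&
  [forall v : 'rV[R]_n, (lc v h == 0) == [exists u : 'rV[R]_m, v == u *m X]].

Lemma presP (M : finLmodType R) m n (X : 'M[R]_(m, n)) (h : 'rV[M]_n) :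
  reflect ((forall x, exists v, lc v h = x) /\
           (forall v, lc v h = 0 <-> exists u, v = u *m X)) (pres X h).
Proof.
apply: (iffP andP) => [[/forallP h1 /forallP h2]|[h1 h2]]; split.
- by move=> x; have /existsP[v /eqP <-] := h1 x; exists v.
- move=> v; have /eqP e := h2 v; split=> [/eqP|[u eu]].
    by rewrite e => /existsP[u /eqP]; exists u.
  by apply/eqP; rewrite e; apply/existsP; exists u; apply/eqP.
- by apply/forallP => x; have [v e] := h1 x; apply/existsP; exists v; apply/eqP.
- apply/forallP => v; apply/eqP; apply/idP/existsP => [/eqP/h2[u ->]|[u /eqP hu]];
  first by exists u.
  by apply/eqP/h2; exists u.
Qed.

Definition cokis (M : finLmodType R) m n (X : 'M[R]_(m, n)) : bool :=
  [exists h : 'rV[M]_n, pres X h].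

Definition is_lin (M M' : finLmodType R) (f : M -> M') : bool :=
  [forall a, forall x, forall y, f (a *: x + y) == a *: f x + f y].

Lemma is_linP (M M' : finLmodType R) (f : M -> M') :
  reflect (linear f) (is_lin f).
Proof.
apply: (iffP forallP) => [h a x y|h a].
  by have /forallP/(_ x)/forallP/(_ y)/eqP := h a.
by apply/forallP => x; apply/forallP => y; apply/eqP/h.
Qed.

Definition aut_count (M : finLmodType R) := #|[pred s : {perm M} | is_lin s]|.

Lemma lin_lc (M M' : finLmodType R) (f : M -> M') n (v : 'rV[R]_n) (h : 'rV[M]_n) :
  linear f -> f (lc v h) = lc v (map_mx f h).
Proof.
move=> lf; pose fl := HB.pack_for {linear M -> M'} f (GRing.isLinear.Build _ _ _ _ f lf).
have -> : f = fl by [].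
by rewrite /lc linear_sum; apply: eq_bigr => i _; rewrite linearZ mxE.
Qed.

Lemma pres_map (M M' : finLmodType R) (f : M -> M') m n (X : 'M[R]_(m, n)) (h : 'rV[M]_n) :
  linear f -> bijective f -> pres X h -> pres X (map_mx f h).
Proof.
move=> lf [g fg gf] /presP[h1 h2]; apply/presP; split=> [x|v].
  by have [v e] := h1 (g x); exists v; rewrite -lin_lc// e gf.
have f0 : f 0 = 0 by have := lf 1 0 0; rewrite !scale1r !addr0 => /esym/eqP;
  rewrite -subr_eq0 addrK => /eqP.
rewrite -h2 -lin_lc//; split=> [e|->//].
by rewrite -[LHS]fg e -{1}f0 fg.
Qed.

Lemma pres_iso (M M' : finLmodType R) m n (X : 'M[R]_(m, n)) (h : 'rV[M]_n) (h' : 'rV[M']_n) :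
  pres X h -> pres X h' ->
  exists f : M -> M', [/\ linear f, bijective f & map_mx f h = h'].
Proof.
have key (N N' : finLmodType R) (k : 'rV[N]_n) (k' : 'rV[N']_n) : pres X k -> pres X k' ->
    exists f : N -> N', forall v, f (lc v k) = lc v k'.
  move=> /presP[h1 h2] /presP[h1' h2'].
  have [g hg] := fin_all_exists h1.
  exists (fun x => lc (g x) k') => v; apply/eqP; rewrite -subr_eq0 -lcB; apply/eqP.
  by apply/h2'/h2; rewrite lcB hg subrr.
move=> p p'; have [f hf] := key _ _ _ _ p p'; have [g hg] := key _ _ _ _ p' p.
move: p p' => /presP[h1 h2] /presP[h1' h2'].
exists f; split.
- move=> a x y; have [u <-] := h1 x; have [v <-] := h1 y.
  by rewrite -lcP !hf lcP.
- exists g => x; first by have [u <-] := h1 x; rewrite hf hg.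
  by have [u <-] := h1' x; rewrite hg hf.
- by apply/rowP => i; rewrite mxE -lc_delta hf lc_delta.
Qed.

(** Two generating tuples with the same relations differ by a unique automorphism, so Aut M acts
    simply transitively on them. *)
Lemma card_pres (M : finLmodType R) m n (X : 'M[R]_(m, n)) :
  cokis M X -> #|[pred h : 'rV[M]_n | pres X h]| = aut_count M.
Proof.
move=> /existsP[h ph]; have /presP[h1 h2] := ph.
have inj : {in [pred s : {perm M} | is_lin s] &, injective (fun s : {perm M} => map_mx s h)}.
  move=> s s' /is_linP ls /is_linP ls' /= e; apply/permP => x; have [v <-] := h1 x.
  by rewrite (lin_lc _ _ ls) (lin_lc _ _ ls') e.
rewrite /aut_count -(card_in_image inj); apply: eq_card => h'.
apply/idP/fintype.imageP => [ph'|[s /is_linP ls ->]].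
  have [f [lf bf e]] := pres_iso ph ph'.
  exists (perm (bij_inj bf)); first by apply/is_linP => a x y; rewrite !permE; exact: lf.
  by rewrite -e; apply/rowP => i; rewrite !mxE permE.
by rewrite inE; apply: pres_map => //; exists (s^-1)%g; [exact: permK | exact: permKV].
Qed.

Lemma cokis_iso (M M' : finLmodType R) (f : M -> M') m n (X : 'M[R]_(m, n)) :
  linear f -> bijective f -> cokis M X -> cokis M' X.
Proof. by move=> lf bf /existsP[h ph]; apply/existsP; exists (map_mx f h); exact: pres_map. Qed.

Lemma card_cokis_pairs (M : finLmodType R) n :
  (#|[pred X : 'M[R]_n | cokis M X]| * aut_count M)%N =
  #|[pred p : 'M[R]_n * 'rV[M]_n | pres p.1 p.2]|.
Proof.
have H (X : 'M[R]_n) : [pred X : 'M[R]_n | cokis M X] X ->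
    #|[pred h : 'rV[M]_n | pres X h]| = aut_count M by exact: card_pres.
rewrite -(card_pairs H); apply: eq_card => -[X h]; rewrite !inE/=.
by case p: (pres X h); rewrite ?andbF// andbT; apply/existsP; exists h.
Qed.

Lemma cokis_equiv (M : finLmodType R) n (X P P' Q Q' : 'M[R]_n) :
  P *m P' = 1%:M -> P' *m P = 1%:M -> Q *m Q' = 1%:M -> Q' *m Q = 1%:M ->
  cokis M X -> cokis M (P *m X *m Q).
Proof.
move=> PP' P'P QQ' Q'Q /existsP[h /presP[h1 h2]].
pose h' := \row_i lc (row i Q') h.
have E v : lc v h' = lc (v *m Q') h.
  rewrite /lc; under eq_bigr do rewrite mxE scaler_sumr.
  rewrite exchange_big/=; apply: eq_bigr => j _; rewrite mxE scaler_suml.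
  by apply: eq_bigr => i _; rewrite mxE scalerA.
apply/existsP; exists h'; apply/presP; split=> [x|v].
  by have [v <-] := h1 x; exists (v *m Q); rewrite E -mulmxA QQ' mulmx1.
rewrite E h2; split=> [[u e]|[u ->]].
  exists (u *m P'); rewrite !mulmxA -(mulmxA u) P'P mulmx1 -e -mulmxA Q'Q mulmx1//.
by exists (u *m P); rewrite -!mulmxA QQ' mulmx1.
Qed.

End Presentations.

Section ChainPresentations.
Variables (R : finComNzRingType) (F : finFieldType) (rho : {rmorphism R -> F}).
Variables (t : R) (l : nat).
Hypothesis ut : uniformizer rho t l.

Local Notation red := (map_mx rho).
Local Notation q := #|F|.

Let q_gt1 : (1 < q)%N. Proof. exact: card_finNzRing_gt1. Qed.

Lemma card_tmul (M : finLmodType R) (S : pred M) : is_submod S ->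
  #|S| = (#|tmul t S| * #|[pred x | S x && (t *: x == 0%R)]|)%N.
Proof.
move=> sS; rewrite -(@card_preim_additive _ _ S ( *:%R t) _ _ _ (tmul t S)).
- apply: eq_card => x; rewrite inE/= -[in LHS]topredE/=.
  by case Sx: (S x) => //=; rewrite tmulI.
- by case: sS.
- by move=> x y; exact: submodB.
- by move=> x y _ _; rewrite scalerBr.
- by move=> b /existsP[x /andP[Sx /eqP ->]]; exists x.
Qed.

Lemma predT_submod (M : finLmodType R) : is_submod (xpredT : pred M).
Proof. by []. Qed.

Lemma tmul_gt0 (M : finLmodType R) (S : pred M) : is_submod S -> (0 < #|tmul t S|)%N.
Proof.
by move=> sS; apply/card_gt0P; exists 0; rewrite -topredE/=; case: (tmul_submod t sS).
Qed.

Lemma coords_row n : coords rho t (xpredT : pred 'rV[R]_n) (fun v : 'rV[R]_n => red v).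
Proof.
split=> [a x y _ _|w|x _]; first by rewrite raddfD/= map_mxZ.
  by have [v <-] := red_surj ut w; exists v.
apply/eqP/existsP => [/(red_ker ut)[b ->]|[b /andP[_ /eqP ->]]].
  by exists b; rewrite eqxx.
by apply/(red_ker ut); exists b.
Qed.

(** The index of t R^n in R^n is computed twice: by reduction it is q^n, and through multiplication
    by t it is the order of the torsion. *)
Lemma card_torsion n : #|[pred v : 'rV[R]_n | t *: v == 0]| = (q ^ n)%N.
Proof.
have := card_tmul (@predT_submod 'rV[R]_n).
rewrite (coords_card (@predT_submod _) (coords_row n)) mulnC => /eqP.
by rewrite eqn_pmul2l ?tmul_gt0// => /eqP ->.
Qed.

Definition rels (M : finLmodType R) n (h : 'rV[M]_n) : pred 'rV[R]_n :=
  fun v => lc v h == 0.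

Lemma rels_submod (M : finLmodType R) n (h : 'rV[M]_n) : is_submod (rels h).
Proof.
split; first by rewrite /rels lc0.
by move=> a x y /eqP hx /eqP hy; rewrite /rels lcP hx hy scaler0 addr0.
Qed.

Lemma card_rels (M : finLmodType R) n (h : 'rV[M]_n) : [forall x, lspan h x] ->
  (#|rels h| * #|M|)%N = (#|R| ^ n)%N.
Proof.
move=> /forallP gen.
have := @card_preim_additive _ _ (xpredT : pred 'rV[R]_n) (fun v => lc v h) erefl
  (fun _ _ _ _ => erefl) (fun x y _ _ => lcB x y h) xpredT.
have sur b : xpredT b -> exists2 a : 'rV_n, true & lc a h = b.
  by move=> _; have /existsP[v /eqP <-] := gen b; exists v.
move=> /(_ sur) e; transitivity #|[pred v : 'rV[R]_n | true]|.
  by rewrite e mulnC; congr (_ * _)%N.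
by rewrite [LHS]card_mx mul1n.
Qed.

(** Since t^(l-1) kills M, all t-torsion vectors of R^n are relations. So S = [rels h] satisfies |S
    / tS| = q^n, and the presenting matrices are the generating n-tuples of S, counted by
    [card_gens]. The second equation shows that |tS| does not depend on [h]. *)
Lemma card_pres_mx (M : finLmodType R) r (phi : M -> 'rV[F]_r) n (h : 'rV[M]_n) :
  (forall x : M, t ^+ l.-1 *: x = 0) -> coords rho t xpredT phi ->
  [forall x, lspan h x] ->
  (#|[pred X : 'M[R]_n | pres X h]| = full_count q n n * #|tmul t (rels h)| ^ n)%N /\
  (q ^ n * #|tmul t (rels h)| * #|M| = #|R| ^ n)%N.
Proof.
move=> kM cM gen; have sS := rels_submod h; set S := rels h in sS *.
have [_ _ l_gt0 tl _] := ut.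
have cS : #|S| = (q ^ n * #|tmul t S|)%N.
  rewrite (card_tmul sS) mulnC -card_torsion; congr (_ * _)%N; apply: eq_card => v.
  rewrite !inE andbC; case: eqP => //= e; rewrite /S /rels.
  (* A vector killed by t has its entries in (t^(l-1)). *)
  have : exists b, v = t ^+ l.-1 *: b.
    have hv i : exists b, v 0 i = t ^+ (l - 1) * b.
      by apply/(annih_tpow ut) => //; have /rowP/(_ i) := e; rewrite !mxE expr1.
    have [f hf] := fin_all_exists hv.
    by exists (\row_i f i); apply/rowP => i; rewrite !mxE hf subn1.
  by move=> [b ->]; rewrite lcZ kM eqxx.
split; last by rewrite -cS card_rels.
have [s [psi cpsi]] := coords_exists ut sS.
have es : s = n.
  have := coords_card sS cpsi; rewrite cS => /eqP; rewrite eqn_pmul2r ?tmul_gt0//.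
  by rewrite eqn_exp2l// => /eqP.
have lcE (u : 'rV[R]_n) (X : 'M[R]_n) : lc u (\row_i row i X) = u *m X.
  by rewrite mulmx_sum_row; apply: eq_bigr => i _; rewrite mxE.
have := card_gens ut n sS cpsi; rewrite es => <-.
have E (X : 'M[R]_n) : pres X h = [forall i, S ((\row_i row i X) 0 i)] &&
    [forall x, S x ==> lspan (\row_i row i X) x].
  rewrite /pres gen /=; apply/forallP/andP => [hX|[/forallP h1 /forallP h2] v].
    split; apply/forallP => x.
      by move: x => i; rewrite mxE /S /rels (eqP (hX _)); apply/existsP; exists (delta_mx 0 i);
        rewrite -rowE.
    apply/implyP; rewrite /S /rels (eqP (hX _)) => /existsP[u /eqP ->].
    by apply/existsP; exists u; rewrite lcE.
  apply/eqP; apply/idP/existsP => [Sv|[u /eqP ->]].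
    by have /existsP[u /eqP <-] := implyP (h2 v) Sv; exists u; rewrite lcE.
  by rewrite -lcE; exact: (submod_lc _ sS h1).
have K1 (X : 'M[R]_n) : \matrix_i (\row_i row i X) 0 i = X.
  by apply/row_matrixP => i; rewrite rowK mxE.
have K2 (k : 'rV['rV[R]_n]_n) : \row_i row i (\matrix_i k 0 i) = k.
  by apply/rowP => i; rewrite mxE rowK.
apply: (@card_bij_pred _ _ (fun X : 'M[R]_n => \row_i row i X)
   (fun k => \matrix_i k 0 i)) => [X|k]; rewrite /= ?E ?K1 ?K2 => ->//.
Qed.

(** Modulo t the presentation becomes a presentation of M / tM = F^r by the reduced matrix. *)
Lemma pres_rank (M : finLmodType R) r (phi : M -> 'rV[F]_r) m n (X : 'M[R]_(m, n)) (h : 'rV[M]_n) :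
  coords rho t xpredT phi -> pres X h -> (r + \rank (red X) = n)%N.
Proof.
move=> cM /presP[h1 h2]; have [_ surj ker] := cM.
pose A := \matrix_i phi (h 0 i).
have lcA v : phi (lc v h) = red v *m A by exact: (coords_lc _ _ cM).
have full : row_full A.
  rewrite -sub1mx; apply/row_subP => i; have [x _ <-] := surj (row i 1%:M).
  by have [v <-] := h1 x; rewrite lcA submxMl.
have kerA : (kermx A :=: red X)%MS.
  apply/eqmxP/andP; split.
    apply/row_subP => i; have [v ev] := red_surj ut (row i (kermx A)).
    have : phi (lc v h) == 0 by rewrite lcA ev -row_mul mulmx_ker row0.
    rewrite ker// => /existsP[y /andP[_ /eqP ey]]; have [u eu] := h1 y.
    have /h2[z ez] : lc (v - t *: u) h = 0 by rewrite lcB lcZ eu ey subrr.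
    rewrite -ev -[v](subrK (t *: u)) ez raddfD/= map_mxZ (rho_t ut) scale0r addr0.
    by rewrite map_mxM submxMl.
  apply/sub_kermxP/row_matrixP => i; rewrite row_mul row0 -map_row -lcA.
  have -> : lc (row i X) h = 0 by apply/h2; exists (delta_mx 0 i); rewrite -rowE.
  by apply/eqP; rewrite ker//; have [] := tmul_submod t (@predT_submod M).
rewrite -kerA mxrank_ker (eqP full) subnKC//.
by rewrite -(eqP full) rank_leq_row.
Qed.

Definition lift_count (M : finLmodType R) n (Y : 'M[F]_n) :=
  #|[pred X : 'M[R]_n | (red X == Y) && cokis M X]|.

Lemma lift_unit n (P : 'M[F]_n) : P \in unitmx ->
  exists A B : 'M[R]_n, [/\ red A = P, A *m B = 1%:M & B *m A = 1%:M].
Proof.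
move=> uP; have [A eA] := red_surj ut P.
have [d hd] : exists d, \det A * d = 1.
  by apply: (chain_unit ut); rewrite -det_map_mx eA -unitfE -unitmxE.
exists A, (d *: \adj A); split=> //.
  by rewrite -scalemxAr mul_mx_adj scale_scalar_mx mulrC hd.
by rewrite -scalemxAl mul_adj_mx scale_scalar_mx mulrC hd.
Qed.

Lemma lift_count_equiv (M : finLmodType R) n (Y P Q : 'M[F]_n) :
  P \in unitmx -> Q \in unitmx -> lift_count M (P *m Y *m Q) = lift_count M Y.
Proof.
move=> uP uQ; have [A [A' [eA AA' A'A]]] := lift_unit uP.
have [B [B' [eB BB' B'B]]] := lift_unit uQ.
symmetry; apply: (@card_bij_pred _ _ (fun X => A *m X *m B) (fun X => A' *m X *m B')).
  move=> X /= /andP[/eqP eX cX]; split.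
    by rewrite !map_mxM eA eB eX eqxx; exact: (cokis_equiv AA' A'A BB' B'B).
  by rewrite -!mulmxA BB' mulmx1 mulmxA A'A mul1mx.
move=> X /= /andP[/eqP eX cX]; split; last by rewrite -!mulmxA B'B mulmx1 mulmxA AA' mul1mx.
rewrite (cokis_equiv A'A AA' B'B BB')// andbT !map_mxM eX -eA -eB !mulmxA -map_mxM A'A.
by rewrite map_mx1 mul1mx -mulmxA -map_mxM BB' map_mx1 mulmx1.
Qed.

(** Matrices of equal rank over F are equivalent, and the invertible matrices relating them lift to
    invertible ones over R, which preserve cokernels. *)
Lemma lift_count_rank (M : finLmodType R) n (Y Y' : 'M[F]_n) :
  \rank Y = \rank Y' -> lift_count M Y = lift_count M Y'.
Proof.
move=> e; rewrite -(mulmx_ebase Y) -(mulmx_ebase Y') e.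
by rewrite !lift_count_equiv ?col_ebase_unit ?row_ebase_unit.
Qed.

Lemma lift_count_eq0 (M : finLmodType R) r (phi : M -> 'rV[F]_r) n (Y : 'M[F]_n) :
  coords rho t xpredT phi -> (r + \rank Y)%N <> n -> lift_count M Y = 0%N.
Proof.
move=> cM ne; apply: eq_card0 => X; rewrite inE; apply/negP => /andP[/eqP e].
by move=> /existsP[h /(pres_rank cM)]; rewrite e.
Qed.

(** Double count of the pairs (X, h) with h a presentation of M by X: by X, sorted by reductions of
    rank n - r, and by h. Here [K] is |tS| for the relations S of any generating tuple. *)
Lemma lift_count_total (M : finLmodType R) r (phi : M -> 'rV[F]_r) n (Y : 'M[F]_n) :
  (forall x : M, t ^+ l.-1 *: x = 0) -> coords rho t xpredT phi ->
  (r + \rank Y)%N = n ->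
  exists K, (q ^ n * K * #|M| = #|R| ^ n)%N /\
    (#|[pred Z : 'M[F]_n | \rank Z == (n - r)%N]| * lift_count M Y * aut_count M =
     full_count q n r * #|tmul t (xpredT : pred M)| ^ n * (full_count q n n * K ^ n))%N.
Proof.
move=> kM cM eY.
(* |tS| solved from q^n |tS| |M| = |R|^n; this form is visibly independent of h. *)
exists (#|R| ^ n %/ (q ^ n * #|M|))%N.
have kK (K : nat) : (q ^ n * K * #|M| = #|R| ^ n)%N -> K = (#|R| ^ n %/ (q ^ n * #|M|))%N.
  move=> <-; rewrite mulnAC mulKn// muln_gt0 expn_gt0 (ltnW q_gt1)/=.
  by apply/card_gt0P; exists 0.
have cg := card_gens ut n (@predT_submod M) cM.
have genE (h : 'rV[M]_n) : [forall i, xpredT (h 0 i)] && [forall x, xpredT x ==> lspan h x]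
   = [forall x, lspan h x] by rewrite (introT forallP).
have -> : (#|[pred Z : 'M[F]_n | \rank Z == (n - r)%N]| * lift_count M Y)%N =
    #|[pred X : 'M[R]_n | cokis M X]|.
  rewrite -(@card_fibers _ _ (fun X : 'M[R]_n => cokis M X) (fun X => red X)); last first.
    move=> Z /= /eqP rZ; rewrite (@lift_count_rank M n Y Z); last by rewrite rZ -[in RHS]eY addKn.
    by apply: eq_card => X; rewrite !inE andbC.
  apply: eq_card => X; rewrite !inE; case cX: (cokis M X) => //=.
  have /existsP[h /(pres_rank cM) e] := cX.
  by apply/eqP; rewrite -[in RHS]e addKn.
rewrite card_cokis_pairs; split.
  have : (0 < full_count q n r)%N.
    rewrite /full_count prodn_gt0// => i; rewrite subn_gt0 ltn_exp2l//.
    by rewrite (leq_trans (ltn_ord i))// -eY leq_addr.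
  rewrite -(ltn_pmul2r (m := #|tmul t (xpredT : pred M)| ^ n)) ?expn_gt0 ?tmul_gt0// mul0n -cg.
  move=> /card_gt0P[h]; rewrite inE genE => gh.
  by have [_ e] := card_pres_mx kM cM gh; rewrite -(kK _ e).
rewrite -cg -(@card_pairs _ _ _ (fun h => [pred X : 'M[R]_n | pres X h])); last first.
  move=> h /=; rewrite genE => gh.
  by have [-> /kK ->] := card_pres_mx kM cM gh.
rewrite card_swap; apply: eq_card => -[h X]; rewrite !inE/= genE.
by case: (boolP (pres X h)) => [|_]; rewrite ?andbF// andbT => /andP[].
Qed.

End ChainPresentations.

(** * Kernels and cyclic extensions *)

Section KernelsAndExtensions.
Variables (R : finComNzRingType) (F : finFieldType) (rho : {rmorphism R -> F}).
Variables (t : R) (l : nat).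
Hypothesis ut : uniformizer rho t l.

Local Notation red := (map_mx rho).
Local Notation q := #|F|.

Let q_gt1 : (1 < q)%N. Proof. exact: card_finNzRing_gt1. Qed.

(** With E dual to X, the map v -> v E has kernel the row module of X and image the kernel of X, so
    it induces an isomorphism from coker X to ker X. *)
Lemma cokis_ker (M : finLmodType R) n (X : 'M[R]_n) : cokis M X <->
  exists f : M -> 'rV[R]_n,
    [/\ linear f, injective f & forall v, v *m X = 0 <-> exists x, v = f x].
Proof.
have [E [XE EX]] := dual_mx_exists ut X; split.
  move=> /existsP[h /presP[h1 h2]]; have [g hg] := fin_all_exists h1.
  have key v : lc v h = 0 <-> v *m E = 0 by rewrite h2 EX.
  have gE v : g (lc v h) *m E = v *m E.
    by apply/eqP; rewrite -subr_eq0 -mulmxBl; apply/eqP/key; rewrite lcB hg subrr.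
  exists (fun x => g x *m E); split.
  - move=> a x y; rewrite -{1}(hg x) -{1}(hg y) -lcP gE mulmxDl scalemxAl//.
  - move=> x y /eqP; rewrite -subr_eq0 -mulmxBl => /eqP/key.
    by rewrite lcB !hg => /eqP; rewrite subr_eq0 => /eqP.
  - move=> v; rewrite XE; split=> [[u ->]|[x ->]]; last by exists (g x).
    by exists (lc u h); rewrite gE.
move=> [f [lf fi fX]].
have ex i : exists x, row i E = f x by apply/fX/XE; exists (delta_mx 0 i); rewrite -rowE.
have [k hk] := fin_all_exists ex.
have fE v : f (lc v (\row_i k i)) = v *m E.
  rewrite (lin_lc _ _ lf) mulmx_sum_row; apply: eq_bigr => i _.
  by rewrite !mxE -hk.
have f0 : f 0 = 0.
  by have := lf 1 0 0; rewrite !scale1r !addr0 => /esym/eqP; rewrite -subr_eq0 addrK => /eqP.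
apply/existsP; exists (\row_i k i); apply/presP; split=> [x|v].
  have [u hu] : exists u, f x = u *m E by apply/XE/fX; exists x.
  by exists u; apply: fi; rewrite fE.
by rewrite -EX -fE -f0; split=> [->//|/fi].
Qed.

(** Multiplication by t maps (t^k) onto (t^(k+1)), and for k < l its kernel is the whole t-torsion
    of R, of order q. *)
Lemma card_tideal k : (k <= l)%N ->
  (#|[pred a : R | [exists b, a == (t ^+ k * b)%R]]| * q ^ k)%N = #|R|.
Proof.
elim: k => [_|k IH kl].
  rewrite muln1; apply: eq_card => a; rewrite !inE; apply/existsP; exists a.
  by rewrite mul1r.
rewrite -(IH (ltnW kl)) expnS mulnA; congr (_ * _)%N.
pose S : pred R := fun a => [exists b, a == t ^+ k * b].
have SB (x y : R) : S x -> S y -> S (x - y).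
  move=> /existsP[b /eqP ->] /existsP[c /eqP ->]; apply/existsP; exists (b - c).
  by rewrite mulrBr.
have S0 : S 0 by apply/existsP; exists 0; rewrite mulr0.
have := @card_preim_additive _ _ S ( *%R t) S0 SB (fun x y _ _ => mulrBr t x y)
  (fun a => [exists b, a == t ^+ k.+1 * b]).
have sur (b : R) : [exists c, b == t ^+ k.+1 * c] -> exists2 a, S a & t * a = b.
  move=> /existsP[c /eqP ->]; exists (t ^+ k * c); last by rewrite mulrA exprS.
  by apply/existsP; exists c.
move=> /(_ sur) e.
transitivity #|[pred x | S x && [exists b, t * x == t ^+ k.+1 * b]]|.
  rewrite e; congr (_ * _)%N; rewrite -[LHS](expn1 q) -(card_torsion ut 1).
  apply: (@card_bij_pred _ _ (fun v : 'rV_1 => v 0 0) (fun a : R => a%:M)) => [v|a] /=.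
    move=> /eqP e'; have tv : t * v 0 0 = 0 by have /rowP/(_ 0) := e'; rewrite !mxE.
    rewrite tv eqxx andbT -mx11_scalar; split=> //.
    have : t ^+ 1 * v 0 0 = 0 by rewrite expr1.
    have [_ _ l_gt0 _ _] := ut.
    move=> /(annih_tpow ut _ l_gt0)[b ->].
    apply/existsP; exists (t ^+ (l - 1 - k) * b).
    by rewrite mulrA -exprD subnKC// subn1 -ltnS prednK.
  move=> /andP[_ /eqP ta]; rewrite mxE eqxx mulr1n scale_scalar_mx ta.
  by split=> //; apply/eqP/matrixP => i j; rewrite !mxE mul0rn.
apply: eq_card => x; rewrite !inE -/(S x); case: (boolP (S x)) => //= /existsP[b /eqP ->].
by apply/existsP; exists b; rewrite mulrA exprS.
Qed.

(** k is least with t^k y = 0; ideals being powers of (t), the annihilator of y is (t^k). *)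
Lemma annih_cyclic_ex (H : finLmodType R) (y : H) : exists k,
  [/\ (#|[pred a : R | a *: y == 0%R]| * q ^ k)%N = #|R|,
      forall a, a *: y = 0 <-> exists b, a = t ^+ k * b
    & #|[pred x : H | [exists a, x == a *: y]]| = (q ^ k)%N].
Proof.
have [_ _ _ tl _] := ut.
have ex : exists k, t ^+ k *: y == 0 by exists l; rewrite tl scale0r.
case: (ex_minnP ex) => k /eqP ky kmin; exists k.
have kl : (k <= l)%N by apply: kmin; rewrite tl scale0r.
have ann a : a *: y = 0 <-> exists b, a = t ^+ k * b.
  split=> [|[b ->]]; last by rewrite mulrC -scalerA ky scaler0.
  have [->|[m [u [ml ru ->]]]] := chain_factor ut a; first by exists 0; rewrite mulr0.
  have [w uw] := chain_unit ut ru.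
  move=> e; have km : (k <= m)%N.
    apply: kmin; rewrite -[t ^+ m]mul1r -uw [u * w]mulrC -mulrA -scalerA e.
    by rewrite scaler0.
  by exists (t ^+ (m - k) * u); rewrite mulrA -exprD subnKC// mulrC.
have cR : (#|[pred a : R | a *: y == 0%R]| * q ^ k)%N = #|R|.
  rewrite -(card_tideal kl); congr (_ * _)%N; apply: eq_card => a; rewrite !inE.
  apply/eqP/existsP => [/ann[b ->]|[b /eqP eb]]; first by exists b.
  by apply/ann; exists b.
split=> //.
have := @card_preim_additive R H xpredT (fun a => a *: y) erefl (fun _ _ _ _ => erefl)
  (fun x z _ _ => scalerBl x z y) [pred x : H | [exists a, x == a *: y]].
have sur (b : H) : [pred x : H | [exists a, x == a *: y]] b -> exists2 a : R, true & a *: y = b.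
  by move=> /existsP[a /eqP ->]; exists a.
move=> /(_ sur) e.
have eR : #|R| = (#|[pred x : H | [exists a, x == a *: y]]| * #|[pred a : R | a *: y == 0%R]|)%N.
  transitivity #|[pred x : R | [exists a, x *: y == a *: y]]|; last exact: e.
  by apply: eq_card => x; rewrite !inE; apply/esym/existsP; exists x.
move/eqP: cR; rewrite eR mulnC eqn_pmul2r; first by move/eqP.
by apply/card_gt0P; exists 0; rewrite inE scale0r.
Qed.

Lemma annih_cyclic (H : finLmodType R) (y : H) j :
  #|[pred x : H | [exists a, x == a *: y]]| = (q ^ j)%N ->
  (#|[pred a : R | a *: y == 0%R]| * q ^ j)%N = #|R| /\
  forall a, a *: y = 0 <-> exists b, a = t ^+ j * b.
Proof.
have [k [cR ann ->]] := annih_cyclic_ex y.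
by move=> /eqP; rewrite eqn_exp2l// => /eqP <-.
Qed.

Lemma card_cyclic_ext (G H : finLmodType R) (f : H -> G) (y : H) : linear f ->
  (forall z, exists x, f x = z) -> (forall x, f x = 0 <-> exists a, x = a *: y) ->
  #|H| = (#|[pred x : H | [exists a, x == a *: y]]| * #|G|)%N.
Proof.
move=> lf sf kf.
have fB x z : f (x - z) = f x - f z by rewrite -scaleN1r addrC lf scaleN1r addrC.
have := @card_preim_additive H G xpredT f erefl (fun _ _ _ _ => erefl)
  (fun x z _ _ => fB x z) xpredT.
have sur (b : G) : xpredT b -> exists2 a : H, true & f a = b.
  by move=> _; have [x <-] := sf b; exists x.
move=> /(_ sur) e; rewrite mulnC; transitivity #|[pred _ : H | true && true]| => //.
rewrite e; congr (_ * _)%N; apply: eq_card => x; rewrite !inE/=.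
apply/eqP/existsP => [/kf[a ->]|[a /eqP ea]]; first by exists a.
by apply/kf; exists a.
Qed.

Variables (G : finLmodType R) (r : nat) (B : 'M[R]_r) (g0 : 'rV[G]_r) (j m : nat).
Hypothesis presB : pres B g0.
Hypothesis jml : (m + j < l)%N.
Hypothesis killG : forall x : G, t ^+ m *: x = 0.

(** Such a v lies in the image of the dual E of B. That image is isomorphic to G, hence killed by
    t^m, so the entries of E are divisible by t^(l-m), and l - m > j. This keeps [ext_mx] from
    imposing on y more than t^j y = 0. *)
Lemma left_ker_dvd (v : 'rV[R]_r) : v *m B = 0 -> exists u, v = t ^+ j *: u.
Proof.
have [E [BE EB]] := dual_mx_exists ut B.
have /presP[_ h2] := presB.
have tE : t ^+ m *: E = 0.
  apply/row_matrixP => i; rewrite linearZ/= row0 rowE scalemxAl.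
  by apply/EB/h2; rewrite lcZ killG.
move=> /BE[u ->].
have mjl : (m <= l)%N by rewrite ltnW// (leq_ltn_trans _ jml)// leq_addr.
have hE p : exists b, E p.1 p.2 = t ^+ (l - m) * b.
  by apply/(annih_tpow ut) => //; have /matrixP/(_ p.1 p.2) := tE; rewrite !mxE.
have [f hf] := fin_all_exists hE.
have -> : E = t ^+ j *: (\matrix_(i, k) (t ^+ (l - m - j) * f (i, k))).
  apply/matrixP => i k; rewrite !mxE mulrA -exprD subnKC ?(hf (i, k))//.
  by rewrite leq_subRL// ltnW.
by rewrite -scalemxAr; eexists.
Qed.

Definition ext_mx (c : 'cV[R]_r) : 'M[R]_(r + 1) := block_mx B c 0 (t ^+ j)%:M.

Lemma mul_ext_mx c (u : 'rV_r) (w : 'rV_1) : row_mx u w *m ext_mx c = row_mx (u *m B) (u *m c + t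
  ^+ j *: w).
Proof. by rewrite mul_row_block mulmx0 addr0 mul_mx_scalar. Qed.

(** Dropping the last coordinate maps the relations of H onto those of G. By [left_ker_dvd] the
    kernel is exactly (t^j), placed in the last coordinate. *)
Lemma card_ext (H : finLmodType R) (c : 'cV_r) : cokis H (ext_mx c) -> #|H| = (q ^ j * #|G|)%N.
Proof.
move=> /existsP[h ph]; have /presP[_ h2] := ph.
have jl : (j <= l)%N by rewrite ltnW// (leq_ltn_trans _ jml)// leq_addl.
have c1 : (#|rels h| * #|H|)%N = (#|R| ^ (r + 1))%N.
  by apply: card_rels; case/andP: ph.
have c2 : (#|rels g0| * #|G|)%N = (#|R| ^ r)%N.
  by apply: card_rels; case/andP: presB.
have c3 := card_tideal jl.
pose S : pred 'rV[R]_(r + 1) := rels h.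
have sS : is_submod S by exact: rels_submod.
have ps : (#|rels h| = #|rels g0| * #|[pred a : R | [exists b, a == (t ^+ j * b)%R]]|)%N.
  have e := @card_preim_additive _ _ S (fun v : 'rV[R]_(r + 1) => lsubmx v) _ _ _ (rels g0).
  have /presP[_ k2] := presB.
  transitivity #|[pred x | S x && rels g0 (lsubmx x)]|.
    apply: eq_card => v; rewrite inE -[in LHS]topredE/= /S; case rv: (rels h v) => //=.
    have /h2[u] := eqP rv; rewrite -[u]hsubmxK mul_ext_mx => ->; rewrite row_mxKl.
    by apply/esym/eqP/k2; eexists.
  rewrite e.
  - congr (_ * _)%N; apply: (@card_bij_pred _ _ (fun v : 'rV_(r + 1) => rsubmx v 0 0)
      (fun a : R => row_mx 0 a%:M)) => [v|a] /=.
      move=> /andP[Sv /eqP lv]; rewrite -mx11_scalar -[in RHS](hsubmxK v) lv; split=> //.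
      have /h2[u] := eqP Sv; rewrite -[u]hsubmxK mul_ext_mx => ev.
      have : lsubmx u *m B = 0 by move: lv; rewrite ev row_mxKl.
      move=> /left_ker_dvd[u' eu]; rewrite ev row_mxKr eu.
      apply/existsP; exists ((u' *m c + rsubmx u) 0 0).
      by rewrite -scalemxAl -scalerDr mxE.
    move=> /existsP[b /eqP ->]; rewrite row_mxKl eqxx andbT row_mxKr mxE eqxx mulr1n.
    split=> //; apply/eqP/h2; exists (row_mx 0 b%:M).
    by rewrite mul_ext_mx !mul0mx add0r scale_scalar_mx.
  - by case: sS.
  - by move=> x y; exact: submodB.
  - by move=> x y _ _; rewrite raddfB.
  - move=> b /eqP/k2[u ->]; exists (row_mx u (0 : 'rV_1) *m ext_mx c);
    last by rewrite mul_ext_mx row_mxKl.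
    by apply/eqP/h2; eexists.
have R0 : (0 < #|R|)%N by apply/card_gt0P; exists 0.
have p1 : (0 < #|rels g0|)%N by move: c2 (expn_gt0 #|R| r); rewrite R0 => <-;
  rewrite muln_gt0 => /andP[].
have p2 : (0 < #|[pred a : R | [exists b, a == (t ^+ j * b)%R]]|)%N.
  by move: R0; rewrite -c3 muln_gt0 => /andP[].
apply/eqP; rewrite -(eqn_pmul2l (m := #|rels h|)) ?ps ?muln_gt0 ?p1//; apply/eqP.
by rewrite -{1}ps c1 expnD expn1 -c2 -c3; ring.
Qed.

(** H/<y> = G, stated by a surjection with kernel <y>; the finite function type makes it a boolean,
    so that the y can be counted. *)
Definition quot_by (H : finLmodType R) (y : H) : bool :=
  [exists f : {ffun H -> G}, [&& is_lin f, [forall z, exists x, f x == z]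
    & [forall x, (f x == 0) == [exists a, x == a *: y]]]].

Lemma quot_byP (H : finLmodType R) (y : H) :
  reflect (exists f : H -> G, [/\ linear f, forall z, exists x, f x = z
    & forall x, f x = 0 <-> exists a, x = a *: y]) (quot_by y).
Proof.
apply: (iffP existsP) => [[f /and3P[/is_linP lf /forallP sf /forallP kf]]|[f [lf sf kf]]].
  exists f; split=> //; first by move=> z; have /existsP[x /eqP] := sf z; exists x.
  move=> x; have /eqP e := kf x; split=> [/eqP|[a ea]].
    by rewrite e => /existsP[a /eqP]; exists a.
  by apply/eqP; rewrite e; apply/existsP; exists a; apply/eqP.
exists [ffun x => f x]; apply/and3P; split.
- by apply/is_linP => a x y'; rewrite !ffunE lf.
- by apply/forallP => z; have [x e] := sf z; apply/existsP; exists x; rewrite ffunE e.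
- apply/forallP => x; rewrite ffunE; apply/eqP; apply/eqP/existsP => [/kf[a ->]|[a /eqP ea]].
    by exists a.
  by apply/kf; exists a.
Qed.

Lemma quot_by_pres (H : finLmodType R) c (h : 'rV[H]_r) (y : H) :
  pres (ext_mx c) (row_mx h (const_mx y)) -> quot_by y.
Proof.
move=> /presP[h1 h2]; have /presP[k1 k2] := presB.
have lcE (v : 'rV[R]_(r + 1)) :
    lc v (row_mx h (const_mx y)) = lc (lsubmx v) h + rsubmx v 0 0 *: y.
  by rewrite -{1}[v]hsubmxK lc_row -lc1 -mx11_scalar.
have [g hg] := fin_all_exists h1.
have key (v : 'rV[R]_(r + 1)) : lc v (row_mx h (const_mx y)) = 0 -> lc (lsubmx v) g0 = 0.
  move=> /h2[u]; rewrite -[u]hsubmxK mul_ext_mx => ->; apply/k2.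
  by rewrite row_mxKl; eexists.
pose f x := lc (lsubmx (g x)) g0.
have fE (v : 'rV[R]_(r + 1)) : f (lc v (row_mx h (const_mx y))) = lc (lsubmx v) g0.
  by apply/eqP; rewrite -subr_eq0 -lcB -raddfB/=; apply/eqP/key; rewrite lcB hg subrr.
apply/quot_byP; exists f; split.
- move=> a x z; have [u <-] := h1 x; have [v <-] := h1 z.
  by rewrite -lcP !fE -lcP; congr lc; apply/rowP => i; rewrite !mxE.
- move=> z; have [v <-] := k1 z; exists (lc (row_mx v (0 : 'rV_1)) (row_mx h (const_mx y))).
  by rewrite fE row_mxKl.
- move=> x; split=> [|[a ->]].
    have [v <-] := h1 x; rewrite fE => /k2[u eu].
    have : lc (row_mx u (0 : 'rV_1) *m ext_mx c) (row_mx h (const_mx y)) = 0 by apply/h2; eexists.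
    rewrite mul_ext_mx scaler0 addr0 -eu lcE row_mxKl row_mxKr => e.
    exists (rsubmx v 0 0 - (u *m c) 0 0); rewrite lcE scalerBl.
    by move/eqP: e; rewrite addr_eq0 => /eqP ->; rewrite addrC.
  rewrite [a *: y](_ : _ = lc (row_mx 0 a%:M) (row_mx h (const_mx y))).
    by rewrite fE row_mxKl lc0.
  by rewrite lcE row_mxKl row_mxKr lc0 add0r mxE eqxx.
Qed.

(** If the image of h presents G by B, each row of B evaluated at h lands in <y>, and c records
    minus its coefficient. As y has annihilator (t^j), no further relation appears. *)
Lemma pres_ext_iff (H : finLmodType R) (f : H -> G) c (h : 'rV[H]_r) (y : H) :
  linear f -> (forall z, exists x, f x = z) ->
  (forall x, f x = 0 <-> exists a, x = a *: y) ->
  (forall a, a *: y = 0 <-> exists b, a = t ^+ j * b) ->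
  pres (ext_mx c) (row_mx h (const_mx y)) =
  pres B (map_mx f h) && [forall i, lc (row i B) h + c i 0 *: y == 0].
Proof.
move=> lf sf kf ay.
have lcE (v : 'rV[R]_(r + 1)) :
    lc v (row_mx h (const_mx y)) = lc (lsubmx v) h + rsubmx v 0 0 *: y.
  by rewrite -{1}[v]hsubmxK lc_row -lc1 -mx11_scalar.
have fy a : f (a *: y) = 0 by apply/kf; exists a.
have fD x z : f (x + z) = f x + f z by rewrite -[x in LHS]scale1r lf scale1r.
have uBc (u : 'rV_r) : [forall i, lc (row i B) h + c i 0 *: y == 0] ->
    lc (u *m B) h + (u *m c) 0 0 *: y = 0.
  move=> /forallP hc.
  have -> : lc (u *m B) h = \sum_i u 0 i *: lc (row i B) h.
    rewrite mulmx_sum_row; elim/big_rec2: _ => [|i x z _ <-]; first by rewrite lc0.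
    by rewrite lcP.
  rewrite mxE scaler_suml -big_split/= big1// => i _.
  by rewrite -scalerA -scalerDr (eqP (hc i)) scaler0.
apply/presP/andP => [[h1 h2]|[/presP[k1 k2] hc]].
  have hc : [forall i, lc (row i B) h + c i 0 *: y == 0].
    apply/forallP => i; have : lc (row_mx (delta_mx 0 i) (0 : 'rV_1) *m ext_mx c) (row_mx h
      (const_mx y)) = 0.
      by apply/h2; eexists.
    by rewrite mul_ext_mx scaler0 addr0 lcE row_mxKl row_mxKr -!rowE mxE => /eqP.
  split=> //; apply/presP; split=> [z|v].
    have [x <-] := sf z; have [v <-] := h1 x; exists (lsubmx v).
    by rewrite lcE fD fy addr0 (lin_lc _ _ lf).
  rewrite -(lin_lc _ _ lf); split=> [/kf[a ea]|[u ->]].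
    have : lc (row_mx v (- a)%:M) (row_mx h (const_mx y)) = 0.
      by rewrite lcE row_mxKl row_mxKr ea mxE eqxx mulr1n scaleNr subrr.
    by move=> /h2[u]; rewrite -[u]hsubmxK mul_ext_mx => /eq_row_mx[-> _]; eexists.
  apply/kf; exists (- (u *m c) 0 0); apply/eqP.
  by rewrite -subr_eq0 scaleNr opprK uBc.
split=> [x|v].
  have [v ev] := k1 (f x).
  have [a ea] : exists a, x - lc v h = a *: y.
    have fB z w : f (z - w) = f z - f w by rewrite -scaleN1r addrC lf scaleN1r addrC.
    by apply/kf; rewrite fB (lin_lc _ _ lf) ev subrr.
  exists (row_mx v a%:M); rewrite lcE row_mxKl row_mxKr mxE eqxx mulr1n -ea.
  by rewrite addrC subrK.
rewrite lcE; split=> [e|[u ->]].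
  have : lc (lsubmx v) (map_mx f h) = 0.
    rewrite -(lin_lc _ _ lf); transitivity (f (lc (lsubmx v) h + rsubmx v 0 0 *: y)).
      by rewrite fD fy addr0.
    by rewrite e -(scale0r y) fy.
  move=> /k2[u eu].
  have : (rsubmx v 0 0 - (u *m c) 0 0) *: y = 0.
    rewrite scalerBl; apply/eqP; rewrite subr_eq0; apply/eqP.
    by apply: (addrI (lc (lsubmx v) h)); rewrite e eu uBc.
  move=> /ay[b eb]; exists (row_mx u b%:M); rewrite mul_ext_mx -eu scale_scalar_mx -eb.
  rewrite -[LHS]hsubmxK; congr row_mx; rewrite [LHS]mx11_scalar.
  by apply/matrixP => i k; rewrite !ord1 !mxE !eqxx !mulr1n addrC subrK.
rewrite -[u]hsubmxK mul_ext_mx row_mxKl row_mxKr [X in X *: _]mxE scalerDl addrA uBc// add0r.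
by apply/ay; rewrite mxE; eexists.
Qed.

(** Double count of the triples (c, h, y) presenting H. Each c with cokernel H gives |Aut H| of
    them. Each admissible y gives |Aut G| presentations of G, (q^j)^r lifts h of each, and |Ann y|^r
    columns c, where q^j |Ann y| = |R|. *)
Lemma card_ext_pairs (H : finLmodType R) : #|H| = (q ^ j * #|G|)%N ->
  (#|[pred c : 'cV[R]_r | cokis H (ext_mx c)]| * aut_count H =
   #|[pred y : H | quot_by y]| * (aut_count G * #|R| ^ r))%N.
Proof.
move=> cH.
pose T : pred ('cV[R]_r * 'rV[H]_(r + 1)) := fun p => pres (ext_mx p.1) p.2.
have -> : (#|[pred c : 'cV[R]_r | cokis H (ext_mx c)]| * aut_count H)%N = #|T|.
  have hk (c : 'cV[R]_r) : [pred c : 'cV[R]_r | cokis H (ext_mx c)] c ->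
    #|[pred k : 'rV[H]_(r + 1) | pres (ext_mx c) k]| = aut_count H by exact: card_pres.
  rewrite -(card_pairs hk); apply: eq_card => -[c k]; rewrite !inE -[in RHS]topredE/= /T/=.
  by case p: (pres _ k); rewrite ?andbF// andbT; apply/existsP; exists k.
pose Q (y : H) : pred ('cV[R]_r * 'rV[H]_r) := fun p => pres (ext_mx p.1) (row_mx p.2 (const_mx y)).
transitivity #|[pred x : H * ('cV[R]_r * 'rV[H]_r) | quot_by x.1 && Q x.1 x.2]|.
  apply: (@card_bij_pred _ _ (fun p : 'cV[R]_r * 'rV[H]_(r + 1) =>
     (rsubmx p.2 0 0, (p.1, lsubmx p.2)))
    (fun x => (x.2.1, row_mx x.2.2 (const_mx x.1)))) => [[c k]|[y [c h]]] /=.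
    have ek : row_mx (lsubmx k) (const_mx (rsubmx k 0 0)) = k.
      rewrite -[RHS]hsubmxK; congr row_mx; apply/matrixP => a b.
      by rewrite !ord1 !mxE.
    rewrite /T /Q /= ek => pk; split=> //; rewrite pk andbT.
    by move: pk; rewrite -{1}ek; exact: quot_by_pres.
  move=> /andP[_ py]; split=> //; rewrite row_mxKl row_mxKr !mxE//.
apply: card_pairs => y /quot_byP[f [lf sf kf]].
have cy : #|[pred x : H | [exists a, x == a *: y]]| = (q ^ j)%N.
  have := card_cyclic_ext lf sf kf; rewrite cH => /eqP.
  by rewrite eqn_pmul2r; [move=> /eqP -> | apply/card_gt0P; exists 0].
have [cA ay] := annih_cyclic cy.
have fB x z : f (x - z) = f x - f z by rewrite -scaleN1r addrC lf scaleN1r addrC.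
pose P (h : 'rV[H]_r) := pres B (map_mx f h).
pose C (h : 'rV[H]_r) : pred 'cV[R]_r :=
  fun c => [forall i, lc (row i B) h + c i 0 *: y == 0].
have -> : #|Q y| = #|[pred p : 'rV[H]_r * 'cV[R]_r | P p.1 && C p.1 p.2]|.
  rewrite card_swap; apply: eq_card => -[h c]; rewrite [LHS]inE [RHS]inE.
  exact: pres_ext_iff.
pose A := #|[pred a : R | a *: y == 0]|.
rewrite (@card_pairs _ _ P C (A ^ r)%N); last first.
  move=> h /presP[_ p2].
  have ex i : exists a, lc (row i B) h = a *: y.
    by apply/kf; rewrite (lin_lc _ _ lf); apply/p2; exists (delta_mx 0 i); rewrite -rowE.
  have [a ha] := fin_all_exists ex.
  transitivity #|[pred v : 'rV[R]_r | [forall i, (a i + v 0 i) *: y == 0]]|.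
    apply: (@card_bij_pred _ _ (fun c => c^T) (fun v => v^T)) => c; rewrite /C /= trmxK;
      by move=> /forallP hc; split=> //; apply/forallP => i; have := hc i; rewrite mxE ha -scalerDl.
  rewrite (@card_row_forall R r (fun i => [pred b | (a i + b) *: y == 0])).
  rewrite -[RHS](_ : (\prod_(i < r) A = _)%N); last by rewrite prod_nat_const card_ord.
  apply: eq_bigr => i _.
  apply: (@card_bij_pred _ _ (fun b => a i + b) (fun b => b - a i)) => b /=.
    by move=> ->; rewrite addrC addrA addNr add0r.
  by rewrite [a i + _]addrC subrK.
have -> : #|P| = (aut_count G * (q ^ j) ^ r)%N.
  rewrite -(@card_pres _ G _ _ B); last by apply/existsP; exists g0.
  rewrite -(@card_fibers _ _ (xpredT : pred 'rV[H]_r) (fun h => map_mx f h)) => [|g _] //.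
  transitivity #|[pred h : 'rV[H]_r | [forall i, f (h 0 i) == g 0 i]]|.
    apply: eq_card => h; rewrite !inE/=; apply/eqP/forallP => [<- i|hh]; first by rewrite mxE.
    by apply/rowP => i; rewrite mxE; exact/eqP.
  rewrite (@card_row_forall H r (fun i => [pred x | f x == g 0 i])).
  rewrite -[RHS](_ : (\prod_(i < r) q ^ j = _)%N); last by rewrite prod_nat_const card_ord.
  apply: eq_bigr => i _; have [x0 <-] := sf (g 0 i).
  rewrite -cy (_ : #|[pred x | f x == f x0]| = #|[pred x | xpredT x && (f x == f x0)]|)//.
  rewrite card_fiber_additive//; apply: eq_card => x; rewrite !inE/=.
  by apply/eqP/existsP => [/kf[a ->]|[a /eqP ea]]; [exists a|apply/kf; exists a].
by rewrite -cA -/A expnMn; ring.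
Qed.

(** Only the last column survives modulo t, and its bottom entry is 1 exactly when j = 0. *)
Lemma rank_ext_mx (c : 'cV_r) : red B = 0 ->
  \rank (red (ext_mx c)) = ((j == 0%N) || (red c != 0)).
Proof.
move=> B0; rewrite map_block_mx B0 !raddf0 map_scalar_mx/= rmorphXn/= (rho_t ut).
have -> : block_mx 0 (red c) 0 (0 ^+ j)%:M =
    col_mx (red c) (0 ^+ j)%:M *m row_mx (0 : 'M[_]_(1, r)) 1%:M.
  by rewrite mul_col_row !mulmx0 !mulmx1.
rewrite mxrankMfree; last first.
  apply: inj_row_free => v; rewrite mul_mx_row mulmx0 mulmx1 -row_mx0.
  by move=> /eq_row_mx[].
rewrite -mxrank_tr rank_rV trmx_eq0 col_mx_eq0 negb_and orbC; congr (nat_of_bool (_ || _)).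
by case: j => [|k]; rewrite ?expr0 ?scalar_mx_eq0 ?oner_eq0// expr0n/= raddf0 eqxx.
Qed.

End KernelsAndExtensions.

Section ReductionFibers.
Variables (R : finComNzRingType) (F : finFieldType) (rho : {rmorphism R -> F}).
Variables (t : R) (l : nat).
Hypothesis ut : uniformizer rho t l.

Lemma card_red_fiber m n (Y : 'M[F]_(m, n)) :
  (#|[pred X : 'M[R]_(m, n) | map_mx rho X == Y]| * #|F| ^ (m * n) = #|R| ^ (m * n))%N.
Proof.
have h (Z : 'M[F]_(m, n)) : xpredT Z -> #|[pred X : 'M[R]_(m, n) | xpredT X && (map_mx rho X ==
  Z)]| =
    #|[pred X : 'M[R]_(m, n) | map_mx rho X == 0]|.
  move=> _; have [X <-] := red_surj ut Z.
  by rewrite card_fiber_additive// => x y _ _; rewrite raddfB.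
have := card_fibers h; rewrite -(h Y erefl) /= => e.
by rewrite -!card_mx mulnC; symmetry; exact: e.
Qed.

End ReductionFibers.

(** * Symplectic matrices over a finite field *)

Section Witt.
Variables (F : finFieldType) (N : nat) (J : 'M[F]_N).
Hypothesis Ju : J \in unitmx.
Hypothesis Jalt : forall v : 'rV_N, v *m J *m v^T = 0.

Lemma alt_skew : J^T = - J.
Proof.
apply/matrixP => i j; rewrite !mxE.
have E (k k' : 'I_N) : ((delta_mx 0 k : 'rV[F]_N) *m J *m (delta_mx 0 k' : 'rV[F]_N)^T) 0 0 = J k
  k'.
  by rewrite trmx_delta -colE mxE -rowE mxE.
have := Jalt (delta_mx 0 i + delta_mx 0 j).
rewrite linearD/= !mulmxDl !mulmxDr !Jalt addr0 add0r => /matrixP/(_ 0 0).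
by rewrite mxE !E mxE => /eqP; rewrite addr_eq0 => /eqP ->; rewrite opprK.
Qed.

Lemma gram_tr m k (X : 'M[_]_(m, N)) (Y : 'M[_]_(k, N)) : (X *m J *m Y^T)^T = - (Y *m J *m X^T).
Proof. by rewrite !trmx_mul trmxK alt_skew mulNmx mulmxN mulmxA. Qed.

Lemma row_free_gram k (X : 'M[_]_(k, N)) : row_free X -> row_free (X *m J).
Proof. by move=> fX; rewrite /row_free mxrankMfree// row_free_unit. Qed.

(* If every extension w of Y were in Y, then the orthogonal of Y, hence that of
   X, would be totally isotropic, forcing v to lie in X. *)
Lemma witt_step k (X Y : 'M[F]_(k, N)) (v : 'rV_N) : row_free X -> row_free Y ->
  X *m J *m X^T = Y *m J *m Y^T -> ~~ (v <= X)%MS ->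
  exists2 w : 'rV_N, Y *m J *m w^T = X *m J *m v^T & ~~ (w <= Y)%MS.
Proof.
move=> fX fY e vX.
have [Z hZ] := row_freeP (row_free_gram fY).
(* A solution of the linear conditions on w; it can be changed freely by the orthogonal [K Y] of
   Y. *)
pose w0 := (Z *m (X *m J *m v^T))^T.
have hw0 : Y *m J *m w0^T = X *m J *m v^T by rewrite trmxK mulmxA hZ mul1mx.
have [w0Y|] := boolP (w0 <= Y)%MS; last by exists w0.
pose K (W : 'M[F]_(k, N)) := kermx (W *m J)^T.
have rK (W : 'M[_]_(k, N)) : row_free W -> \rank (K W) = (N - k)%N.
  by move=> /row_free_gram /eqP fW; rewrite mxrank_ker mxrank_tr fW.
have KP p (W : 'M[_]_(k, N)) (z : 'M[_]_(p, N)) : (z <= K W)%MS = (W *m J *m z^T == 0).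
  by rewrite sub_kermx -trmx_eq0 trmx_mul trmxK.
have KP' p (W : 'M[_]_(k, N)) (z : 'M[_]_(p, N)) : (z <= K W)%MS = (z *m J *m W^T == 0).
  by rewrite KP -trmx_eq0 gram_tr oppr_eq0.
have [KY|] := boolP (K Y <= Y)%MS; last first.
  move=> /row_subPn[i hi]; exists (w0 + row i (K Y)).
    have := row_sub i (K Y); rewrite KP => /eqP e0.
    by rewrite linearD/= mulmxDr e0 addr0.
  apply: contra hi => h; rewrite -[row i _](addKr w0) addmx_sub// eqmx_opp//.
(* Coefficients of the common radical: A X is contained in the orthogonal of X. When K Y lies in Y,
   comparing dimensions gives equality, so K X lies in X. *)
pose A := kermx (Y *m J *m Y^T).
have AX : (A *m X <= K X)%MS.
  have : A *m (X *m J *m X^T) = 0 by rewrite e mulmx_ker.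
  by rewrite KP' !mulmxA => ->.
have KA : (\rank (K X) <= \rank (A *m X))%N.
  have [D eD] := submxP KY.
  have -> : \rank (A *m X) = \rank A by exact: mxrankMfree.
  have -> : \rank (K X) = \rank D by rewrite rK// -(rK _ fY) eD mxrankMfree.
  apply: mxrankS; apply/sub_kermxP; rewrite !mulmxA -eD.
  by apply/eqP; rewrite -KP'.
have KX : (K X <= X)%MS.
  apply: (submx_trans _ (submxMl A X)).
  by rewrite -(mxrank_leqif_sup AX) eqn_leq KA mxrankS.
case/negP: vX; have /submxP[c ec] := w0Y.
rewrite -(subrK (c *m X) v) addmx_sub ?submxMl//; apply: (submx_trans _ KX).
rewrite KP linearB/= mulmxBr -hw0 ec !trmx_mul !mulmxA e subrr//.
Qed.

(** Both families are extended by one vector at a time until they are bases, where a = X^-1 Y. The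
    form being alternating, the new diagonal Gram entries vanish on both sides. *)
Lemma witt k (X Y : 'M[F]_(k, N)) : row_free X -> row_free Y ->
  X *m J *m X^T = Y *m J *m Y^T ->
  exists2 a : 'M[F]_N, a *m J *m a^T = J & Y = X *m a.
Proof.
have [d] : exists d, (k + d = N)%N \/ (N < k)%N.
  by have [h|h] := leqP k N; [exists (N - k)%N; left; rewrite subnKC | exists 0%N; right].
move=> [|kN] ; last first.
  by move=> /eqP fX; have := rank_leq_col X; rewrite fX leqNgt kN.
elim: d k X Y => [|d IH] k X Y kd fX fY e.
  rewrite addn0 in kd; subst k.
  rewrite !row_free_unit in fX fY; exists (invmx X *m Y); last by rewrite mulKVmx.
  have eJ : invmx X *m (X *m J *m X^T) *m (invmx X)^T = J.
    by rewrite trmx_inv !mulmxA mulVmx// mul1mx mulmxK// unitmx_tr.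
  by rewrite -[RHS]eJ e trmx_mul !mulmxA.
have [v vX] : exists v : 'rV_N, ~~ (v <= X)%MS.
  have : ~~ (1%:M <= X)%MS by rewrite sub1mx /row_full (eqP fX) -kd neq_ltn -{1}(addn0 k) ltn_add2l.
  by move=> /row_subPn[i hi]; exists (row i 1%:M).
have [w hw wY] := witt_step fX fY e vX.
have [||||a ha] := IH (k + 1)%N (col_mx X v) (col_mx Y w).
- by rewrite -addnA add1n.
- by rewrite row_free_col_mx1 fX.
- by rewrite row_free_col_mx1 fY.
- rewrite !tr_col_mx !(mul_col_mx _ _ J) !mul_col_row -e -hw !Jalt; congr block_mx.
  by rewrite -[LHS]trmxK -[RHS]trmxK !gram_tr hw.
by rewrite mul_col_mx => /eq_col_mx[-> _]; exists a.
Qed.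

End Witt.

(** * Isometries and the tuples they fix *)

Section SymplecticMoments.
Variables (F : finFieldType).
Local Notation q := #|F|.

Lemma card_row_free_sub m n k (A : 'M[F]_(m, n)) :
  #|[pred X : 'M[F]_(k, n) | row_free X && (X <= A)%MS]| = full_count q (\rank A) k.
Proof.
rewrite -card_row_free; symmetry.
apply: (@card_bij_pred _ _ (fun Y => Y *m row_base A)
  (fun X => X *m pinvmx (row_base A))) => [Y|X] /=.
  move=> fY; rewrite /row_free mxrankMfree ?row_base_free// -/(row_free Y) fY/=.
  by rewrite -(eq_row_base A) submxMl -mulmxA mulmxVp ?row_base_free ?mulmx1.
rewrite -{1}(eq_row_base A) => /andP[fX XA]; rewrite mulmxKpV//; split=> //.
by move: fX; rewrite -{1}(mulmxKpV XA) /row_free mxrankMfree ?row_base_free.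
Qed.

Section Form.
Variables (N : nat) (J : 'M[F]_N).
Hypothesis Ju : J \in unitmx.
Hypothesis Jalt : forall v : 'rV_N, v *m J *m v^T = 0.

(** Row-vector convention: a acts by v -> v a. It is the transpose of the condition defining the
    symplectic group. *)
Definition isom : pred 'M[F]_N := fun a => a *m J *m a^T == J.

Definition grams k : pred 'M[F]_k :=
  fun A => [exists X : 'M[_]_(k, N), row_free X && (X *m J *m X^T == A)].

Lemma isom_unit a : isom a -> a \in unitmx.
Proof.
move=> /eqP e; have : a *m (J *m a^T *m invmx J) = 1%:M by rewrite !mulmxA e mulmxV.
by move=> /mulmx1_unit[].
Qed.

Lemma isomM a b : isom a -> isom b -> isom (a *m b).
Proof.
move=> /eqP ea /eqP eb; apply/eqP.
by rewrite trmx_mul -!mulmxA (mulmxA b) (mulmxA (b *m J)) eb mulmxA ea.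
Qed.

Lemma isomV a : isom a -> isom (invmx a).
Proof.
move=> sa; have ua := isom_unit sa; apply/eqP.
by rewrite -{1}(eqP sa) !mulmxA mulVmx// mul1mx trmx_inv mulmxK// unitmx_tr.
Qed.

(** Over a Gram matrix A realized by X0, Witt provides for each X with the same Gram matrix an
    isometry g(X) with X = X0 g(X). Then (X, b) -> g(X) b is a bijection onto all isometries, its
    inverse reading X off as the image of X0. *)
Lemma card_isom_fixed k :
  #|[pred p : 'M[F]_(k, N) * 'M[F]_N | [&& row_free p.1, isom p.2 & p.1 *m p.2 == p.1]]| =
  (#|@grams k| * #|isom|)%N.
Proof.
pose S (p : 'M[F]_(k, N) * 'M[F]_N) := [&& row_free p.1, isom p.2 & p.1 *m p.2 == p.1].
rewrite -(@card_fibers _ _ S (fun p => p.1 *m J *m p.1^T)).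
  apply: eq_card => -[X a]; rewrite [LHS]inE [RHS]inE /=.
  case s: (S (X, a)); rewrite /S/= in s; rewrite s//=.
  by move: s => /and3P[fX _ _]; apply/esym/existsP; exists X; rewrite fX eqxx.
move=> A /existsP[X0 /andP[f0 /eqP e0]].
have gX (X : 'M[F]_(k, N)) : exists g, (row_free X && (X *m J *m X^T == A)) ->
    isom g /\ X = X0 *m g.
  case: (boolP (_ && _)) => [/andP[fX /eqP eX]|_]; last by exists 0.
  have [|a ha eXa] := witt Ju Jalt f0 fX; first by rewrite e0 eX.
  by exists a => _; split=> //; apply/eqP.
have [g hg] := fin_all_exists gX.
apply: (@card_bij_pred _ _ (fun p : 'M[F]_(k, N) * 'M[F]_N => g p.1 *m p.2)
   (fun a => (X0 *m a, invmx (g (X0 *m a)) *m a))) => [[X b]|a].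
  move=> /= /andP[/and3P[/= fX sb /eqP Xb] eX].
  have [sg eg] := hg X (introT andP (conj fX eX)).
  by rewrite mulmxA -eg Xb mulKmx ?isom_unit//; split=> //; apply: isomM.
move=> /= sa; have ua := isom_unit sa.
have fa : row_free (X0 *m a) by rewrite /row_free mxrankMfree ?row_free_unit.
have ea : X0 *m a *m J *m (X0 *m a)^T == A.
  by rewrite trmx_mul -!mulmxA (mulmxA a) (mulmxA (a *m J)) (eqP sa) mulmxA e0.
have [sg eg] := hg (X0 *m a) (introT andP (conj fa ea)).
rewrite mulKVmx ?isom_unit//; split=> //; rewrite ea andbT /S/= fa/=.
rewrite isomM ?isomV//= {1}eg !mulmxA mulmxK ?isom_unit//.
Qed.

(** The same pairs sorted by a: the tuples fixed by a are the free tuples in the kernel of a - 1. *)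
Lemma sum_isom_fixed k :
  (\sum_(a : 'M[F]_N | isom a) full_count q (N - \rank (a - 1%:M)%R) k =
   #|@grams k| * #|isom|)%N.
Proof.
rewrite -card_isom_fixed card_swap -[RHS]sum1_card.
rewrite (eq_bigl (fun p : 'M[F]_N * 'M[F]_(k, N) => isom p.1 &&
   (row_free p.2 && (p.2 *m p.1 == p.2)))); last first.
  by move=> [a X]; rewrite !inE/= andbCA.
rewrite -(pair_big_dep isom (fun a X => row_free X && (X *m a == X)) (fun _ _ => 1%N))/=.
apply: eq_bigr => a _; rewrite -mxrank_ker -card_row_free_sub -[LHS]sum1_card.
apply: eq_bigl => X; rewrite !inE sub_kermx mulmxBr mulmx1 subr_eq0//.
Qed.

(** The zero diagonal is a separate condition because of characteristic 2. *)
Definition alts k : pred 'M[F]_k := fun A => (A^T == - A) && [forall i, A i i == 0].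

Lemma card_alts k : #|@alts k| = (q ^ 'C(k, 2))%N.
Proof.
elim: k => [|k IH].
  rewrite bin0n expn0 -(expn0 q) -(card_mx F 0 0); apply: eq_card => A.
  rewrite !inE -topredE/= /alts; apply/andP; split; first by apply/eqP/matrixP => -[].
  by apply/forallP => -[].
rewrite binS bin1 expnD -IH.
have -> : (q ^ k)%N = #|{: 'rV[F]_k}| by rewrite card_mx mul1n.
rewrite -(@card_pairs _ _ (@alts k) (fun _ => xpredT : pred 'rV[F]_k)); last by [].
apply: (@card_bij_pred _ _ (fun A : 'M[F]_(1 + k) => (drsubmx A, ursubmx A))
   (fun p => block_mx 0 p.2 (- p.2^T) p.1 : 'M[_]_(1 + k))) => [A|[A b]] /=.
  move=> /andP[/eqP tA /forallP dA]; rewrite andbT; split.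
    apply/andP; split; first by rewrite trmx_drsub tA; apply/eqP/matrixP => i j; rewrite !mxE.
    by apply/forallP => i; rewrite !mxE.
  rewrite -[RHS]submxK; congr block_mx.
    by rewrite [RHS]mx11_scalar mxE mxE (eqP (dA _)) raddf0.
  by rewrite trmx_ursub tA; apply/matrixP => i j; rewrite !mxE opprK.
rewrite andbT block_mxKdr block_mxKur => /andP[/eqP tA /forallP dA]; split=> //.
pose B : 'M[_]_(1 + k) := block_mx 0 b (- b^T) A.
have tB : B^T = - B.
  rewrite /B tr_block_mx opp_block_mx tA trmx0 oppr0; congr block_mx.
    by rewrite linearN/= trmxK.
  by rewrite opprK.
have dB (i : 'I_(1 + k)) : B i i == 0.
  case: (split_ordP i) => i' ->; first by rewrite block_mxEul mxE.
  by rewrite block_mxEdr.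
by apply/andP; split; [apply/eqP | apply/forallP].
Qed.

Lemma grams_alts k A : @grams k A -> alts A.
Proof.
move=> /existsP[X /andP[_ /eqP <-]]; apply/andP; split; first by rewrite (gram_tr Jalt).
apply/forallP => i; have /matrixP/(_ 0 0) e := Jalt (row i X).
rewrite [in RHS]mxE in e; rewrite -[X in _ == X]e; apply/eqP.
rewrite [LHS]mxE [RHS]mxE; apply: eq_bigr => x _; rewrite -row_mul [in RHS]mxE.
by congr (_ * _); rewrite !mxE.
Qed.

(** Valid for every k; it controls the moments with k > n. *)
Lemma card_grams_le k : (#|@grams k| <= q ^ 'C(k, 2))%N.
Proof. by rewrite -card_alts; apply/subset_leq_card/fintype.subsetP => A; exact: grams_alts. Qed.

End Form.

Definition stdJ n : 'M[F]_(n + n) := block_mx 0 1%:M (- 1%:M) 0.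

Lemma stdJ_unit n : stdJ n \in unitmx.
Proof.
have : stdJ n *m - stdJ n = 1%:M.
  rewrite mulmxN mulmx_block !mul0mx !mulmx0 !mul1mx !mulmx1 !add0r !addr0.
  by rewrite opp_block_mx opprK oppr0 -scalar_mx_block.
by move=> /mulmx1_unit[].
Qed.

Lemma stdJ_alt n (v : 'rV[F]_(n + n)) : v *m stdJ n *m v^T = 0.
Proof.
rewrite -[v]hsubmxK tr_row_mx mul_row_block !mulmx0 add0r addr0 mulmx1 mulmxN mulmx1.
rewrite mul_row_col mulNmx; apply/eqP; rewrite addrC subr_eq0; apply/eqP.
have tr11 (x : 'M[F]_1) : x^T = x by rewrite [x]mx11_scalar tr_scalar_mx.
by rewrite -[LHS]tr11 trmx_mul trmxK.
Qed.

(** With U the strict upper part, A = U - U^T is the Gram matrix of the rows of (P, U^T P), where P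
    = (1 0) has k rows. They are free because P is, which requires k <= n. *)
Lemma card_grams n k : (k <= n)%N -> #|@grams _ (stdJ n) k| = (q ^ 'C(k, 2))%N.
Proof.
move=> kn; rewrite -card_alts; apply: eq_card => A; apply/idP/idP.
  exact: grams_alts (@stdJ_alt n) _ _.
move=> /andP[/eqP tA /forallP dA].
pose U : 'M[F]_k := \matrix_(i, j) if (i < j)%N then A i j else 0.
pose P : 'M[F]_(k, n) := pid_mx k.
have PP : P *m P^T = 1%:M by rewrite tr_pid_mx pid_mx_id// pid_mx_1.
have AU : A = U - U^T.
  apply/matrixP => i j; rewrite !mxE; have := ltngtP i j => -[ij|ij|/val_inj ->].
  - by rewrite subr0.
  - by rewrite sub0r; have /matrixP/(_ j i) := tA; rewrite !mxE.
  - by rewrite subr0; exact/eqP.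
apply/existsP; exists (row_mx P (U^T *m P)); apply/andP; split.
  apply: inj_row_free => v; rewrite mul_mx_row -row_mx0 => /eq_row_mx[e _].
  by rewrite -[v]mulmx1 -PP mulmxA e mul0mx.
rewrite tr_row_mx mul_row_block !mulmx0 add0r addr0 mulmx1 mulmxN mulmx1 mul_row_col.
by rewrite trmx_mul trmxK mulmxA PP mul1mx mulNmx -mulmxA PP mulmx1 addrC AU.
Qed.

End SymplecticMoments.

(** * Residue rings of a ring of integers *)

Section IntegersFinite.
Variable K : fieldExtType rat.
Local Notation O := (ringint K).

Lemma ringint_integral (x : O) : integralOver (intr : int -> K) (val x).
Proof. by have := valP x; rewrite unfold_in => /asboolP. Qed.

Lemma ringint_of_integral (z : K) : integralOver (intr : int -> K) z -> exists x : O, val x = z.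
Proof.
move=> iz; have hz : z \in @integral_pred K by rewrite unfold_in; apply/asboolP.
by exists (Sub z hz); rewrite SubK.
Qed.

Lemma ringint_mulf_eq0 (x y : O) : x * y = 0 -> x = 0 \/ y = 0.
Proof.
move=> /(congr1 val); rewrite rmorphM rmorph0 => /eqP; rewrite mulf_eq0.
by move=> /orP[] /eqP e; [left|right]; apply: val_inj; rewrite rmorph0.
Qed.

Lemma ringint_mulI (x y z : O) : x != 0 -> x * y = x * z -> y = z.
Proof.
move=> x0 /eqP; rewrite -subr_eq0 -mulrBr => /eqP/ringint_mulf_eq0[e|/eqP].
  by rewrite e eqxx in x0.
by rewrite subr_eq0 => /eqP.
Qed.

Lemma ringint_natr_eq0 n : (n%:R == 0 :> O) = (n == 0)%N.
Proof.
apply/eqP/eqP => [/(congr1 val)|->//]; rewrite rmorph_nat rmorph0 => /eqP.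
by rewrite -(rmorph_nat (in_alg K)) fmorph_eq0 pnatr_eq0 => /eqP.
Qed.

(** The constant term of an integer polynomial vanishing at a is a multiple of a; if it is zero, a
    factor X is cancelled. Only P != 0, not monicity, survives this induction. *)
Lemma ringint_int_multiple (a : O) : a != 0 -> exists c (b : O), c != 0 /\ c%:~R = a * b.
Proof.
move=> a0; have [P mP rP] := ringint_integral a.
have P0 := monic_neq0 mP.
elim/poly_ind: P {mP} P0 rP => [|Q c IH] P0; first by rewrite eqxx in P0.
rewrite rmorphD rmorphM/= map_polyX map_polyC/= /root !hornerE => /eqP e.
have va0 : val a != 0.
  by apply: contraNneq a0 => ea; apply/eqP/val_inj; rewrite rmorph0.
have [c0|c0] := eqVneq c 0.
  move: e; rewrite c0 addr0 => /eqP; rewrite mulf_eq0 (negPf va0) orbF => rQ.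
  by apply: IH => //; apply: contraNneq P0 => ->; rewrite c0 mul0r add0r.
exists c, (- (map_poly (intr : int -> O) Q).[a]); split=> //; apply: val_inj.
pose vm : {rmorphism O -> K} := val.
have hv : val (map_poly (intr : int -> O) Q).[a] = (map_poly intr Q).[val a].
  rewrite -[LHS](horner_map vm) -map_poly_comp/=; congr _.[_].
  by apply: eq_map_poly => z; exact: (rmorph_int vm).
transitivity (val a * - (map_poly intr Q).[val a]); last by rewrite -hv -rmorphN -rmorphM.
rewrite rmorph_int.
by move/eqP: e; rewrite addrC addr_eq0 => /eqP ->; rewrite mulrN mulrC.
Qed.

(** A rational dependence is made integral and primitive, so l cannot divide all its
    coefficients. *)
Lemma int_relation l n (x : 'I_n -> O) : prime l -> (\dim {:K} < n)%N ->
  exists c : 'I_n -> int, \sum_i x i *~ c i = 0 /\ exists i, ~~ (l%:Z %| c i)%Z.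
Proof.
move=> pl dn; pose X := [tuple val (x i) | i < n].
have : ~~ free X.
  apply/negP; rewrite /free size_tuple => /eqP e.
  by have := dimvS (subvf <<X>>%VS); rewrite e leqNgt dn.
move=> /freeP nf.
have [k [ek [i ki]]] : exists k : 'I_n -> rat, \sum_i k i *: X`_i = 0 /\ exists i, k i != 0.
  apply: contrapT => no; apply: nf => k ek i; apply/eqP/negPn/negP => ki.
  by apply: no; exists k; split=> //; exists i.
(* The coefficients are packed into a polynomial so that contents and primitive parts apply. *)
pose P : {poly rat} := \sum_(i < n) k i *: 'X^i.
have Pi (j : 'I_n) : P`_j = k j.
  rewrite coef_sum (bigD1 j)//= coefZ coefXn eqxx mulr1 big1 ?addr0// => m mj.
  by rewrite coefZ coefXn eq_sym (inj_eq val_inj) (negPf mj) mulr0.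
have [Q [a a0 eP]] := rat_poly_scale P.
have Q0 : Q != 0.
  apply: contraNneq ki => Q0; rewrite -Pi eP Q0 rmorph0 scaler0 coef0//.
pose d := zcontents Q; have d0 : d != 0 by rewrite zcontents_eq0.
pose c (j : 'I_n) := (zprimitive Q)`_j.
have kc j : k j = a%:~R^-1 * d%:~R * (c j)%:~R.
  by rewrite -Pi eP [in LHS](zpolyEprim Q) coefZ coef_map/= coefZ rmorphM/= mulrA.
exists c; split.
  apply: val_inj; rewrite rmorph_sum rmorph0 /=.
  have := ek; rewrite (eq_bigr (fun j => (a%:~R^-1 * d%:~R) *: (val (x j) *~ c j))).
    rewrite -scaler_sumr => /eqP; rewrite scaler_eq0 mulf_eq0 invr_eq0 !intr_eq0.
    rewrite (negPf a0) (negPf d0) /= => /eqP e; rewrite -[RHS]e.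
    by apply: eq_bigr => j _; exact: (raddfMz (val : {rmorphism O -> K})).
  by move=> j _; rewrite kc -[in RHS]scaler_int scalerA -tnth_nth tnth_mktuple.
apply: contrapT => no.
have : (l%:Z %| zcontents (zprimitive Q))%Z.
  rewrite dvdz_contents; apply/polyOverP => m.
  have [mn|nm] := ltnP m n.
    by apply: contraT => h; exfalso; apply: no; exists (Ordinal mn).
  have -> : (zprimitive Q)`_m = 0; last by rewrite rpred0.
  have Pm : P`_m = 0.
    rewrite coef_sum big1// => j _; rewrite coefZ coefXn.
    by rewrite gtn_eqF ?mulr0// (leq_trans (ltn_ord j)).
  have Qm : Q`_m = d * (zprimitive Q)`_m by rewrite [in LHS](zpolyEprim Q) coefZ.
  move: Pm; rewrite eP coefZ coef_map/= Qm => /eqP.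
  by rewrite mulf_eq0 invr_eq0 !intr_eq0 (negPf a0)/= mulf_eq0 (negPf d0)/= => /eqP.
by rewrite zcontents_primitive Q0 dvdz1/= => /eqP l1; move: pl; rewrite l1.
Qed.

(** A family of maximal length that is independent modulo l has at most dim K members and spans O
    modulo l. This needs no integral basis of O. *)
Lemma ringint_mod_finite l : prime l ->
  exists s : seq O, forall x, exists2 y, y \in s & exists z, x - y = l%:R * z.
Proof.
move=> pl.
pose indep n (x : 'I_n -> O) := forall c : 'I_n -> int,
  (exists z, \sum_i x i *~ c i = l%:R * z) -> forall i, (l%:Z %| c i)%Z.
pose ex n := `[< exists x : 'I_n -> O, indep n x >].
have ex0 : exists n, ex n by exists 0%N; apply/asboolP; exists (fun=> 0) => c _ [].
have bnd n : ex n -> (n <= \dim {:K})%N.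
  move=> /asboolP[x ix]; rewrite leqNgt; apply/negP => /(int_relation x pl)[c [e [i]]].
  by rewrite ix//; exists 0; rewrite e mulr0.
case: (ex_maxnP ex0 bnd) => n /asboolP[x ix] nmax.
have gen (w : O) : exists (c : {ffun 'I_n -> 'I_l}) z,
    w - \sum_i x i *+ c i = l%:R * z.
  (* Appending w breaks independence. In the resulting relation the coefficient [c2] of w is prime
     to l, and Bezout solves for w. *)
  have no : ~ exists x : 'I_(n + 1) -> O, indep _ x.
    by move=> h; have := nmax (n + 1)%N (asboolT h); rewrite addn1 ltnn.
  pose x' (i : 'I_(n + 1)) := match fintype.split i with inl j => x j | inr _ => w end.
  have [c [[z ez] [i hi]]] : exists c : 'I_(n + 1) -> int,
      (exists z, \sum_i x' i *~ c i = l%:R * z) /\ exists i, ~~ (l%:Z %| c i)%Z.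
    apply: contrapT => no'; apply: no; exists x' => c ec i; apply/negPn/negP => hi.
    by apply: no'; exists c; split=> //; exists i.
  pose c1 j := c (lshift 1 j); pose c2 := c (rshift n 0).
  have {}ez : \sum_j x j *~ c1 j + w *~ c2 = l%:R * z.
    rewrite -ez big_split_ord/= big_ord1 /x' (unsplitK (inr _)).
    by congr (_ + _); apply: eq_bigr => j _; rewrite (unsplitK (inl j)).
  have c2l : ~~ (l%:Z %| c2)%Z.
    apply/negP => /dvdzP[d ed]; move: ez; rewrite ed => ez.
    have h1 : forall j, (l%:Z %| c1 j)%Z.
      apply: ix; exists (z - w *~ d).
      have -> : l%:R * (z - w *~ d) = l%:R * z - w *~ (d * l%:Z).
        by rewrite mulrBr mulrzA -pmulrn !mulr_natl.
      by rewrite -ez addrK.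
    case: (split_ordP i) hi => j ->; first by rewrite -/(c1 j) h1.
    by rewrite ord1 -/c2 ed dvdz_mull.
  have [[u v] /= uv] : exists uv, uv.1 * c2 + uv.2 * l%:Z = 1.
    apply/coprimezP; rewrite coprimezE/= coprime_sym prime_coprime//.
  pose b j := (((- u * c1 j) %% l%:Z)%Z).
  have l0 : l%:Z != 0 by rewrite eqz_nat -lt0n prime_gt0.
  have bl j : (`|b j| < l)%N.
    by have := ltz_pmod (- u * c1 j) (d := l%:Z); rewrite -ltz_nat gez0_abs ?modz_ge0//; apply;
      rewrite ltz_nat prime_gt0.
  have bE j : (`|b j|%N)%:Z = b j by rewrite gez0_abs ?modz_ge0.
  exists [ffun j => Ordinal (bl j)].
  exists (z *~ u + w *~ v + \sum_j x j *~ ((- u * c1 j) %/ l%:Z)%Z).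
  have -> : \sum_i x i *+ [ffun j => Ordinal (bl j)] i = \sum_i x i *~ b i.
    by apply: eq_bigr => j _; rewrite ffunE/= pmulrn bE.
  have ew : w = (w *~ c2) *~ u + (w *~ l) *~ v.
    by rewrite -!mulrzA -mulrzDr [c2 * u]mulrC [_ * v]mulrC uv mulr1z.
  have ec2 : w *~ c2 = l%:R * z - \sum_j x j *~ c1 j by rewrite -ez addrC addKr.
  have -> : \sum_j x j *~ b j = - (\sum_j x j *~ c1 j) *~ u -
      l%:R * \sum_j x j *~ ((- u * c1 j) %/ l%:Z)%Z.
    rewrite mulNrz mulrz_suml mulr_sumr -sumrN -sumrB; apply: eq_bigr => j _.
    have e := divz_eq (- u * c1 j) l%:Z.
    have -> : b j = - u * c1 j - (- u * c1 j %/ l%:Z)%Z * l by rewrite {1}e addrC addKr.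
    rewrite mulrzBr mulNr mulrNz -mulrzA [c1 j * u]mulrC; congr (_ - _).
    by rewrite mulrzA -pmulrn mulr_natl.
  have el : w *~ l *~ v = l%:R * (w *~ v).
    by rewrite -mulrzA mulrC mulrzA -pmulrn mulr_natl.
  rewrite {1}ew ec2 el mulrzBl -!mulrzAr mulNrz.
  by move: (_ *~ u) (z *~ u) (w *~ v) (\sum_j x j *~ (_ %/ _)%Z) => a1 a2 a3 a4; ring.
exists [seq \sum_i x i *+ (c : {ffun 'I_n -> 'I_l}) i | c <- enum {: {ffun 'I_n -> 'I_l}}].
move=> w; have [c [z e]] := gen w; exists (\sum_i x i *+ c i); last by exists z.
by apply/mapP; exists c => //; rewrite mem_enum.
Qed.

End IntegersFinite.

(** * A local uniformizer at p *)

Section LocalStructure.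
Variable K : fieldExtType rat.
Local Notation O := (ringint K).
Variable p : prime_idealr O.
Hypothesis p_neq0 : exists2 a, a \in p & a != 0.

(** p contains a positive integer, and primality of p lets one split off prime factors until one of
    them lies in p. *)
Lemma exists_prime_in_ideal : exists2 l, prime l & (l%:R : O) \in p.
Proof.
have [a ap a0] := p_neq0; have [c [b [c0 ec]]] := ringint_int_multiple a0.
have mp : ((`|c|%N)%:R : O) \in p.
  have cp : (c%:~R : O) \in p by rewrite ec mulrC idealMr.
  case: (intP c) cp => [|n|n] cp; first by rewrite absz0 mulr0n rpred0.
    exact: cp.
  by rewrite abszN; move: cp; rewrite mulrNz rpredN.
have : (0 < `|c|)%N by rewrite absz_gt0.
elim/ltn_ind: `|c|%N mp => m IH mp m0.
have [m1|m1] := leqP m 1.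
  have e1 : m = 1%N by apply/eqP; rewrite eqn_leq m1.
  by move: mp; rewrite e1 idealr1.
have pm := pdiv_prime m1.
move: mp; rewrite -{1}(divnK (pdiv_dvd m)) natrM prime_idealrM => /orP[h|]; last by exists (pdiv m).
by apply: IH h _; [rewrite ltn_Pdiv ?prime_gt1 | rewrite divn_gt0 ?pdiv_gt0// dvdn_leq ?pdiv_dvd].
Qed.

Section WithPrime.
Variable l : nat.
Hypothesis pl : prime l.
Hypothesis lp : (l%:R : O) \in p.

Let l0 : (l%:R : O) != 0.
Proof. by rewrite ringint_natr_eq0 -lt0n prime_gt0. Qed.

Lemma mod_pigeonhole (g : nat -> O) :
  exists m n, (m < n)%N /\ exists z, g n - g m = l%:R * z.
Proof.
have [s hs] := ringint_mod_finite K pl.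
have hs' (n : nat) : exists i : 'I_(size s), exists z, g n - s`_i = l%:R * z.
  have [y ys hy] := hs (g n); have iy : (index y s < size s)%N by rewrite index_mem.
  by exists (Ordinal iy); rewrite /= nth_index.
have [r hr] := choice hs'.
have : ~~ injectiveb (fun i : 'I_(size s).+1 => r i).
  apply/negP => /injectiveP /leq_card; by rewrite !card_ord ltnn.
move=> /injectivePn[i [j ij e]].
wlog lij : i j ij e / (i < j)%N.
  move=> W; have := ltngtP i j => -[h|h|/val_inj h]; [exact: (W i j)| |by rewrite h eqxx in ij].
  by apply: (W j i) => //; rewrite eq_sym.
exists i, j; split=> //.
have [z1 e1] := hr i; have [z2 e2] := hr j; exists (z2 - z1).
by rewrite mulrBr -e1 -e2 e opprB addrA subrK.
Qed.

(** Two powers of a agree modulo l, so a^m (1 - a^(n-m)) lies in p while a^m does not. *)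
Lemma prime_maximal a : a \notin p -> exists c, 1 - a * c \in p.
Proof.
move=> ap; have [m [n [mn [z e]]]] := mod_pigeonhole (fun n => a ^+ n).
have an k : a ^+ k \notin p.
  by elim: k => [|k IH]; rewrite ?expr0 ?idealr1// exprS prime_idealrM negb_or ap.
exists (a ^+ (n - m).-1); rewrite -exprS prednK ?subn_gt0//.
have : a ^+ m * (1 - a ^+ (n - m)) \in p.
  rewrite mulrBr mulr1 -exprD subnKC ?(ltnW mn)// -opprB e rpredN.
  by rewrite mulrC idealMr.
by rewrite prime_idealrM (negPf (an m)).
Qed.

Lemma prime_prod_notin (I : finType) (P : pred I) (h : I -> O) :
  (forall i, P i -> h i \notin p) -> \prod_(i | P i) h i \notin p.
Proof.
move=> hp; elim/big_rec: _ => [|i x Pi xp]; first by rewrite idealr1.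
by rewrite prime_idealrM negb_or hp.
Qed.

(* b / l lies in the inverse of the ideal p but not in O. *)
Lemma exists_annihilated : exists b : O,
  (forall z, b <> l%:R * z) /\ (forall x, x \in p -> exists z, b * x = l%:R * z).
Proof.
have [s hs] := ringint_mod_finite K pl.
pose L (x : O) := exists z, x = l%:R * z.
have LD x y : L x -> L y -> L (x + y).
  by move=> [u ->] [v ->]; exists (u + v); rewrite mulrDr.
have LM x y : L x -> L (x * y) by move=> [u ->]; exists (u * y); rewrite mulrA.
have LN x : L x -> L (- x) by move=> [u ->]; exists (- u); rewrite mulrN.
have Lp x : L x -> x \in p by move=> [u ->]; rewrite mulrC idealMr.
(* Good means that the annihilator of b in O/lO lies in p/lO. Among good b one takes the ideal bO +
   lO as small as possible. *)
pose good b := forall x, L (x * b) -> x \in p.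
pose I b : pred 'I_(size s) := fun i => `[< exists c, L (s`_i - b * c) >].
have good1 : good 1 by move=> x; rewrite mulr1; exact: Lp.
have [b gb bmin] : exists2 b, good b & forall b', good b' -> (#|I b| <= #|I b'|)%N.
  have ex : exists n, `[< exists2 b, good b & #|I b| = n >].
    by exists #|I 1|; apply/asboolP; exists 1.
  case: (ex_minnP ex) => n /asboolP[b gb <-] h; exists b => // b' gb'.
  by apply: h; apply/asboolP; exists b'.
(* If x b were good, minimality would give b = x b c modulo l, hence 1 - x c in p, which is absurd
   for x in p. *)
have notgood x : x \in p -> exists y, y \notin p /\ L (y * (x * b)).
  move=> xp; apply: contrapT => no.
  have gxb : good (x * b).
    by move=> y Ly; apply: contrapT => yp; apply: no; exists y; split=> //; apply/negP.
  have sub : I (x * b) \subset I b.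
    apply/fintype.subsetP => i /asboolP[c hc]; apply/asboolP; exists (x * c).
    by rewrite mulrA [b * x]mulrC.
  have eqI : I b =i I (x * b).
    move=> i; symmetry; apply: (subset_cardP _ sub).
    by apply/eqP; rewrite eqn_leq subset_leq_card//= bmin.
  have [y ys [z ez]] := hs b; have iy : (index y s < size s)%N by rewrite index_mem.
  have : Ordinal iy \in I b.
    apply/asboolP; exists 1; rewrite /= nth_index// mulr1 -opprB ez; apply: LN.
    by exists z.
  rewrite eqI => /asboolP[c]; rewrite /= nth_index// => hc.
  have : L ((1 - x * c) * b).
    have -> : (1 - x * c) * b = (b - y) + (y - x * b * c) by ring.
    by apply: LD => //; exists z.
  move=> /gb h; have : 1 \in p by rewrite -(subrK (x * c) 1) rpredD// mulrC idealMr.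
  by rewrite idealr1.
have ch (i : 'I_(size s)) : exists y, y \notin p /\ (s`_i \in p -> L (y * (s`_i * b))).
  have [/notgood[y [yp Ly]]|ip] := boolP (s`_i \in p); first by exists y.
  by exists 1; rewrite idealr1.
have [h hh] := choice ch.
(* Finitely many representatives modulo l suffice: their killers outside p multiply to one y outside
   p, and y b is the required element. *)
pose y := \prod_i h i.
have yp : y \notin p by apply: prime_prod_notin => i _; case: (hh i).
exists (y * b); split=> [z e|x xp].
  by move/negP: yp; apply; apply: gb; exists z.
have [w ws [z ez]] := hs x; have iw : (index w s < size s)%N by rewrite index_mem.
have wp : w \in p.
  by rewrite -(subKr x w) ez rpredB// mulrC idealMr.
have [_ /=] := hh (Ordinal iw); rewrite nth_index// => /(_ wp) Lw.
have -> : y * b * x = l%:R * z * (y * b) + y * (w * b) by rewrite -ez; ring.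
apply: LD; first by apply: LM; exists z.
rewrite /y (bigD1 (Ordinal iw))//=.
set Y := \prod_(i | _) _; rewrite mulrAC; exact: LM.
Qed.

(** Put w = b/l, so that w p is contained in O. If w t = s lies outside p for some t in p, then s x
    = t (w x) for every x in p. Otherwise w maps p into itself, all w^n l lie in O, and two of them
    agree modulo l: w is a root of the monic X^n - X^m - z with z in O, hence lies in O, against the
    choice of b. *)
Lemma local_uniformizer : exists t s : O,
  [/\ t \in p, s \notin p & forall x, x \in p -> exists c, s * x = t * c].
Proof.
have [b [bl bp]] := exists_annihilated.
have [[t [s [tp sp e]]]|no] := pselect (exists t s, [/\ t \in p, s \notin p & b * t = l%:R * s]).
  exists t, s; split=> // x xp; have [z ez] := bp x xp; exists z.
  apply: (ringint_mulI l0); transitivity (l%:R * s * x); first by ring.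
  by rewrite -e; transitivity (b * x * t); [ring | rewrite ez; ring].
have stab x : x \in p -> exists2 y, y \in p & b * x = l%:R * y.
  move=> xp; have [y ey] := bp x xp; exists y => //.
  by apply: contrapT => /negP yp; apply: no; exists x, y.
pose w : K := val b / val (l%:R : O).
have l0' : val (l%:R : O) != 0.
  by apply: contraNneq l0 => e; apply/eqP/val_inj; rewrite rmorph0.
have wl : w * val (l%:R : O) = val b by rewrite divfK.
have pw n : exists2 y : O, y \in p & val y = w ^+ n * val (l%:R : O).
  elim: n => [|n [y yp ey]]; first by exists l%:R; rewrite ?mul1r.
  have [z zp ez] := stab y yp; exists z => //.
  have e1 : val b * val y = val (l%:R : O) * val z by rewrite -[RHS]rmorphM -ez rmorphM.
  by apply: (mulfI l0'); rewrite -e1 ey exprS -wl; ring.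
have [g hg] := choice (fun n => (let: ex_intro2 y _ e := pw n in ex_intro _ y e) : exists y : O,
  val y = w ^+ n * val (l%:R : O)).
have [m [n [mn [z ez]]]] := mod_pigeonhole g.
have wz : w ^+ n - w ^+ m = val z.
  apply: (mulIf l0'); rewrite mulrBl -!hg -rmorphB ez rmorphM mulrC//.
have : integralOver (intr : int -> K) w.
  apply: (@integral_root_monic _ _ _ w ('X^n - 'X^m - (val z)%:P)).
  - rewrite monicE -addrA lead_coefDl ?lead_coefXn// size_polyXn.
    rewrite -opprD size_polyN (leq_ltn_trans (size_polyD _ _))// size_polyXn gtn_max.
    by rewrite ltnS mn (leq_ltn_trans (size_polyC_leq1 _))// ltnS (leq_ltn_trans _ mn).
  - by rewrite /root !hornerE wz subrr.
  - apply/integral_poly => i; rewrite !coefB !coefXn coefC; apply: integral_sub.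
      by apply: integral_sub; exact: integral_nat.
    by case: ifP => _; [exact: ringint_integral | exact: (integral_nat _ 0)].
move=> /ringint_of_integral[w' ew].
case: (bl w'); apply: val_inj.
by transitivity (val (l%:R : O) * val w'); [rewrite ew mulrC wl | rewrite rmorphM].
Qed.

End WithPrime.
End LocalStructure.

(** * Finite rings, fields and modules from finiteness proofs *)

Section FiniteStructures.

Section Enumeration.
Variables (T : choiceType) (h : finite_set [set: T]%classic).
Definition fin_enum : seq T := fset_set [set: T]%classic.
Lemma mem_fin_enum x : x \in fin_enum.
Proof. by rewrite /fin_enum in_fset_set// inE. Qed.
Lemma fin_pickleK : pcancel (fun x => index x fin_enum) (fun n => onth fin_enum n).
Proof.
by move=> x; rewrite onthE (nth_map x) ?index_mem ?mem_fin_enum// nth_index ?mem_fin_enum.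
Qed.
Lemma fin_enumP : Finite.axiom fin_enum.
Proof. by move=> x; rewrite count_uniq_mem ?fset_uniq// mem_fin_enum. Qed.
End Enumeration.

(** An alias carrying the finiteness proof, on which the finite structure can be declared. *)
Definition finring (R : comNzRingType) (h : finite_set [set: R]%classic) : Type := R.
HB.instance Definition _ (R : comNzRingType) h := GRing.ComNzRing.on (@finring R h).
HB.instance Definition _ (R : comNzRingType) h :=
  Choice_isCountable.Build (@finring R h) (fin_pickleK h).
HB.instance Definition _ (R : comNzRingType) h :=
  fintype.isFinite.Build (@finring R h) (fin_enumP h).

Definition finmod (R : nzRingType) (V : lmodType R) (h : finite_set [set: V]%classic) : Type := V.
HB.instance Definition _ (R : nzRingType) (V : lmodType R) h := GRing.Lmodule.on (@finmod R V h).
HB.instance Definition _ (R : nzRingType) (V : lmodType R) h :=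
  Choice_isCountable.Build (@finmod R V h) (fin_pickleK h).
HB.instance Definition _ (R : nzRingType) (V : lmodType R) h :=
  fintype.isFinite.Build (@finmod R V h) (fin_enumP h).

Definition finfield (R : comNzRingType) (h : finite_set [set: R]%classic)
  (inv : R -> R) (mulVf : forall x, x != 0 -> inv x * x = 1) (inv0 : inv 0 = 0) : Type := R.
Section FinField.
Variables (R : comNzRingType) (h : finite_set [set: R]%classic).
Variables (inv : R -> R) (mulVf : forall x, x != 0 -> inv x * x = 1) (inv0 : inv 0 = 0).
Local Notation T := (finfield h mulVf inv0).
HB.instance Definition _ := GRing.ComNzRing.on T.
HB.instance Definition _ := GRing.ComNzRing_isField.Build T mulVf inv0.
HB.instance Definition _ := Choice_isCountable.Build T (fin_pickleK h).
HB.instance Definition _ := fintype.isFinite.Build T (fin_enumP h).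
End FinField.

End FiniteStructures.

Section IdealPowers.
Variables (O : comNzRingType) (p : idealr O).

Lemma idealXD k a b : a \in idealX p k -> b \in idealX p k -> a + b \in idealX p k.
Proof. by case: k => // k; move=> ha hb; exact: (@rpredD _ (idealXS p k : idealr O) a b ha hb). Qed.

Lemma idealXM k a b : a \in idealX p k -> b * a \in idealX p k.
Proof. by case: k => // k; exact: (@idealMr _ (idealXS p k : idealr O) b a). Qed.

Lemma idealX_mul k a b : a \in p -> b \in idealX p k -> a * b \in idealX p k.+1.
Proof.
move=> ap bk; apply/asboolP; exists 1%N, (fun=> a), (fun=> b).
by split=> //; rewrite big_ord1.
Qed.

Lemma idealX_exp k a : a \in p -> a ^+ k \in idealX p k.
Proof. by move=> ap; elim: k => // k IH; rewrite exprS idealX_mul. Qed.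

Lemma idealX_ind (Q : O -> Prop) k : (forall a b, Q a -> Q b -> Q (a + b)) -> Q 0 ->
  (forall a b, a \in p -> b \in idealX p k -> Q (a * b)) ->
  forall a, a \in idealX p k.+1 -> Q a.
Proof.
move=> QD Q0 QM a /asboolP[n [c [d [cp dp ->]]]].
by elim/big_rec: _ => // i x _ Qx; apply: QD => //; exact: QM.
Qed.

Lemma idealX_sub k a : a \in idealX p k.+1 -> a \in p.
Proof.
move: a; apply: idealX_ind => [a b|//|a b ap _]; [exact: rpredD|exact: rpred0|].
by rewrite mulrC idealMr.
Qed.

Lemma idealX_pred k a : a \in idealX p k.+1 -> a \in idealX p k.
Proof.
move: a; apply: idealX_ind => [a b|//|a b ap bk]; [exact: idealXD| |exact: idealXM].
by case: k => // k; exact: (@rpred0 _ (idealXS p k : idealr O)).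
Qed.

Lemma idealX_le k m a : (k <= m)%N -> a \in idealX p m -> a \in idealX p k.
Proof. by move=> /subnK <-; elim: (m - k)%N => // n IH /idealX_pred/IH. Qed.

Lemma piX_eq0 f a : (0 < f)%N -> (piX p f a == 0) = (a \in idealX p f).
Proof.
move=> f0; rewrite -(rmorph0 (piX p f)) /piX.
have -> : (a \in idealX p f) = (a - 0 \in idealXS p f.-1).
  by rewrite subr0 /idealXS prednK.
exact/esym/Quotient.idealrBE.
Qed.

Lemma piX_surj f (x : quotX p f) : exists a, piX p f a = x.
Proof. by exists (repr (x : {ideal_quot (idealXS p f.-1)})); rewrite /piX reprK. Qed.

Lemma unit_mod_idealX k a : (exists c, 1 - a * c \in p) -> exists c, 1 - a * c \in idealX p k.
Proof.
move=> [c cp]; set m := 1 - a * c in cp.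
exists (c * \sum_(i < k) m ^+ i).
have -> : 1 - a * (c * \sum_(i < k) m ^+ i) = m ^+ k.
  have -> : a * (c * \sum_(i < k) m ^+ i) = (1 - m) * \sum_(i < k) m ^+ i.
    by rewrite mulrA; congr (_ * _); rewrite /m subKr.
  have := subrX1 m k => e.
  by rewrite -[1 - m]opprB mulNr -e opprK addrC subrK.
exact: idealX_exp.
Qed.

End IdealPowers.

Section LocalRings.
Variable K : fieldExtType rat.
Local Notation O := (ringint K).
Variable p : prime_idealr O.
Hypothesis p_neq0 : exists2 a, a \in p & a != 0.

(** Write x = y + l w with y from a finite list and reduce w modulo p^k: as l lies in p, this gives
    x modulo p^(k+1). *)
Lemma finite_mod_idealX k : exists s : seq O, forall x, exists2 y, y \in s & x - y \in idealX p k.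
Proof.
have [l pl lp] := exists_prime_in_ideal p_neq0.
have [s hs] := ringint_mod_finite K pl.
elim: k => [|k [s' hs']]; first by exists [:: 0] => x; exists 0; rewrite ?inE.
exists [seq y + l%:R * z | y <- s, z <- s'] => x.
have [y ys [w ew]] := hs x; have [z zs hz] := hs' w.
exists (y + l%:R * z); first by apply/allpairsP; exists (y, z).
have -> : x - (y + l%:R * z) = l%:R * (w - z) by rewrite mulrBr -ew opprD addrA.
exact: idealX_mul.
Qed.

Lemma finite_quot (T : choiceType) (g : O -> T) k : (forall x, exists a, g a = x) ->
  (forall a b, a - b \in idealX p k -> g a = g b) -> finite_set [set: T]%classic.
Proof.
move=> sg eg; have [s hs] := finite_mod_idealX k.
apply: (@sub_finite_set _ _ [set` [seq g a | a <- s]]%classic); last exact: finite_seq.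
move=> x _ /=; have [a <-] := sg x; have [b bs hb] := hs a.
by rewrite (eg _ _ hb); exact: map_f.
Qed.

Lemma residue_field : exists (F : finFieldType) (tau : {rmorphism {ideal_quot p} -> F}),
  bijective tau.
Proof.
have h : finite_set [set: {ideal_quot p}]%classic.
  apply: (@finite_quot _ (\pi_{ideal_quot p}) 1) => [x|a b /idealX_sub].
    by exists (repr x); rewrite reprK.
  by rewrite Quotient.idealrBE => /eqP.
have inv_ex (x : {ideal_quot p}) : exists y, (x != 0 -> y * x = 1) /\ (x = 0 -> y = 0).
  have [->|x0] := eqVneq x 0; first by exists 0.
  have [l pl lp] := exists_prime_in_ideal p_neq0.
  have xp : repr x \notin p.
    apply: contraNN x0 => xp; rewrite -[x]reprK; apply/eqP.
    rewrite -(rmorph0 \pi_{ideal_quot p}); apply/eqP; rewrite -Quotient.idealrBE subr0//.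
  have [c hc] := prime_maximal pl lp xp.
  exists (\pi c); split=> [_|e]; last by rewrite e eqxx in x0.
  rewrite -{1}[x]reprK -rmorphM -(rmorph1 \pi_{ideal_quot p}); apply/eqP.
  by rewrite -Quotient.idealrBE -opprB rpredN mulrC.
have [inv hinv] := choice inv_ex.
exists (finfield h (fun x => (hinv x).1) ((hinv 0).2 erefl)).
exists (GRing.RMorphism.clone _ _ (@idfun {ideal_quot p}) _).
by exists id.
Qed.

Variables (F : finFieldType) (tau : {rmorphism {ideal_quot p} -> F}).
Hypothesis tau_bij : bijective tau.

Definition resmap (a : O) : F := tau (\pi_{ideal_quot p} a).

Lemma resmap_is_zmod_morphism : zmod_morphism resmap.
Proof. by move=> a b; rewrite /resmap !rmorphB. Qed.
Lemma resmap_is_monoid_morphism : monoid_morphism resmap.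
Proof. by split=> [|a b]; rewrite /resmap ?rmorph1 ?rmorphM. Qed.
HB.instance Definition _ := GRing.isZmodMorphism.Build O F resmap resmap_is_zmod_morphism.
HB.instance Definition _ := GRing.isMonoidMorphism.Build O F resmap resmap_is_monoid_morphism.

Lemma resmap_eq0 a : (resmap a == 0) = (a \in p).
Proof.
rewrite /resmap -(rmorph0 tau) (bij_eq tau_bij) -(rmorph0 \pi_{ideal_quot p}).
by rewrite -Quotient.idealrBE subr0.
Qed.

Lemma resmap_surj x : exists a, resmap a = x.
Proof.
have [g gt tg] := tau_bij; exists (repr (g x)).
by rewrite /resmap reprK tg.
Qed.

Lemma card_residue : #|F| = set_card [set: {ideal_quot p}]%classic.
Proof.
have h : finite_set [set: {ideal_quot p}]%classic.
  apply: (@finite_quot _ (\pi_{ideal_quot p}) 1) => [x|a b /idealX_sub].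
    by exists (repr x); rewrite reprK.
  by rewrite Quotient.idealrBE => /eqP.
have [g gt tg] := tau_bij.
rewrite /set_card cardE -(size_map tau); apply: perm_size; apply: uniq_perm.
- exact: enum_uniq.
- by rewrite map_inj_uniq ?fset_uniq//; exact: bij_inj.
- move=> x; rewrite mem_enum inE; apply/esym/mapP; exists (g x); last by rewrite tg.
  by rewrite in_fset_set// inE.
Qed.

(** The local uniformizer t becomes a generator of p/p^f once s is inverted modulo p^f. *)
Lemma local_ring f : (0 < f)%N ->
  exists (R : finComNzRingType) (kappa : {rmorphism quotX p f -> R})
    (rho : {rmorphism R -> F}) (t : R),
  [/\ bijective kappa, uniformizer rho t f & forall a, rho (kappa (piX p f a)) = resmap a].
Proof.
move=> f0.
have h : finite_set [set: quotX p f]%classic.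
  apply: (@finite_quot _ (piX p f) f) => [x|a b]; first exact: piX_surj.
  by rewrite -(piX_eq0 p _ f0) rmorphB subr_eq0 => /eqP.
pose R := finring h.
pose kappa : {rmorphism quotX p f -> R} := GRing.RMorphism.clone _ _ (@idfun (quotX p f)) _.
pose rho0 (x : R) : F := resmap (repr (x : {ideal_quot (idealXS p f.-1)})).
have rhoE a : rho0 (piX p f a) = resmap a.
  apply/eqP; rewrite -subr_eq0 -rmorphB resmap_eq0.
  apply: (@idealX_sub _ p f.-1); rewrite prednK// -piX_eq0// rmorphB.
  by rewrite /= {1}/piX reprK subrr.
have rhoB : zmod_morphism rho0.
  move=> x y; have [a <-] := piX_surj x; have [b <-] := piX_surj y.
  rewrite [_ - _](_ : _ = piX p f (a - b)); last by rewrite rmorphB.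
  by rewrite !rhoE rmorphB.
have rhoM : monoid_morphism rho0.
  split; first by rewrite -[1](rmorph1 (piX p f)) rhoE rmorph1.
  move=> x y; have [a <-] := piX_surj x; have [b <-] := piX_surj y.
  rewrite [_ * _](_ : _ = piX p f (a * b)); last by rewrite rmorphM.
  by rewrite !rhoE rmorphM.
pose rho := HB.pack_for {rmorphism R -> F} rho0
  (GRing.isZmodMorphism.Build R F rho0 rhoB) (GRing.isMonoidMorphism.Build R F rho0 rhoM).
have [l pl lp] := exists_prime_in_ideal p_neq0.
have [t [s [tp sp st]]] := local_uniformizer pl lp.
have [s' hs'] := @unit_mod_idealX _ p f s (prime_maximal pl lp sp).
exists R, kappa, rho, (piX p f t); split.
- by exists id.
- split=> //.
  + by move=> x; have [a <-] := resmap_surj x; exists (piX p f a); exact: rhoE.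
  + move=> x; have [a <-] := piX_surj x; rewrite [rho _]rhoE; split=> [/eqP|[b]].
      rewrite resmap_eq0 => /st[c ec]; exists (piX p f (c * s')).
      apply/eqP; rewrite -[X in _ == X](rmorphM (piX p f)) -subr_eq0 -(rmorphB (piX p f)).
      rewrite piX_eq0//; have -> : a - t * (c * s') = a * (1 - s * s').
        by rewrite mulrA -ec; ring.
      exact: idealXM.
    have [b' <-] := piX_surj b; rewrite -[X in _ = X](rmorphM (piX p f)) => /eqP.
    rewrite -subr_eq0 -(rmorphB (piX p f)) piX_eq0// -(prednK f0) => /idealX_sub.
    move=> h'; apply/eqP; rewrite resmap_eq0 -(subrK (t * b') a) rpredD//.
    by rewrite mulrC idealMr.
  + apply/eqP; rewrite -[X in X == _](rmorphXn (piX p f)) piX_eq0//; exact: idealX_exp.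
  + rewrite -[X in X != _](rmorphXn (piX p f)) piX_eq0//; apply/negP => tf.
    (* If t^(f-1) were in p^f, then s^f t^(f-1) = t^f c, and cancelling would put s^f in p. *)
    have key k a : a \in idealX p k -> exists c, s ^+ k * a = t ^+ k * c.
      elim: k a => [|k IH] a; first by exists a.
      move: a; apply: idealX_ind => [a b [c ec] [d ed]| |a b ap /IH[d ed]].
      * by exists (c + d); rewrite !mulrDr ec ed.
      * by exists 0; rewrite !mulr0.
      * have [c ec] := st a ap; exists (c * d).
        transitivity ((s * a) * (s ^+ k * b)); first by rewrite exprS; ring.
        by rewrite ec ed exprS; ring.
    have [c ec] := key _ _ tf.
    have t0 : t != 0.
      have [x xp x0] := p_neq0; apply: contraNneq x0 => t0.
      have [c1] := st x xp; rewrite t0 mul0r => /ringint_mulf_eq0[s0|->//].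
      by rewrite s0 rpred0 in sp.
    have tX k : t ^+ k != 0.
      elim: k => [|k IH]; first by rewrite expr0 oner_neq0.
      apply/eqP; rewrite exprS => /ringint_mulf_eq0[/eqP|/eqP]; apply/negP => //.
    have : s ^+ f = t * c.
      apply: (ringint_mulI (tX f.-1)); rewrite mulrC ec.
      by rewrite mulrA -exprSr prednK.
    move=> e; have : s ^+ f \in p by rewrite e mulrC idealMr.
    apply/negP; elim: (f) => [|k IH]; first by rewrite expr0 idealr1.
    by rewrite exprS prime_idealrM negb_or sp.
- by move=> a; exact: rhoE.
Qed.

End LocalRings.

(** * Modules over a residue ring *)

Definition withscale (R : nzRingType) (G : finZmodType) (act : R -> G -> G)
  (actA : forall a b v, act a (act b v) = act (a * b) v) (act1 : left_id 1 act)
  (actDr : right_distributive act +%R) (actDl : forall v, {morph act^~ v : a b / a + b}) : Type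
    := G.

Section WithScale.
Variables (R : nzRingType) (G : finZmodType) (act : R -> G -> G).
Variables (actA : forall a b v, act a (act b v) = act (a * b) v) (act1 : left_id 1 act).
Variables (actDr : right_distributive act +%R) (actDl : forall v, {morph act^~ v : a b / a + b}).
Local Notation T := (withscale actA act1 actDr actDl).
HB.instance Definition _ := FinRing.Zmodule.on T.
HB.instance Definition _ := GRing.Zmodule_isLmodule.Build R T actA act1 actDr actDl.
End WithScale.

Section Descent.
Variables (O : comNzRingType) (R : finComNzRingType) (s : {rmorphism O -> R}).
Hypothesis s_surj : forall y, exists a, s a = y.

(* M is G, seen as a module over the quotient R of O *)
Definition descends (G : finLmodType O) (M : finLmodType R) (e : G -> M) : Prop :=
  bijective e /\ forall a x y, e (a *: x + y) = s a *: e x + e y.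

Lemma descends_exists (G : finLmodType O) : (forall a (x : G), s a = 0 -> a *: x = 0) ->
  exists (M : finLmodType R) (e : G -> M), descends e.
Proof.
move=> kG; have [g hg] := fin_all_exists s_surj.
have gE a b (x : G) : s a = s b -> a *: x = b *: x.
  by move=> e; apply/eqP; rewrite -subr_eq0 -scalerBl kG// rmorphB e subrr.
pose act (y : R) (x : G) : G := g y *: x.
have actA a b v : act a (act b v) = act (a * b) v.
  by rewrite /act scalerA; apply: gE; rewrite rmorphM !hg.
have act1 : left_id 1 act by move=> v; rewrite /act -[RHS]scale1r; apply: gE; rewrite hg rmorph1.
have actDr : right_distributive act +%R by move=> a u v; rewrite /act scalerDr.
have actDl v : {morph act^~ v : a b / a + b}.
  by move=> a b; rewrite /act -scalerDl; apply: gE; rewrite rmorphD !hg.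
exists (withscale actA act1 actDr actDl), id; split; first by exists id.
by move=> a x y; congr (_ + _); apply: gE; rewrite hg.
Qed.

Variables (G : finLmodType O) (M : finLmodType R) (e : G -> M).
Hypothesis dG : descends e.

Lemma descD x y : e (x + y) = e x + e y.
Proof. by rewrite -[x in LHS]scale1r dG.2 rmorph1 scale1r. Qed.

Lemma desc0 : e 0 = 0.
Proof. by apply: (@addrI _ (e 0)); rewrite -descD !addr0. Qed.

Lemma descZ a x : e (a *: x) = s a *: e x.
Proof. by rewrite -[a *: x]addr0 dG.2 desc0 addr0. Qed.

Lemma desc_card : #|M| = #|G|.
Proof. exact/esym/(bij_eq_card dG.1). Qed.

Variables (H : finLmodType O) (N : finLmodType R) (e' : H -> N).
Hypothesis dH : descends e'.

Lemma desc_linear (h : G -> H) : linear h ->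
  exists h' : M -> N, [/\ linear h', forall x, h' (e x) = e' (h x) & bijective h -> bijective h'].
Proof.
move=> lh; have [g ge eg] := dG.1.
have lin : linear (e' \o h \o g).
  move=> a x y /=; have [b <-] := s_surj a.
  by rewrite -{1}(eg x) -{1}(eg y) -dG.2 ge lh dH.2.
exists (e' \o h \o g); split=> // [x|bh]; first by rewrite /= ge.
by apply: bij_comp; [exact: bij_comp dH.1 bh | exists e].
Qed.

Lemma lift_linear (h : M -> N) : linear h ->
  exists h' : G -> H, [/\ linear h', forall x, e' (h' x) = h (e x) & bijective h -> bijective h'].
Proof.
move=> lh; have [g ge eg] := dH.1.
have lin : linear (g \o h \o e).
  move=> a x y /=; apply: (can_inj ge).
  by rewrite eg dG.2 lh dH.2 !eg.
exists (g \o h \o e); split=> // [x|bh]; first by rewrite /= eg.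
by apply: bij_comp; [apply: bij_comp => //; exists e' | exact: dG.1].
Qed.

End Descent.

Lemma linear_bundle (O : nzRingType) (V W : lmodType O) (f : V -> W) : linear f ->
  exists g : {linear V -> W}, forall x, g x = f x.
Proof.
move=> lf; pose g := HB.pack_for {linear V -> W} f (GRing.isLinear.Build _ _ _ _ f lf).
by exists g.
Qed.

Section DescentConsequences.
Variables (O : comNzRingType) (R : finComNzRingType) (s : {rmorphism O -> R}).
Hypothesis s_surj : forall y, exists a, s a = y.

Lemma desc_iso (G H : finLmodType O) (M N : finLmodType R) (e : G -> M) (e' : H -> N) :
  descends s e -> descends s e' -> lmod_iso G H ->
  exists f : M -> N, linear f /\ bijective f.
Proof.
move=> dG dH [h bh]; have [f [lf _ bf]] := desc_linear s_surj dG dH (linearP h).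
by exists f; split=> //; exact: bf.
Qed.

Lemma lift_iso (G H : finLmodType O) (M N : finLmodType R) (e : G -> M) (e' : H -> N) (f : M -> N) :
  descends s e -> descends s e' -> linear f -> bijective f -> lmod_iso G H.
Proof.
move=> dG dH lf bf; have [h [lh _ bh]] := lift_linear dG dH lf.
have [g hg] := linear_bundle lh; exists g.
by apply: (eq_bij (bh bf)) => x; rewrite hg.
Qed.

Lemma desc_aut (G : finLmodType O) (M : finLmodType R) (e : G -> M) :
  descends s e -> card_Aut G = aut_count M.
Proof.
move=> dG; have [g ge eg] := dG.1.
have inj (f : {perm G}) : injective (e \o f \o g).
  by apply: inj_comp; [apply: inj_comp; [exact: can_inj ge|exact: perm_inj]|exact: can_inj eg].
have inj' (f : {perm M}) : injective (g \o f \o e).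
  by apply: inj_comp; [apply: inj_comp; [exact: can_inj eg|exact: perm_inj]|exact: can_inj ge].
rewrite /card_Aut /aut_count.
apply: (@card_bij_pred _ _ (fun f => perm (inj f)) (fun f => perm (inj' f))) => f.
  move=> /asboolP lf; split.
    apply/is_linP => a x y; rewrite !permE /=; have [b <-] := s_surj a.
    by rewrite -{1}(eg x) -{1}(eg y) -dG.2 ge lf dG.2.
  by apply/permP => x; rewrite permE /= permE /= !ge.
move=> /is_linP lf; split.
  apply/asboolP => a x y; rewrite !permE /=; apply: (can_inj ge).
  by rewrite dG.2 lf dG.2 !eg.
by apply/permP => x; rewrite permE /= permE /= !eg.
Qed.

Lemma lquot_iso (G H : finLmodType O) (y : H) :
  lmod_iso (lquot (cyclic_submod y)) G <->
  exists f : H -> G, [/\ linear f, forall z, exists x, f x = z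
    & forall x, f x = 0 <-> exists a, x = a *: y].
Proof.
split=> [[phi [psi phipsi psiphi]]|[f [lf sf kf]]].
  pose V := lquot (cyclic_submod y).
  pose pi (x : H) : V := lquot_pi (cyclic_submod y) x.
  exists (fun x => phi (pi x)); split.
  - move=> a u v; rewrite -linearP; congr (phi _); rewrite /pi lquot_piD.
    by congr (_ + _); apply/esym/lquot_piZ.
  - move=> z; have : exists x, pi x = psi z.
      by elim/lquot_ind: (psi z) => v; exists v.
    by move=> [x ex]; exists x; rewrite ex psiphi.
  - move=> x; have p0 : phi (pi 0) = 0.
      have := lquot_piZ (cyclic_submod y) 0 (0 : H); rewrite scale0r => e0.
      by rewrite /pi -e0 -[lquot_scale _ _]/(0 *: pi 0) scale0r linear0.
    split=> [e|[a ->]].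
      have : pi x = pi 0 by apply: (can_inj phipsi); rewrite e p0.
      by move=> /lquot_piP; rewrite subr0 => /asboolP.
    rewrite -p0; congr (phi _); apply/lquot_piP; rewrite subr0.
    by apply/asboolP; exists a.
have fB u v : f (u - v) = f u - f v by rewrite -scaleN1r addrC lf scaleN1r addrC.
pose V := lquot (cyclic_submod y).
pose pi (x : H) : V := lquot_pi (cyclic_submod y) x.
have piE u v : pi u = pi v <-> f u = f v.
  rewrite /pi lquot_piP; split=> [/asboolP/kf|e].
    by rewrite fB => /eqP; rewrite subr_eq0 => /eqP.
  by apply/asboolP/kf; rewrite fB e subrr.
have [g hg] := fin_all_exists sf.
pose psi z := pi (g z).
have lpsi : linear psi.
  move=> a u v; have e1 : a *: pi (g u) = pi (a *: g u) by exact: lquot_piZ.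
  by rewrite /psi e1 -lquot_piD; apply/piE; rewrite lf !hg.
have bpsi : bijective psi.
  have surj (x : V) : exists z, psi z = x.
    by elim/lquot_ind: x => v; exists (f v); apply/piE; rewrite hg.
  have [k hk] := choice surj; exists k => z; last exact: hk.
  have /piE := hk (psi z); rewrite !hg => ->//.
apply: lmod_iso_sym; have [k hk] := linear_bundle lpsi.
by exists k; apply: (eq_bij bpsi) => x; rewrite hk.
Qed.

Lemma desc_quot_by (G H : finLmodType O) (M N : finLmodType R) (e : G -> M) (e' : H -> N) (y : H) :
  descends s e -> descends s e' ->
  lmod_iso (lquot (cyclic_submod y)) G <-> quot_by M (e' y).
Proof.
move=> dG dH; rewrite lquot_iso; have [k ke ek] := dG.1; have [k' ke' ek'] := dH.1.
split=> [[f [lf sf kf]]|/quot_byP[f [lf sf kf]]].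
  have [h [lh eh _]] := desc_linear s_surj dH dG lf; apply/quot_byP; exists h; split=> //.
    by move=> z; have [x ex] := sf (k z); exists (e' x); rewrite eh ex ek.
  move=> x; rewrite -(ek' x) eh -(desc0 dG); split=> [/(can_inj ke)/kf[a ->]|[a ea]].
    by exists (s a); rewrite (descZ dH).
  have [b eb] := s_surj a; congr e; apply/kf; exists b; apply: (can_inj ke').
  by rewrite ea -eb (descZ dH).
have [h [lh eh _]] := lift_linear dH dG lf; exists h; split=> //.
  move=> z; have [x ex] := sf (e z); exists (k' x); apply: (can_inj ke).
  by rewrite eh ek' ex.
move=> x; split=> [hx|[a ->]].
  have : f (e' x) = 0 by rewrite -eh hx (desc0 dG).
  move=> /kf[a ea]; have [b eb] := s_surj a; exists b; apply: (can_inj ke').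
  by rewrite ea -eb (descZ dH).
apply: (can_inj ke); rewrite eh (desc0 dG); apply/kf; exists (s a).
by rewrite (descZ dH).
Qed.

End DescentConsequences.

Lemma pkills_le (O : comNzRingType) (p : idealr O) k m (G : lmodType O) :
  (k <= m)%N -> pkills p k G -> pkills p m G.
Proof. by move=> km h a x /(idealX_le km); exact: h. Qed.

Lemma pkills_iso (O : comNzRingType) (p : idealr O) k (G H : lmodType O) :
  lmod_iso G H -> pkills p k G -> pkills p k H.
Proof.
move=> [f [g fg gf]] h a x ha; rewrite -(gf x) -linearZ h// linear0//.
Qed.

Section CokernelModule.
Variables (O : comNzRingType) (R : finComNzRingType) (s : {rmorphism O -> R}).
Hypothesis s_surj : forall y, exists a, s a = y.
Variables (n : nat) (X : 'M[R]_n).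

Definition cok_rel : {pred 'rV[O]_n} := fun v => `[< exists u, map_mx s v = u *m X >].

Lemma cok_rel_closed : submod_closed cok_rel.
Proof.
split; first by apply/asboolP; exists 0; rewrite raddf0 mul0mx.
move=> a u v /asboolP[u' eu] /asboolP[v' ev]; apply/asboolP; exists (s a *: u' + v').
by rewrite raddfD/= map_mxZ eu ev mulmxDl scalemxAl.
Qed.
HB.instance Definition _ := GRing.isSubmodClosed.Build O 'rV[O]_n cok_rel cok_rel_closed.

Lemma cok_finite : finite_set [set: lquot cok_rel]%classic.
Proof.
have [g hg] := fin_all_exists s_surj.
pose q (w : 'rV[R]_n) : lquot cok_rel := lquot_pi cok_rel (\row_i g (w 0 i)).
apply: (@sub_finite_set _ _ [set` [seq q w | w <- enum {: 'rV[R]_n}]]%classic);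
  last exact: finite_seq.
move=> x _ /=; elim/lquot_ind: x => v; apply/mapP; exists (map_mx s v); rewrite ?mem_enum//.
apply/lquot_piP/asboolP; exists 0; rewrite mul0mx; apply/rowP => i.
by rewrite !mxE rmorphB hg subrr.
Qed.

Lemma cokernel_module : exists H : finLmodType O,
  (forall a (x : H), s a = 0 -> a *: x = 0) /\
  forall (M : finLmodType R) (e : H -> M), descends s e -> cokis M X.
Proof.
exists (finmod cok_finite); split=> [a|M e de].
  elim/lquot_ind => v sa; have := lquot_piZ cok_rel a v => e0.
  transitivity (lquot_scale a (lquot_pi cok_rel v)) => //; rewrite e0.
  transitivity (lquot_pi cok_rel (0 : 'rV[O]_n)).
    apply/lquot_piP; rewrite subr0; apply/asboolP; exists 0.
    by rewrite map_mxZ sa scale0r mul0mx.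
  by have := lquot_piZ cok_rel 0 (0 : 'rV[O]_n); rewrite scale0r => <-;
    exact: (scale0r (lquot_pi cok_rel 0)).
pose pi (v : 'rV[O]_n) : finmod cok_finite := lquot_pi cok_rel v.
pose h := \row_i e (pi (delta_mx 0 i)).
have piL a u v : pi (a *: u + v) = a *: pi u + pi v.
  by rewrite {1}/pi lquot_piD; congr (_ + _); exact/esym/lquot_piZ.
have pi0 : pi 0 = 0.
  have := piL 1 0 0; rewrite !scale1r !addr0 => /eqP.
  by rewrite -subr_eq0 opprD addrA subrr sub0r oppr_eq0 => /eqP.
have lcE v : lc (map_mx s v) h = e (pi v).
  rewrite /lc [in RHS](row_sum_delta v).
  elim/big_rec2: _ => [|i x y _ ->]; first by rewrite pi0 (desc0 de).
  by rewrite piL de.2 !mxE.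
apply/existsP; exists h; apply/presP; split=> [x|w].
  have [k ek ke] := de.1; have : exists v, pi v = k x.
    by elim/lquot_ind: (k x) => v; exists v.
  by move=> [v ev]; exists (map_mx s v); rewrite lcE ev ke.
have [g hg] := fin_all_exists s_surj.
have -> : w = map_mx s (\row_i g (w 0 i)) by apply/rowP => i; rewrite !mxE hg.
set v := \row_i _; rewrite lcE -(desc0 de); split.
  move=> /(bij_inj de.1); rewrite -pi0 => /lquot_piP; rewrite subr0 => /asboolP//.
by move=> ex; congr e; rewrite -pi0; apply/lquot_piP; rewrite subr0; apply/asboolP.
Qed.

End CokernelModule.

Section Ranks.
Variables (O : comNzRingType) (p : idealr O) (F : finFieldType) (res : {rmorphism O -> F}).
Hypothesis res_eq0 : forall a, (res a == 0) = (a \in p).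
Hypothesis res_surj : forall x, exists a, res a = x.

(** The p-rank through a map G -> F^r with kernel pG; it avoids the quotient type and matches
    [coords] over R. *)
Definition res_rank (G : finLmodType O) (r : nat) : Prop :=
  exists phi : G -> 'rV[F]_r,
    [/\ forall a x y, phi (a *: x + y) = res a *: phi x + phi y,
        forall w, exists x, phi x = w
      & forall x, phi x = 0 <-> x \in span_prod p (predT : {pred G})].

Variables (R : finComNzRingType) (rho : {rmorphism R -> F}) (t : R) (l : nat).
Variable s : {rmorphism O -> R}.
Hypothesis ut : uniformizer rho t l.
Hypothesis s_surj : forall y, exists a, s a = y.
Hypothesis rho_s : forall a, rho (s a) = res a.

Variables (G : finLmodType O) (M : finLmodType R) (e : G -> M).
Hypothesis dG : descends s e.

Lemma span_tmul x : x \in span_prod p (predT : {pred G}) <-> tmul t (xpredT : pred M) (e x).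
Proof.
have [_ rk _ _ _] := ut; split.
  move=> /asboolP[k [a [v [ap _ ->]]]].
  elim/big_rec: _ => [|i y _ ty].
    by rewrite (desc0 dG); have [] := tmul_submod t (@predT_submod _ M).
  rewrite dG.2; apply: submodD (tmul_submod t (@predT_submod _ M)) _ ty.
  have /rk[b ->] : rho (s (a i)) = 0 by rewrite rho_s; apply/eqP; rewrite res_eq0.
  by rewrite -scalerA tmulI.
move=> /existsP[y /andP[_ /eqP ey]].
have [t0 et] := s_surj t; have [k ke ek] := dG.1.
have t0p : t0 \in p by rewrite -res_eq0 -rho_s et (rho_t ut).
apply/asboolP; exists 1%N, (fun=> t0), (fun=> k y); split=> //.
rewrite big_ord1; apply: (can_inj ke); rewrite ey (descZ dG) et ek//.
Qed.

Lemma res_rank_coords r : res_rank G r <-> exists phi : M -> 'rV[F]_r, coords rho t xpredT phi.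
Proof.
have [k ke ek] := dG.1; split=> [[phi [lin sur ker]]|[phi [lin sur ker]]].
  exists (phi \o k); split=> [a x y _ _|w|x _] /=.
  - have [b <-] := s_surj a; rewrite rho_s -lin; congr phi.
    by apply: (can_inj ke); rewrite dG.2 !ek.
  - by have [x <-] := sur w; exists (e x); rewrite //= ke.
  - by apply/eqP/idP => [/ker/span_tmul|tx]; [rewrite ek | apply/ker/span_tmul; rewrite ek].
exists (phi \o e); split=> [a x y|w|x] /=; first by rewrite dG.2 lin// rho_s.
- by have [x _ <-] := sur w; exists (k x); rewrite ek.
- by split=> [/eqP|/span_tmul]; rewrite -?ker// => h; [apply/span_tmul; rewrite -ker|apply/eqP].
Qed.

Lemma res_rank_uniq r r' : res_rank G r -> res_rank G r' -> r = r'.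
Proof.
move=> /res_rank_coords[phi c] /res_rank_coords[phi' c'].
have := coords_card (@predT_submod _ M) c; rewrite (coords_card (@predT_submod _ M) c').
move/eqP; rewrite eqn_pmul2r ?tmul_gt0// eqn_exp2l ?card_finNzRing_gt1//.
by move=> /eqP.
Qed.

Lemma res_rank_exists : exists r, res_rank G r.
Proof.
have [r [phi c]] := coords_exists ut (@predT_submod _ M).
by exists r; apply/res_rank_coords; exists phi.
Qed.

End Ranks.

(** * Isomorphism classes of cyclic extensions *)

Section Classes.
Variable K : fieldExtType rat.
Local Notation O := (ringint K).
Variable p : prime_idealr O.
Hypothesis p_neq0 : exists2 a, a \in p & a != 0.
Variables (F : finFieldType) (tau : {rmorphism {ideal_quot p} -> F}).
Hypothesis tau_bij : bijective tau.

Local Notation q := #|F|.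
Local Notation res := (resmap tau).
Local Notation rk := (res_rank p res).

Let res0 a : (res a == 0) = (a \in p). Proof. exact: resmap_eq0. Qed.

Lemma local_system l : (0 < l)%N ->
  exists (R : finComNzRingType) (s : {rmorphism O -> R}) (rho : {rmorphism R -> F}) (t : R),
  [/\ forall y, exists a, s a = y, forall a, (s a == 0) = (a \in idealX p l),
      uniformizer rho t l & forall a, rho (s a) = res a].
Proof.
move=> l0; have [R [kappa [rho [t [kb ut hr]]]]] := local_ring p_neq0 tau_bij l0.
exists R, (kappa \o piX p l : {rmorphism O -> R}), rho, t; split=> //.
  move=> y; have [g kg gk] := kb; have [a ea] := piX_surj (g y).
  by exists a; rewrite /= ea gk.
by move=> a; rewrite /= -(rmorph0 kappa) (bij_eq kb) piX_eq0.
Qed.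

Lemma pkills_scale l (R : finComNzRingType) (s : {rmorphism O -> R}) (G : finLmodType O) :
  (forall a, (s a == 0) = (a \in idealX p l)) ->
  pkills p l G <-> forall a (x : G), s a = 0 -> a *: x = 0.
Proof.
by move=> hs; split=> h a x; [move=> /eqP; rewrite hs|rewrite -hs => /eqP]; exact: h.
Qed.

Lemma has_prank_rank (G : finLmodType O) r : has_prank p G r -> rk G r.
Proof.
move=> [phi bphi]; have [psi phipsi psiphi] := bphi.
pose pi (x : G) := lquot_pi (span_prod p (predT : {pred G})) x.
have [g tg gt] := tau_bij.
exists (fun x => map_mx tau (phi (pi x))); split.
- move=> a x y; have -> : pi (a *: x + y) = a *: pi x + pi y.
    by rewrite {1}/pi lquot_piD; congr (_ + _); exact/esym/lquot_piZ.
  by rewrite linearP raddfD/= map_mxZ.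
- move=> w; have : exists x, pi x = psi (map_mx g w).
    by elim/lquot_ind: (psi _) => v; exists v.
  move=> [x ex]; exists x; rewrite ex psiphi.
  by apply/rowP => i; rewrite !mxE gt.
- move=> x; have -> : map_mx tau (phi (pi x)) = 0 <-> phi (pi x) = 0.
    split=> [/rowP h|->]; last by rewrite raddf0.
    apply/rowP => i; apply: (can_inj tg); have := h i.
    by rewrite !mxE rmorph0.
  have -> : phi (pi x) = 0 <-> pi x = 0.
    by split=> [h|->]; [apply: (can_inj phipsi); rewrite h raddf0|rewrite raddf0].
  have p0 : pi 0 = 0.
    have := lquot_piZ (span_prod p (predT : {pred G})) 0 (0 : G); rewrite scale0r => e0.
    by rewrite /pi -e0; exact: (scale0r (pi 0)).
  rewrite -{1}p0; split=> [/lquot_piP|h]; first by rewrite subr0.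
  by apply/lquot_piP; rewrite subr0.
Qed.

Lemma rank_exists (G : finLmodType O) : ptorsion p G -> exists r, rk G r.
Proof.
move=> [k kG]; have [R [s [rho [t [ss s0 ut rs]]]]] := @local_system k.+1 isT.
have /(pkills_scale _ s0) kG' := pkills_le (leqnSn k) kG.
have [M [e de]] := descends_exists ss kG'.
exact: (res_rank_exists res0 ut ss rs de).
Qed.

Lemma rank_uniq (G : finLmodType O) r r' : ptorsion p G -> rk G r -> rk G r' -> r = r'.
Proof.
move=> [k kG]; have [R [s [rho [t [ss s0 ut rs]]]]] := @local_system k.+1 isT.
have /(pkills_scale _ s0) kG' := pkills_le (leqnSn k) kG.
have [M [e de]] := descends_exists ss kG'.
exact: (res_rank_uniq res0 ut ss rs de).
Qed.

Definition quot_count (G H : finLmodType O) : nat :=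
  #|[pred y : H | `[< lmod_iso (lquot (cyclic_submod y)) G >]]|.

(** If <y> has order q^j it is killed by t^j; if p^k kills G then t^k H lies in <y>. This bounds in
    advance the level at which all extensions of a given order are visible. *)
Lemma quot_card (G H : finLmodType O) (y : H) : ptorsion p G -> ptorsion p H ->
  lmod_iso (lquot (cyclic_submod y)) G -> exists j, #|H| = (q ^ j * #|G|)%N /\
   forall k, pkills p k G -> pkills p (k + j) H.
Proof.
move=> [k1 kG] [k2 kH] iso; pose l := (maxn k1 k2).+1.
have [R [s [rho [t [ss s0 ut rs]]]]] := @local_system l isT.
have /(pkills_scale _ s0) kG' : pkills p l G by apply: pkills_le kG; rewrite leqW// leq_maxl.
have /(pkills_scale _ s0) kH' : pkills p l H by apply: pkills_le kH; rewrite leqW// leq_maxr.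
have [M [e dG]] := descends_exists ss kG'; have [N [e' dH]] := descends_exists ss kH'.
have /(desc_quot_by ss y dG dH)/quot_byP[f [lf sf kf]] := iso.
have [j [_ ann cy]] := annih_cyclic_ex ut (e' y).
exists j; split; first by rewrite -(desc_card dH) (card_cyclic_ext lf sf kf) cy (desc_card dG).
move=> k kG2 a x ha.
have powt n b : b \in idealX p n -> exists c, s b = t ^+ n * c.
  elim: n b => [|n IH] b; first by exists (s b); rewrite mul1r.
  move: b; apply: idealX_ind => [b c [b' eb] [c' ec]| |b c bp /IH[c' ec]].
  - by exists (b' + c'); rewrite rmorphD eb ec mulrDr.
  - by exists 0; rewrite rmorph0 mulr0.
  - have [_ rk0 _ _ _] := ut; have /rk0[d ed] : rho (s b) = 0 by rewrite rs; apply/eqP;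
    rewrite res0.
    by exists (d * c'); rewrite rmorphM ed ec exprS; ring.
have [t0 et0] := ss t.
have t0p : t0 \in p by rewrite -res0 -rs et0 (rho_t ut).
have [g ge eg] := dH.1; apply: (can_inj ge); rewrite (desc0 dH) (descZ dH).
have [c ->] := powt _ _ ha.
have : f (t ^+ k *: e' x) = 0.
  have f0 : f 0 = 0 by apply/kf; exists 0; rewrite scale0r.
  have fZ b z : f (b *: z) = b *: f z by rewrite -[b *: z]addr0 lf f0 addr0.
  rewrite fZ; have [h eh he] := dG.1; rewrite -(he (f _)) -et0 -rmorphXn -(descZ dG).
  by rewrite kG2 ?(desc0 dG)//; exact: idealX_exp.
move=> /kf[b eb]; have -> : t ^+ (k + j) * c = (t ^+ j * c) * t ^+ k by rewrite exprD; ring.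
rewrite -scalerA eb.
have tj : t ^+ j *: e' y = 0 by apply/ann; exists 1; rewrite mulr1.
transitivity ((c * b) *: (t ^+ j *: e' y)); last by rewrite tj scaler0.
by rewrite !scalerA; congr (_ *: _); ring.
Qed.

Variables (I : choiceType) (M : I -> finLmodType O).
Hypothesis M_reps : representatives p M.

(** [C] is the set of columns c, [cls] sends c to the class of the cokernel of [ext_mx], and [z]
    singles out c = 0 modulo t. The last clause is the double count [card_ext_pairs] with |C| =
    |R|^r. *)
Lemma extension_classes (G : finLmodType O) r j : ptorsion p G -> rk G r ->
  exists (C : finType) (cls : C -> I) (z : pred C),
  [/\ (0 < #|C|)%N, (#|z| * q ^ r)%N = #|C|,
      forall c, #|M (cls c)| = (q ^ j * #|G|)%N,
      forall c, rk (M (cls c)) (r + ((0 < j)%N && z c))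
    & forall i, #|M i| = (q ^ j * #|G|)%N ->
        (quot_count G (M i) * (card_Aut G * #|C|) =
         #|[pred c | cls c == i]| * card_Aut (M i))%N].
Proof.
move=> [k kG] rG; have [M_tors M_ex] := M_reps.
pose l := (k + j).+1.
have [R [s [rho [t [ss s0 ut rs]]]]] := @local_system l isT.
have kGl : pkills p l G by apply: pkills_le kG; rewrite leqW// leq_addr.
have kGs := (pkills_scale _ s0).1 kGl.
have [MG [e dG]] := descends_exists ss kGs.
have [phi cG] := (res_rank_coords res0 ut ss rs dG r).1 rG.
have [t0 et0] := ss t.
have t0p : t0 \in p by rewrite -res0 -rs et0 (rho_t ut).
have killt m : (k <= m)%N -> forall x : MG, t ^+ m *: x = 0.
  move=> km x; have [g ge eg] := dG.1.
  rewrite -(eg x) -et0 -rmorphXn -(descZ dG) (pkills_le km kG) ?(desc0 dG)//.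
  exact: idealX_exp.
have q1 : (1 < q)%N by exact: card_finNzRing_gt1.
have fpos n m : (n <= m)%N -> (0 < full_count q m n)%N.
  move=> nm; rewrite /full_count prodn_gt0// => i.
  by rewrite subn_gt0 ltn_exp2l// (leq_trans (ltn_ord i)).
have [g0 gg0] : exists g0 : 'rV[MG]_r, [forall x, lspan g0 x].
  have := card_gens ut r (@predT_submod _ MG) cG.
  move: (fpos r r (leqnn r)) => h1 h2.
  have : (0 < full_count q r r * #|tmul t (xpredT : pred MG)| ^ r)%N.
    by rewrite muln_gt0 h1 expn_gt0 tmul_gt0.
  rewrite -h2 => /card_gt0P[h]; rewrite inE => /andP[_ /forallP hh].
  by exists h; apply/forallP => x; exact: (implyP (hh x)).
have killl : forall x : MG, t ^+ l.-1 *: x = 0 by apply: killt; rewrite /l/= leq_addr.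
have [B pB] : exists B : 'M[R]_r, pres B g0.
  have [h1 _] := card_pres_mx ut killl cG gg0.
  have : (0 < full_count q r r * #|tmul t (rels g0)| ^ r)%N.
    by rewrite muln_gt0 fpos// expn_gt0 tmul_gt0//; exact: rels_submod.
  by rewrite -h1 => /card_gt0P[B]; rewrite inE; exists B.
(* The r generators are as many as the rank of G, so the presentation is minimal. *)
have redB : map_mx rho B = 0.
  apply/eqP; rewrite -mxrank_eq0 -(eqn_add2l r) (pres_rank ut cG pB) addn0//.
have jml : (k + j < l)%N by [].
have M_desc i : pkills p l (M i) -> exists (N : finLmodType R) (e' : M i -> N), descends s e'.
  by move=> /(pkills_scale _ s0) h; have [N [e' d']] := descends_exists ss h; exists N, e'.
have ext (c : 'cV[R]_r) : exists i, pkills p l (M i) /\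
    forall i', pkills p l (M i') -> forall (N : finLmodType R) (e' : M i' -> N), descends s e' ->
    (i = i' <-> cokis N (ext_mx t B j c)).
  have [H [kH cokH]] := cokernel_module ss (ext_mx t B j c).
  have kHl : pkills p l H by apply/(pkills_scale _ s0).
  have [NH [eH dH]] := descends_exists ss kH.
  have cH := cokH _ _ dH.
  have [i [iso iuniq]] := M_ex H (ex_intro _ l kHl); exists i; split.
    exact: pkills_iso iso kHl.
  move=> i' ki' N e' d'; split=> [ii'|cN].
    subst i'; have [f [lf bf]] := desc_iso ss dH d' iso; exact: cokis_iso lf bf cH.
  apply: iuniq; have /existsP[h ph] := cH; have /existsP[h' ph'] := cN.
  have [f [lf bf _]] := pres_iso ph ph'.
  exact: lift_iso dH d' lf bf.
have [cls hcls] := choice ext.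
exists {: 'cV[R]_r}, cls, [pred c | map_mx rho c == 0].
have card_i c : #|M (cls c)| = (q ^ j * #|G|)%N.
  have [kc hc] := hcls c; have [N [e' d']] := M_desc _ kc.
  have cN := (hc _ kc N e' d').1 erefl.
  rewrite -(desc_card d') -(desc_card dG).
  exact: (card_ext ut pB jml (killt k (leqnn k)) cN).
split=> //.
- by apply/card_gt0P; exists 0.
- have := card_red_fiber ut (0 : 'cV[F]_r); rewrite muln1 => ->.
  by rewrite card_mx muln1.
- move=> c; have [kc hc] := hcls c; have [N [e' d']] := M_desc _ kc.
  have cN := (hc _ kc N e' d').1 erefl.
  have [r' [psi cpsi]] := coords_exists ut (@predT_submod _ N).
  have er : (r + ((0 < j)%N && (map_mx rho c == 0%R)))%N = r'.
    have /existsP[h /(pres_rank ut cpsi)] := cN.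
    rewrite (rank_ext_mx ut j c redB) /=.
    rewrite lt0n; case: (j == 0%N) => /=; last case: (map_mx rho c == 0) => /=;
      rewrite ?addn0 ?addn1; [by case | by move=> -> | by case].
  by rewrite /= er; apply/(res_rank_coords res0 ut ss rs d'); exists psi.
(* A class not killed by p^l is invisible over R: by [quot_card] it has no suitable y, and no column
   maps to it. *)
- move=> i ci; have [ki|nki] := pselect (pkills p l (M i)); last first.
    have -> : quot_count G (M i) = 0%N.
      apply: eq_card0 => y; rewrite inE; apply/asboolP => iso.
      have [j' [cj hj]] := quot_card (ex_intro _ k kG) (M_tors i) iso.
      case: nki; apply: (pkills_le (leqnSn _)).
      have -> : j = j'; last by exact: hj.
      move/eqP: cj; rewrite ci eqn_pmul2r; last by apply/card_gt0P; exists 0.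
      by rewrite eqn_exp2l// => /eqP.
    rewrite mul0n (_ : #|_| = 0%N)//; apply: eq_card0 => c; rewrite inE.
    by apply/eqP => ec; apply: nki; rewrite -ec; case: (hcls c).
  have [N [e' d']] := M_desc i ki.
  rewrite (desc_aut ss d') (desc_aut ss dG).
  have cN : #|N| = (q ^ j * #|MG|)%N by rewrite (desc_card d') (desc_card dG).
  have := card_ext_pairs ut pB cN.
  have -> : #|[pred c | cokis N (ext_mx t B j c)]| = #|[pred c | cls c == i]|.
    apply: eq_card => c; rewrite !inE; have [kc hc] := hcls c.
    apply/idP/eqP => [h|h]; first by apply/(hc i ki N e' d').
    by apply/(hc i ki N e' d').
  move=> ->; rewrite card_mx muln1; congr (_ * _)%N.
  have [g' ge' eg'] := d'.1.
  apply: (@card_bij_pred _ _ e' g') => y /=.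
    by move=> /asboolP/(desc_quot_by ss y dG d') h.
  move=> h; split=> //; apply/asboolP/(desc_quot_by ss _ dG d').
  by rewrite eg'.
Qed.

End Classes.

(** * q-Pochhammer symbols *)

Section QPochhammer.
Variable R : realType.

Lemma qpochS (x : R) k : qpoch x k.+1 = qpoch x k * (1 - x ^- k.+1).
Proof. by rewrite /qpoch big_nat_recr. Qed.

Lemma qpoch0 (x : R) : qpoch x 0 = 1.
Proof. by rewrite /qpoch big_nil. Qed.

Lemma invX_lt1 (x : R) k : 1 < x -> 0 < x ^- k.+1 < 1.
Proof.
move=> x1; have x0 : 0 < x by exact: lt_trans x1.
by rewrite invr_gt0 exprn_gt0//= invf_lt1 ?exprn_gt0// exprn_egt1.
Qed.

Lemma qpoch_gt0 (x : R) k : 1 < x -> 0 < qpoch x k.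
Proof.
move=> x1; elim: k => [|k IH]; first by rewrite qpoch0.
by rewrite qpochS mulr_gt0// subr_gt0; have /andP[] := invX_lt1 k x1.
Qed.

Lemma full_countE (q n k : nat) : (1 < q)%N -> (k <= n)%N ->
  (full_count q n k)%:R = q%:R ^+ (n * k) * qpoch q%:R n / qpoch q%:R (n - k) :> R.
Proof.
move=> q1; have Q1 : 1 < q%:R :> R by rewrite ltr1n.
have Q0 : q%:R != 0 :> R by rewrite gt_eqF// (lt_trans _ Q1).
elim: k => [_|k IH kn].
  by rewrite /full_count big_ord0 muln0 expr0 mul1r subn0 divff// gt_eqF// qpoch_gt0.
rewrite /full_count big_ord_recr/= natrM -/(full_count q n k) IH; last exact: ltnW.
rewrite natrB ?leq_exp2l ?(ltnW kn)// !natrX.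
have -> : (n - k)%N = (n - k.+1).+1 by rewrite -subnSK.
have p1 := qpoch_gt0 (n - k.+1).+1 Q1; have p2 := qpoch_gt0 (n - k.+1) Q1.
move: p1; rewrite qpochS => p1.
have e : q%:R ^+ n - q%:R ^+ k = q%:R ^+ n * (1 - q%:R ^- (n - k.+1).+1) :> R.
  have {1 2}-> : n = (k + (n - k.+1).+1)%N by rewrite subnSK// subnKC// ltnW.
  by rewrite mulrBr mulr1 exprD mulfK// expf_neq0.
rewrite e mulnS exprD.
have h : 1 - q%:R ^- (n - k.+1).+1 != 0 :> R.
  by apply/eqP => h; rewrite h mulr0 ltxx in p1.
move: (1 - _) h => y hy; have /negbT hz := gt_eqF p2.
by field; rewrite ?hy ?hz.
Qed.

Lemma full_count_gt0 (q n k : nat) : (1 < q)%N -> (k <= n)%N -> (0 < full_count q n k)%N.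
Proof.
move=> q1 kn; rewrite /full_count prodn_gt0// => i.
by rewrite subn_gt0 ltn_exp2l// (leq_trans (ltn_ord i)).
Qed.

(** Elimination of n from [lift_count_total]. Here [Rc] = |R|, [tm] = |tM|, [rk] counts the matrices
    of rank n - r, [c] is the lift count, and [L] is the number of all lifts of one matrix. *)
Lemma lift_constant (q n r c aut L K m tm Rc rk : nat) : (1 < q)%N -> (0 < Rc)%N ->
  (r <= n)%N -> (q ^ n * K * m = Rc ^ n)%N -> (m = q ^ r * tm)%N ->
  (rk * full_count q (n - r) (n - r) = full_count q n (n - r) ^ 2)%N ->
  (rk * c * aut = full_count q n r * tm ^ n * (full_count q n n * K ^ n))%N ->
  (L * q ^ (n * n) = Rc ^ (n * n))%N ->
  (c * aut)%:R = L%:R * (q%:R ^+ (r * r) * qpoch q%:R r ^+ 2) :> R.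
Proof.
move=> q1 Rc0 /subnKC <-; set d := (n - r)%N.
rewrite [(r + d - r)%N](_ : _ = d); last by rewrite addKn.
move: d => d {n} eK em erk ec eL.
have Q1 : 1 < q%:R :> R by rewrite ltr1n.
have Q0 : q%:R != 0 :> R by rewrite gt_eqF// (lt_trans _ Q1).
have p0 k : qpoch q%:R k != 0 :> R by rewrite gt_eqF// qpoch_gt0.
(* The quantities depending on the module enter both counts as the same power of [tm] times [K], so
   they cancel against [L]. *)
have L1 : L%:R = (tm%:R * K%:R) ^+ (r + d) * q%:R ^+ ((r + d) * r) :> R.
  have : L%:R * q%:R ^+ ((r + d) * (r + d)) =
     (tm%:R * K%:R) ^+ (r + d) * q%:R ^+ ((r + d) * r) * q%:R ^+ ((r + d) * (r + d)) :> R.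
    rewrite -!natrX -natrM eL expnM -eK em !expnMn -!expnM !natrM !natrX exprMn.
    by rewrite [(r * _)%N]mulnC; ring.
  by move/mulIf; apply; rewrite expf_neq0.
have rk1 : rk%:R = (q%:R ^+ ((r + d) * d) * qpoch q%:R (r + d) / qpoch q%:R r) ^+ 2 /
    (q%:R ^+ (d * d) * qpoch q%:R d) :> R.
  have := congr1 (fun x : nat => x%:R : R) erk.
  rewrite natrM natrX !full_countE ?leq_addl// subnn addnK qpoch0 divr1 => <-.
  by rewrite mulfK// mulf_neq0// expf_neq0.
have rk0 : rk%:R != 0 :> R.
  by rewrite rk1 !mulf_neq0 ?invr_eq0 ?expf_neq0 ?mulf_neq0 ?invr_eq0 ?expf_neq0.
apply: (mulfI rk0); rewrite -natrM mulnA ec L1 !natrM !full_countE ?leq_addr//.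
rewrite subnn addKn qpoch0 divr1 !natrX rk1 !exprMn.
rewrite !mulnDl !mulnDr !exprD [(d * r)%N]mulnC.
have h1 := expf_neq0 (r * r) Q0; have h2 := expf_neq0 (r * d) Q0; have h3 := expf_neq0 (d * d) Q0.
have := p0 r; have := p0 d; have := p0 (r + d)%N.
move: (qpoch _ r) (qpoch _ d) (qpoch _ (r + d)) => x y z hz hy hx.
move: (q%:R ^+ (r * r)) (q%:R ^+ (r * d)) (q%:R ^+ (d * d)) h1 h2 h3 => a1 a2 a3 h1 h2 h3.
move: (tm%:R ^+ r) (tm%:R ^+ d) (K%:R ^+ r) (K%:R ^+ d) => b1 b2 b3 b4.
by field; rewrite ?hx ?hy ?hz ?h1 ?h2 ?h3.
Qed.

End QPochhammer.

Local Open Scope classical_set_scope.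
Local Open Scope ring_scope.

(** * Kernels of symplectic matrices *)

Lemma set_card_bij (T : choiceType) (T' : finType) (g : T -> T') (A : set T) (P : pred T') :
  bijective g -> (forall x, A x <-> P (g x)) -> set_card A = #|P|.
Proof.
move=> [k gk kg] AP.
have fA : finite_set A.
  apply: (@sub_finite_set _ _ [set` [seq k y | y <- enum T']]); last exact: finite_seq.
  by move=> x _ /=; apply/mapP; exists (g x); rewrite ?mem_enum ?gk.
rewrite /set_card cardE -(size_map g); apply: perm_size; apply: uniq_perm.
- by rewrite map_inj_uniq ?fset_uniq//; exact: can_inj gk.
- exact: enum_uniq.
- move=> y; rewrite mem_enum; apply/mapP/idP => [[x] | Py].
    by rewrite in_fset_set// inE => /AP Px ->.
  by exists (k y); rewrite ?kg// in_fset_set// inE; apply/AP; rewrite kg.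
Qed.

Section KernelFrequency.
Variable K : fieldExtType rat.
Local Notation O := (ringint K).
Variable p : prime_idealr O.
Hypothesis p_neq0 : exists2 a, a \in p & a != 0.
Variables (F : finFieldType) (tau : {rmorphism {ideal_quot p} -> F}).
Hypothesis tau_bij : bijective tau.
Variables (R : realType).

Local Notation q := #|F|.
Local Notation res := (resmap tau).
Local Notation rk := (res_rank p res).

Variables (f : nat) (S : finComNzRingType) (kappa : {rmorphism quotX p f -> S}).
Variables (rho : {rmorphism S -> F}) (t : S).
Hypothesis f_gt0 : (0 < f)%N.
Hypothesis kappa_bij : bijective kappa.
Hypothesis ut : uniformizer rho t f.
Hypothesis rho_kappa : forall a, rho (kappa (piX p f a)) = res a.

Local Notation red := (map_mx rho).
Local Notation kap := (map_mx kappa).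

Lemma kap_bij m n : bijective (fun X : 'M[quotX p f]_(m, n) => kap X).
Proof.
have [k ek ke] := kappa_bij.
exists (map_mx k) => X; apply/matrixP => i j; rewrite !mxE ?ek ?ke//.
Qed.

Lemma kap_inj m n : injective (fun X : 'M[quotX p f]_(m, n) => kap X).
Proof. exact: bij_inj (kap_bij m n). Qed.

Lemma in_p_piX (y : quotX p f) :
  rho (kappa y) = 0 <-> exists2 a, a \in idealX p 1 & y = piX p f a.
Proof.
split=> [|[a ha ->]]; last first.
  by rewrite rho_kappa; apply/eqP; rewrite (resmap_eq0 tau_bij); exact: idealX_sub ha.
have [b <-] := piX_surj y; rewrite rho_kappa => /eqP; rewrite (resmap_eq0 tau_bij) => bp.
by exists b => //; rewrite -[b]mulr1; exact: (@idealX_mul _ p 0).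
Qed.

Lemma unit_of_red n (X : 'M[S]_n) : red X \in unitmx ->
  exists Y, X *m Y = 1%:M /\ Y *m X = 1%:M.
Proof.
move=> uX.
have [d hd] : exists d, \det X * d = 1.
  by apply: (chain_unit ut); rewrite -det_map_mx -unitfE -unitmxE.
exists (d *: \adj X); split.
  by rewrite -scalemxAr mul_mx_adj scale_scalar_mx mulrC hd.
by rewrite -scalemxAl mul_adj_mx scale_scalar_mx mulrC hd.
Qed.

(** The congruence modulo p concerns the reduction alone, and a matrix with invertible reduction is
    invertible. The transpose passes to the row convention of [isom]. *)
Lemma Spm_isom n (g : 'M[quotX p f]_(n + n)) :
  @Spm O p 1 f n g <-> isom (stdJ F n) (red (kap g))^T.
Proof.
have kJ : kap (symplJ (quotX p f) n) = symplJ S n.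
  by rewrite /symplJ map_block_mx !raddf0 raddfN/= map_mx1.
have rJ : red (symplJ S n) = stdJ F n.
  by rewrite /symplJ map_block_mx !raddf0 raddfN/= map_mx1.
have E : red (kap (g^T *m symplJ _ n *m g - symplJ _ n)) =
    (red (kap g))^T *m stdJ F n *m (red (kap g)) - stdJ F n.
  by rewrite !raddfB/= kJ rJ !map_mxM !map_trmx kJ rJ.
have key : (forall i j, exists2 a, a \in idealX p 1 &
      (g^T *m symplJ _ n *m g - symplJ _ n) i j = piX p f a) <->
    isom (stdJ F n) (red (kap g))^T.
  rewrite /isom trmxK -subr_eq0 -E; split=> [h|/eqP/matrixP h i j].
    apply/eqP/matrixP => i j; rewrite !mxE.
    have [a ha ea] := h i j; rewrite !mxE in ea; rewrite ea.
    by apply/in_p_piX; exists a.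
  by apply/in_p_piX; have := h i j; rewrite !mxE.
split=> [[_ /key]//|h]; split; last by apply/key.
have := isom_unit (stdJ_unit F n) h; rewrite unitmx_tr => /unit_of_red[Y [h1 h2]].
have [k hk kh] := kap_bij (n + n) (n + n); exists (k Y).
by split; apply: kap_inj; rewrite map_mxM kh map_mx1.
Qed.

Variables (G : finLmodType O) (M : finLmodType S) (e : G -> M).
Hypothesis dG : descends (kappa \o piX p f) e.

Lemma ker_iso_cokis n (g : 'M[quotX p f]_(n + n)) :
  ker_iso G g <-> cokis M (kap g - 1%:M)^T.
Proof.
have [c ec ce] := dG.1; rewrite (cokis_ker ut).
have surj y : exists a, (kappa \o piX p f) a = y.
  by have [k kk kk'] := kappa_bij; have [a ea] := piX_surj (k y); exists a; rewrite /= ea kk'.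
have K1 (v : 'cV[quotX p f]_(n + n)) :
    (g - 1%:M) *m v = 0 <-> (kap v)^T *m (kap g - 1%:M)^T = 0.
  have -> : (kap v)^T *m (kap g - 1%:M)^T = (kap ((g - 1%:M) *m v))^T.
    by rewrite map_mxM trmx_mul; congr (_ *m _^T); rewrite raddfB/= map_mx1.
  split=> [->|h]; first by rewrite !raddf0.
  by apply: kap_inj; apply: trmx_inj; rewrite h !raddf0.
split=> [[phi [hf hi hs]]|[h [lh ih kh]]].
  exists (fun m => (kap (phi (c m)))^T); split.
  - move=> a x y; have [b <-] := surj a.
    rewrite -{1}(ce x) -{1}(ce y) -dG.2 ec linearP.
    by apply/rowP => i; rewrite !mxE rmorphD rmorphM.
  - move=> x y /trmx_inj /kap_inj /(hi _ _ (in_setT _) (in_setT _)).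
    by move/(congr1 e); rewrite !ce.
  - move=> v; have [k hk kh] := kap_bij (n + n) 1.
    have {1}-> : v = (kap (k v^T))^T by rewrite kh trmxK.
    rewrite -K1; split=> [/hs[x _ ex]|[x ev]].
      by exists (e x); rewrite ec ex kh trmxK.
    by have := hf (c x) I => /=; rewrite ev trmxK hk.
have [k hk kk] := kap_bij (n + n) 1.
pose phi0 (x : G) : 'cV[quotX p f]_(n + n) := k (h (e x))^T.
have phiE x : kap (phi0 x) = (h (e x))^T by exact: kk.
have lphi : forall a x y, phi0 (a *: x + y) = piX p f a *: phi0 x + phi0 y.
  move=> a x y; apply: kap_inj; rewrite raddfD/= map_mxZ !phiE dG.2 lh.
  by rewrite raddfD/= linearZ.
pose phi := HB.pack_for {linear G -> 'cV[quotX p f]_(n + n) | (@piX O p f) \; *:%R} phi0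
  (GRing.isLinear.Build _ _ _ ((@piX O p f) \; *:%R) phi0 lphi).
exists phi; split.
- by move=> x _ /=; apply/K1; rewrite [kap _]phiE trmxK; apply/kh; exists (e x).
- move=> x y _ _ /(congr1 (fun v => kap v)); rewrite /= !phiE => /trmx_inj/ih.
  by move/(congr1 c); rewrite !ec.
- move=> v /= /K1/kh[m em]; exists (c m) => //; apply: kap_inj.
  by rewrite /= phiE ce -em trmxK.
Qed.

(** Each isometry a over F has the same number [L] of lifts. The proportion of them with kernel G is
    0 unless a - 1 has corank r, and then it is the constant of [lift_constant] divided by |Aut
    G|. *)
Lemma ker_freq_formula r n : pkills p f.-1 G -> rk G r ->
  ker_freq p R 1 f G n =
  #|[pred a : 'M[F]_(n + n) | isom (stdJ F n) a && (r + \rank (a - 1%:M)%R == n + n)%N]|%:R /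
    #|isom (stdJ F n)|%:R *
  ((q%:R ^+ (r * r) * qpoch q%:R r ^+ 2) / (card_Aut G)%:R).
Proof.
move=> kG rG; set N := (n + n)%N.
have surj y : exists a, (kappa \o piX p f) a = y.
  by have [k kk kk'] := kappa_bij; have [a ea] := piX_surj (k y); exists a; rewrite /= ea kk'.
have rs a : rho ((kappa \o piX p f) a) = res a by exact: rho_kappa.
have [phi cM] := (res_rank_coords (resmap_eq0 tau_bij) ut surj rs dG r).1 rG.
have [t0 et0] := surj t.
have t0p : t0 \in p by rewrite -(resmap_eq0 tau_bij) -rs et0 (rho_t ut).
have kM (x : M) : t ^+ f.-1 *: x = 0.
  have [g ge eg] := dG.1.
  rewrite -(eg x) -et0 -rmorphXn -(descZ dG) kG ?(desc0 dG)//.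
  exact: idealX_exp.
pose L := #|[pred X : 'M[S]_N | red X == 0]|.
have cardL (Y : 'M[F]_N) : #|[pred X : 'M[S]_N | red X == Y]| = L.
  apply/eqP; rewrite -(eqn_pmul2r (m := (q ^ (N * N))%N)); last first.
    by rewrite expn_gt0 (ltnW (card_finNzRing_gt1 _)).
  by rewrite /L !(card_red_fiber ut).
have L0 : (0 < L)%N.
  by apply/card_gt0P; exists 0; rewrite inE raddf0.
have den : set_card (@Spm O p 1 f n) = (#|isom (stdJ F n)| * L)%N.
  rewrite (@set_card_bij _ _ (fun X : 'M[quotX p f]_N => kap X) _
    [pred X | xpredT X && isom (stdJ F n) (red X)^T] (kap_bij _ _)); last exact: Spm_isom.
  apply: (@card_fibers _ _ xpredT (fun X : 'M[S]_N => (red X)^T)) => a _.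
  rewrite -(cardL a^T); apply: eq_card => X; rewrite !inE/=.
  by rewrite -(inj_eq (@trmx_inj _ _ _)) trmxK.
pose c (Y : 'M[F]_N) := lift_count rho M Y.
have num : set_card (@Spm O p 1 f n `&` [set g | ker_iso G g]) =
    (\sum_(a | isom (stdJ F n) a) c (a - 1%:M)%R)%N.
  rewrite (@set_card_bij _ _ (fun X : 'M[quotX p f]_N => kap X) _
    [pred X : 'M[S]_N | isom (stdJ F n) (red X)^T && cokis M (X - 1%:M)^T] (kap_bij _ _));
      last first.
    move=> X /=; split=> [[/Spm_isom h1 /ker_iso_cokis h2]|/andP[h1 h2]]; first by rewrite h1.
    by split; [apply/Spm_isom | apply/ker_iso_cokis].
  rewrite -[LHS]sum1_card (partition_big (fun X : 'M[S]_N => (red X)^T) (isom (stdJ F n)));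
    last first.
    by move=> X /andP[].
  apply: eq_bigr => a sa; rewrite sum1_card /c /lift_count.
  apply: (@card_bij_pred _ _ (fun X : 'M[S]_N => (X - 1%:M)^T) (fun X => X^T + 1%:M)) => X.
    move=> /andP[/andP[h1 h2] /eqP h3]; split; last by rewrite trmxK subrK.
    by rewrite /= h2 andbT -map_trmx raddfB/= map_mx1 raddfB/= h3 trmx1.
  move=> /andP[/eqP h1 h2]; rewrite addrK trmxK; split=> //.
  have e1 : (red (X^T + 1%:M))^T = a.
    by rewrite raddfD/= map_mx1 raddfD/= trmx1 -map_trmx trmxK h1 subrK.
  by rewrite /= e1 eqxx andbT inE e1 addrK trmxK h2 andbT.
have autE : card_Aut G = aut_count M by exact: desc_aut surj _ _ _ dG.
have aut0 : (0 < card_Aut G)%N.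
  rewrite autE; apply/card_gt0P; exists 1%g; apply/is_linP => b x y.
  by rewrite !perm1.
have cval (Y : 'M[F]_N) : (r + \rank Y)%N = N ->
    (c Y)%:R = L%:R * ((q%:R ^+ (r * r) * qpoch q%:R r ^+ 2) / (card_Aut G)%:R) :> R.
  move=> eY; have [K' [eK eC]] := lift_count_total ut kM cM eY.
  have rN : (r <= N)%N by rewrite -eY leq_addr.
  rewrite mulrA; apply: (mulIf (_ : (card_Aut G)%:R != 0)); first by rewrite pnatr_eq0 -lt0n.
  rewrite divfK ?pnatr_eq0 -?lt0n// -natrM autE.
  apply: (lift_constant R (card_finNzRing_gt1 F) _ rN eK _ _ eC).
  - by apply/card_gt0P; exists 0.
  - exact: (coords_card (@predT_submod _ M) cM).
  - exact: card_rank.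
  - exact: (card_red_fiber ut).
rewrite /ker_freq den num natrM natr_sum.
rewrite (bigID (fun a : 'M[F]_N => (r + \rank (a - 1%:M)%R == N)%N))/= addrC big1 ?add0r;
  last first.
  by move=> a /andP[_ /eqP ne]; rewrite /c (lift_count_eq0 ut cM ne).
rewrite (eq_bigr (fun=> L%:R * ((q%:R ^+ (r * r) * qpoch q%:R r ^+ 2) / (card_Aut G)%:R)));
  last first.
  by move=> a /andP[_ /eqP /cval].
rewrite sumr_const -mulr_natl.
have i0 : #|isom (stdJ F n)|%:R != 0 :> R.
  rewrite pnatr_eq0 -lt0n; apply/card_gt0P; exists 1%:M.
  by rewrite -topredE/= /isom trmx1 mulmx1 mul1mx.
have a0 : (card_Aut G)%:R != 0 :> R by rewrite pnatr_eq0 -lt0n.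
have l0 : L%:R != 0 :> R by rewrite pnatr_eq0 -lt0n.
rewrite (_ : #|_| = #|[pred a : 'M[F]_N | isom (stdJ F n) a && (r + \rank (a - 1%:M)%R == N)%N]|)//.
by field; rewrite ?i0 ?a0 ?l0.
Qed.

End KernelFrequency.

(** * The limit law *)

Section Euler.
Variable R : realType.
Implicit Types x y Q : R.

Lemma invX_le2 x k : 2 <= x -> x ^- k <= 2^-1 ^+ k.
Proof.
move=> x2; have x0 : 0 < x by lra.
rewrite -exprVn lerXn2r ?nnegrE ?invr_ge0 ?(ltW x0)//.
by rewrite lef_pV2 ?posrE.
Qed.

Lemma qpoch_ge x k : 2 <= x -> 4^-1 <= qpoch x k.
Proof.
move=> x2; case: k => [|k]; first by rewrite qpoch0; lra.
(* The bare bound 1/4 is not inductive; the slack 2^-(k+2) pays for the next factor. *)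
suff : 4^-1 + 2^-1 ^+ k.+2 <= qpoch x k.+1.
  have : 0 <= 2^-1 ^+ k.+2 :> R by apply: exprn_ge0; lra.
  lra.
elim: k => [|k IH].
  rewrite qpochS qpoch0 mul1r; have := invX_le2 1 x2.
  rewrite !exprS expr0; lra.
rewrite qpochS; have h := invX_le2 k.+2 x2.
have e : 2^-1 ^+ k.+3 = 2^-1 * 2^-1 ^+ k.+2 :> R by rewrite exprS.
have h0 : 0 < 2^-1 ^+ k.+2 :> R by apply: exprn_gt0; lra.
have h1 : 2^-1 ^+ k.+2 <= 4^-1 :> R.
  rewrite !exprS; have : 2^-1 ^+ k <= 1 :> R by apply: exprn_ile1; lra.
  lra.
rewrite e; move: h h0 h1 IH; set a := 2^-1 ^+ k.+2; set b := x ^- k.+2; move: (qpoch x k.+1) => c.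
move=> h h0 h1 IH.
have : (4^-1 + a) * (1 - a) <= c * (1 - b) by apply: ler_pM; lra.
nra.
Qed.

Lemma geo_le y n : 0 <= y <= 2^-1 -> \sum_(i < n) y ^+ i <= 2.
Proof.
move=> /andP[y0 y1]; have := subrX1 y n.
have : 0 <= y ^+ n by exact: exprn_ge0.
have : 0 <= \sum_(i < n) y ^+ i by apply: sumr_ge0 => i _; exact: exprn_ge0.
move: (y ^+ n) (\sum_(_ < n) _) => a b; nra.
Qed.

(** Partial sums of Euler's series for the inverse of the product of 1 - x Q^-i over i >= 0. At x =
    -1/Q that product is (Q^2)_oo / (Q)_oo. *)
Definition eulerF Q J x := \sum_(j < J) x ^+ j / qpoch Q j.

(** Euler's functional equation E(x/Q) = (1 - x) E(x), with the error made by truncation. *)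
Lemma eulerF_step Q J x : 1 < Q ->
  eulerF Q J.+1 (x / Q) = (1 - x) * eulerF Q J.+1 x + x ^+ J.+1 / qpoch Q J.
Proof.
move=> Q1; have p0 k : qpoch Q k != 0 by rewrite gt_eqF// qpoch_gt0.
suff : eulerF Q J.+1 x - eulerF Q J.+1 (x / Q) = x * eulerF Q J x.
  have e2 : x * eulerF Q J.+1 x = x * eulerF Q J x + x ^+ J.+1 / qpoch Q J.
    by rewrite {1}/eulerF big_ord_recr/= mulrDr exprS mulrA.
  by move=> h; rewrite mulrBl mul1r e2 -h; ring.
rewrite /eulerF -sumrB big_ord_recl/= !expr0 subrr add0r mulr_sumr.
apply: eq_bigr => j _; rewrite /bump/= add1n qpochS exprMn exprVn.
have /andP[h1 h2] := invX_lt1 j Q1.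
have h3 : 1 - Q ^- j.+1 != 0 by rewrite subr_eq0 eq_sym lt_eqF.
rewrite ![x ^+ j.+1]exprS; move: (Q ^- j.+1) h3 (qpoch Q j) (p0 j) (x ^+ j) => y h3 P hP a.
by field; rewrite ?hP ?h3.
Qed.

Lemma qpoch_sqr Q m : 1 < Q ->
  qpoch (Q ^+ 2) m = qpoch Q m * \prod_(1 <= i < m.+1) (1 + Q ^- i).
Proof.
move=> Q1; rewrite /qpoch -big_split/=; apply: eq_bigr => i _.
by rewrite -exprM mulnC exprM -!exprVn; ring.
Qed.

Lemma prod_ge1 Q m : 0 < Q -> 1 <= \prod_(1 <= i < m.+1) (1 + Q ^- i).
Proof.
move=> Q0; elim/big_ind: _ => [//|a b a1 b1|i _]; first by rewrite -[1]mulr1 ler_pM.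
by rewrite lerDl invr_ge0 exprn_ge0// ltW.
Qed.

(* Iterating eulerF_step from -1/Q to -1/Q^(J+1), where eulerF is close to 1. *)
Lemma eulerF_bound Q J : 2 <= Q ->
  `|eulerF Q J.+1 (- Q^-1) - qpoch Q J / qpoch (Q ^+ 2) J| <= 16 * Q ^- J.
Proof.
move=> Q2; have Q1 : 1 < Q by lra.
have Q0 : 0 < Q by lra.
pose P m : R := \prod_(1 <= i < m.+1) (1 + Q ^- i).
have P1 m : 1 <= P m by exact: prod_ge1.
(* For the full series [v] would be constant in m; here its increments come only from truncation and
   are summed geometrically. *)
pose v m := eulerF Q J.+1 (- Q ^- m.+1) / P m.
have p4 k : 0 <= (qpoch Q k)^-1 <= 4.
  rewrite invr_ge0 (ltW (qpoch_gt0 _ Q1))/= -[4]invrK lef_pV2 ?posrE ?qpoch_gt0// ?qpoch_ge//.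
have y0 : 0 <= Q ^- J.+1 <= 2^-1.
  rewrite invr_ge0 exprn_ge0 ?(ltW Q0)//=; apply: (le_trans (invX_le2 _ Q2)).
  rewrite exprS; have : 2^-1 ^+ J <= 1 :> R by apply: exprn_ile1; lra.
  lra.
have step m : `|v m.+1 - v m| <= 4 * Q ^- J.+1 * (Q ^- J.+1) ^+ m.
  have -> : v m.+1 - v m = (- Q ^- m.+1) ^+ J.+1 / qpoch Q J / P m.+1.
    rewrite /v; have -> : - Q ^- m.+2 = (- Q ^- m.+1) / Q.
      by rewrite exprS invfM mulrC mulNr.
    rewrite eulerF_step// opprK.
    have -> : P m.+1 = P m * (1 + Q ^- m.+1) by rewrite /P big_nat_recr.
    have h1 : P m != 0 by rewrite gt_eqF// (lt_le_trans _ (P1 m)).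
    have h2 : 1 + Q ^- m.+1 != 0 by rewrite gt_eqF// addr_gt0// invr_gt0 exprn_gt0.
    move: (P m) (1 + _) h1 h2 => a b a0 b0; move: (eulerF _ _ _) (_ ^+ _ / _) => c d.
    by field; rewrite ?a0 ?b0.
  have /andP[h1 h2] := p4 J.
  have h3 : 0 <= (P m.+1)^-1 <= 1.
    by rewrite invr_ge0 (le_trans ler01 (P1 _))/= invf_le1// (lt_le_trans ltr01 (P1 _)).
  have /andP[h3a _] := h3.
  rewrite !normrM normrX normrN [ `|Q ^- _| ]ger0_norm ?invr_ge0 ?exprn_ge0 ?(ltW Q0)//.
  rewrite [ `|(qpoch _ _)^-1| ]ger0_norm// [ `|(P _)^-1| ]ger0_norm//.
  have -> : Q ^- m.+1 ^+ J.+1 = Q ^- J.+1 * (Q ^- J.+1) ^+ m.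
    by rewrite -exprS -!exprVn -!exprM mulnC.
  have h4 : 0 <= Q ^- J.+1 * (Q ^- J.+1) ^+ m.
    by rewrite mulr_ge0 ?exprn_ge0//; case/andP: y0.
  case/andP: h3 => h5 h6; rewrite -[4 * _ * _]mulrA -mulrA.
  move: (Q ^- J.+1 * _) h4 => a a0.
  move: ((qpoch Q J)^-1) ((P m.+1)^-1) h1 h2 h5 h6 => b c b0 b4 c0 c1.
  have : b * c <= 4 * 1 by apply: ler_pM.
  move=> bc; have : 0 <= a * (4 - b * c) by apply: mulr_ge0; lra.
  nra.
have vJ : `|v J - v 0| <= 8 * Q ^- J.+1.
  have -> : v J - v 0 = \sum_(i < J) (v i.+1 - v i).
    rewrite -(big_mkord xpredT (fun i => v i.+1 - v i)) telescope_sumr//.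
  apply: (le_trans (ler_norm_sum _ _ _)).
  apply: (le_trans (_ : _ <= \sum_(i < J) 4 * Q ^- J.+1 * (Q ^- J.+1) ^+ i)).
    by apply: ler_sum => i _; exact: step.
  rewrite -mulr_sumr.
  have g := geo_le J y0; have /andP[y1 _] := y0.
  by rewrite [8](_ : _ = 4 * 2) -?mulrA ?ler_wpM2l//; [rewrite mulrC ler_wpM2r|ring].
have end1 : `|eulerF Q J.+1 (- Q ^- J.+1) - 1| <= 8 * Q ^- J.+1.
  rewrite /eulerF big_ord_recl/= expr0 qpoch0 divr1 addrAC subrr add0r.
  apply: (le_trans (ler_norm_sum _ _ _)).
  apply: (le_trans (_ : _ <= \sum_(i < J) 4 * Q ^- J.+1 * (Q ^- J.+1) ^+ i)).
    apply: ler_sum => i _; have /andP[h1 h2] := p4 (bump 0 i).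
    rewrite normrM normrX normrN /bump/= add1n in h1 h2 *.
    have /andP[y0a _] := y0; rewrite [ `|Q ^- _| ]ger0_norm//.
    rewrite [ `|(qpoch _ _)^-1| ]ger0_norm// mulrC exprS -mulrA; apply: ler_wpM2r => //.
    by rewrite mulr_ge0 ?exprn_ge0//; case/andP: y0.
  rewrite -mulr_sumr; have g := geo_le J y0; have /andP[y1 _] := y0.
  by rewrite [8](_ : _ = 4 * 2) -?mulrA ?ler_wpM2l//; [rewrite mulrC ler_wpM2r|ring].
have v0 : v 0%N = eulerF Q J.+1 (- Q^-1) by rewrite /v /P big_geq// divr1 expr1.
have PE : qpoch Q J / qpoch (Q ^+ 2) J = (P J)^-1.
  rewrite qpoch_sqr// invfM mulrA divff ?mul1r// gt_eqF// qpoch_gt0//.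
rewrite -v0 PE -normrN opprB.
have -> : (P J)^-1 - v 0%N = (v J - v 0%N) - (eulerF Q J.+1 (- Q ^- J.+1) - 1) / P J.
  by rewrite /v; ring.
(* 16 = 8 + 8, for the drift of [v] and for the end value; each 8 is 4, bounding 1/(Q)_j, times 2,
   bounding a geometric sum. *)
apply: (le_trans (ler_normB _ _)).
have h3 : 0 <= (P J)^-1 <= 1.
  by rewrite invr_ge0 (le_trans ler01 (P1 _))/= invf_le1// (lt_le_trans ltr01 (P1 _)).
have : `|(eulerF Q J.+1 (- Q ^- J.+1) - 1) / P J| <= 8 * Q ^- J.+1.
  case/andP: h3 => h5 h6; rewrite normrM [ `|(P J)^-1| ]ger0_norm//.
  by rewrite -[8 * _]mulr1; apply: ler_pM.
have : Q ^- J.+1 <= Q ^- J.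
  by rewrite lef_pV2 ?posrE ?exprn_gt0// exprS ler_peMl ?exprn_ge0 ?(ltW Q0) ?(ltW Q1).
lra.
Qed.

End Euler.

(** Balance of the powers of q in [coef_moment]; the case j = 0 also yields the exponent of the
    limit law. *)
Lemma bin2_shift r j : ('C(r + j, 2) + j + 'C(r.+1, 2) = r * r + r * j + 'C(j.+1, 2))%N.
Proof.
have b n : 'C(n.+1, 2) = ('C(n, 2) + n)%N by rewrite binS bin1.
elim: j => [|j IH].
  rewrite muln0 [ 'C(1, 2)]bin_small// !addn0.
  by elim: r => [|r IH]; [rewrite !bin_small | rewrite mulSn mulnS !b; move: IH; rewrite !b; lia].
by rewrite !addnS mulnS !b; move: IH; rewrite !b; lia.
Qed.

(** * Inversion of the q-factorial moments *)

Section MomentInversion.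
Variable R : realType.
Variable q : nat.
Hypothesis q_gt1 : (1 < q)%N.
Local Notation Q := (q%:R : R).

Let Q2 : 2 <= Q. Proof. by rewrite ler_nat. Qed.
Let Q1 : 1 < Q. Proof. by have := Q2; lra. Qed.
Let Q0 : 0 < Q. Proof. by have := Q2; lra. Qed.
Let Qn0 k : Q ^+ k != 0. Proof. by rewrite expf_neq0// gt_eqF. Qed.

Lemma full_count_prod d k : (full_count q d k)%:R = \prod_(i < k) (Q ^+ d - Q ^+ i).
Proof.
have [kd|dk] := leqP k d.
  rewrite /full_count natr_prod; apply: eq_bigr => i _.
  by rewrite natrB ?natrX// leq_exp2l// ltnW// (leq_trans (ltn_ord i)).
rewrite /full_count (bigD1 (Ordinal dk))//= subnn mul0n.
by rewrite (bigD1 (Ordinal dk))//= subrr mul0r.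
Qed.

Definition qfact j : R := \prod_(i < j) (Q ^+ i.+1 - 1).

Lemma qfact_gt0 j : 0 < qfact j.
Proof. by apply: prodr_gt0 => i _; rewrite subr_gt0 exprn_egt1. Qed.

Lemma qfactE j : qfact j = Q ^+ 'C(j.+1, 2) * qpoch Q j.
Proof.
elim: j => [|j IH]; first by rewrite /qfact big_ord0 qpoch0 mulr1.
rewrite /qfact big_ord_recr/= -/(qfact j) IH [in RHS]binS bin1 exprD qpochS.
have := Qn0 j.+1; move: (Q ^+ j.+1) => a a0.
by field.
Qed.

Definition coef r j : R := (-1) ^+ j / ((full_count q r r)%:R * Q ^+ (r * j) * qfact j).

Lemma partial_inversion (e J : nat) :
  \sum_(j < J.+1) (\prod_(i < j) (Q ^+ i - Q ^+ e)) / qfact j =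
  (\prod_(i < J) (Q ^+ i.+1 - Q ^+ e)) / qfact J.
Proof.
elim: J => [|J IH]; first by rewrite big_ord_recl big_ord0 !big_ord0 addr0.
rewrite big_ord_recr/= IH big_ord_recl/= expr0.
rewrite [in RHS]big_ord_recr/= {2 3}/qfact big_ord_recr/= -/(qfact J).
have h1 : qfact J != 0 by rewrite gt_eqF// qfact_gt0.
have h2 : Q ^+ J.+1 - 1 != 0 by rewrite gt_eqF// subr_gt0 exprn_egt1.
rewrite (eq_bigr (fun i : 'I_J => Q ^+ i.+1 - Q ^+ e)) => [|i _]; last by rewrite /bump.
move: (\prod_(i < J) (Q ^+ i.+1 - Q ^+ e)) (Q ^+ J.+1) h2 (qfact J) h1 (Q ^+ e) => a b b0 c c0 d.
by field; rewrite ?b0 ?c0.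
Qed.

(** With e = d - r, the moment of order r + j factors through that of order r, and the remaining
    alternating sum collapses by [partial_inversion] to a product over i <= J of q^i - q^e. It
    vanishes for 1 <= e <= J. *)
Lemma moment_inversion d r J : (d < r + J.+1)%N ->
  \sum_(j < J.+1) coef r j * (full_count q d (r + j))%:R = (d == r)%:R.
Proof.
move=> dJ; have [rd|dr] := leqP r d; last first.
  rewrite (ltn_eqF dr) big1// => j _.
  rewrite full_count_prod (bigD1 (Ordinal (leq_trans dr (leq_addr j r))))//=.
  by rewrite subrr mul0r mulr0.
pose e := (d - r)%N; have ed : d = (r + e)%N by rewrite subnKC.
pose A : R := (full_count q r r)%:R.
have A0 : A != 0 by rewrite pnatr_eq0 -lt0n full_count_gt0.
transitivity ((full_count q d r)%:R / A *
   \sum_(j < J.+1) (\prod_(i < j) (Q ^+ i - Q ^+ e)) / qfact j).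
  rewrite mulr_sumr; apply: eq_bigr => j _.
  rewrite !full_count_prod big_split_ord/=.
  have -> : \prod_(i < j) (Q ^+ d - Q ^+ (r + i)) =
      (-1) ^+ j * Q ^+ (r * j) * \prod_(i < j) (Q ^+ i - Q ^+ e).
    rewrite exprM -exprMn -[in X in X * _](card_ord j) -prodr_const -big_split/=.
    by apply: eq_bigr => i _; rewrite ed !exprD; ring.
  rewrite /coef -/A; have := gt_eqF (qfact_gt0 j) => /negbT q0.
  have := Qn0 (r * j); have : (-1) ^+ j * (-1) ^+ j = 1 :> R by rewrite -exprMn mulrNN mulr1 expr1n.
  move: (Q ^+ (r * j)) ((-1) ^+ j) (qfact j) q0 => a s c c0 ss a0.
  move: (\prod_(i < r) (Q ^+ d - Q ^+ i)) (\prod_(i < j) (Q ^+ i - Q ^+ e)) => x y.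
  transitivity ((s * s) * (x / A * (y / c))); first by field; rewrite ?a0 ?c0 ?A0.
  by rewrite ss mul1r.
rewrite partial_inversion; have [e0|e0] := posnP e.
  have dr : d = r by rewrite ed e0 addn0.
  rewrite dr eqxx divff// mul1r e0 /qfact divff// gt_eqF//.
  by apply: prodr_gt0 => i _; rewrite subr_gt0 exprn_egt1.
have -> : (d == r) = false by rewrite gtn_eqF// ed -[X in (X < _)%N]addn0 ltn_add2l.
have eJ : (e.-1 < J)%N.
  by rewrite prednK// -(leq_add2l r) -ed -ltnS -addnS.
by rewrite (bigD1 (Ordinal eJ))//= prednK// subrr !mul0r mulr0.
Qed.

Definition moment_const r : R := (Q ^+ 'C(r.+1, 2) * qpoch Q r)^-1.

(** On the exact moments the inversion becomes Euler's series at -1/q. *)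
Lemma coef_moment r j : coef r j * Q ^+ 'C(r + j, 2) =
  moment_const r * ((- Q^-1) ^+ j / qpoch Q j).
Proof.
rewrite /coef full_countE// subnn qpoch0 divr1 qfactE /moment_const.
have e : Q ^+ 'C(r + j, 2) * Q ^+ j * Q ^+ 'C(r.+1, 2) = Q ^+ (r * r) * Q ^+ (r * j) * Q ^+
  'C(j.+1, 2).
  by rewrite -!exprD bin2_shift.
rewrite [(- Q^-1) ^+ j]exprNn exprVn.
have := gt_eqF (qpoch_gt0 r Q1) => /negbT; have := gt_eqF (qpoch_gt0 j Q1) => /negbT.
have := Qn0 'C(j.+1, 2); have := Qn0 'C(r.+1, 2); have := Qn0 'C(r + j, 2); have := Qn0 j.
have := Qn0 (r * r); have := Qn0 (r * j).
move: e; move: (Q ^+ 'C(j.+1, 2)) (Q ^+ 'C(r.+1, 2)) (Q ^+ 'C(r + j, 2)) (Q ^+ j) (Q ^+ (r * r))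
  (Q ^+ (r * j)).
move: (qpoch Q r) (qpoch Q j) ((-1) ^+ j) => x y s a b c d f g e g0 f0 d0 c0 b0 a0 y0 x0.
have -> : c = f * g * a / (d * b) by rewrite -e; field; rewrite ?d0 ?b0.
by field; rewrite ?g0 ?f0 ?d0 ?b0 ?a0 ?y0 ?x0.
Qed.

Lemma moment_const_ge0 r : 0 <= moment_const r.
Proof. by rewrite invr_ge0 mulr_ge0 ?exprn_ge0 ?ltW ?qpoch_gt0. Qed.

(* The law of d is recovered from its q-factorial moments g. *)
Lemma moment_bound (A : finType) (S : pred A) (d : A -> nat) (g : nat -> nat) (n r : nat) :
  (0 < #|S|)%N -> (forall a, d a <= n + n)%N -> (r <= n)%N ->
  (forall k, \sum_(a | S a) full_count q (d a) k = g k * #|S|)%N ->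
  (forall k, g k <= q ^ 'C(k, 2))%N -> (forall k, (k <= n)%N -> g k = q ^ 'C(k, 2))%N ->
  `| #|[pred a | S a && (d a == r)]|%:R / #|S|%:R -
     moment_const r * (qpoch Q (n - r) / qpoch (Q ^+ 2) (n - r)) | <=
  24 * moment_const r * Q ^- (n - r).
Proof.
move=> S0 dn rn mom gle geq.
have S0' : #|S|%:R != 0 :> R by rewrite pnatr_eq0 -lt0n.
set m := (n - r)%N.
(* r + J = 2n, the largest possible value of d, so the inversion is an identity. *)
pose J := (m + n)%N.
have PE : #|[pred a | S a && (d a == r)]|%:R / #|S|%:R = \sum_(j < J.+1) coef r j * (g (r +
  j)%N)%:R.
  apply: (mulIf S0'); rewrite divfK// mulr_suml.
  transitivity (\sum_(a | S a) (d a == r)%:R : R).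
    rewrite -sum1_card natr_sum (eq_bigl (fun a => S a && (d a == r)))// big_mkcondr/=.
    by apply: eq_bigr => a _; case: (d a == r).
  transitivity (\sum_(a | S a) \sum_(j < J.+1) coef r j * (full_count q (d a) (r + j))%:R).
    apply: eq_bigr => a _; rewrite moment_inversion//.
    by rewrite /J /m addnS addnA subnKC// ltnS dn.
  rewrite exchange_big/=; apply: eq_bigr => j _.
  by rewrite -mulr_sumr -natr_sum mom natrM mulrA.
have bound j : `|coef r j * (g (r + j)%N)%:R| <= moment_const r * (4 * Q ^- j).
  apply: (le_trans (_ : _ <= `|coef r j * Q ^+ 'C(r + j, 2)|)).
    rewrite !normrM; apply: ler_wpM2l => //; rewrite !ger0_norm ?exprn_ge0 ?(ltW Q0)//.
    by rewrite -natrX ler_nat.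
  rewrite coef_moment normrM ger0_norm ?moment_const_ge0//; apply: ler_wpM2l;
    first exact: moment_const_ge0.
  rewrite normrM normrX normrN [ `|Q^-1| ]ger0_norm ?invr_ge0 ?(ltW Q0)// exprVn mulrC.
  apply: ler_wpM2r; first by rewrite invr_ge0 exprn_ge0 ?(ltW Q0).
  rewrite ger0_norm ?invr_ge0 ?(ltW (qpoch_gt0 _ Q1))//.
  by rewrite -[4]invrK lef_pV2 ?posrE ?qpoch_gt0// ?qpoch_ge.
(* The terms j <= m = n - r use exact moments; the other n are only bounded. The final 24 is 16 from
   [eulerF_bound] plus 8 from this tail. *)
have split : \sum_(j < J.+1) coef r j * (g (r + j)%N)%:R =
   moment_const r * eulerF Q m.+1 (- Q^-1) + \sum_(i < n) coef r (m.+1 + i) * (g (r + (m.+1 +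
     i))%N)%:R.
  rewrite -[J.+1]/((m.+1 + n)%N) big_split_ord/=; congr (_ + _).
  rewrite /eulerF mulr_sumr; apply: eq_bigr => j _.
  rewrite -coef_moment geq ?natrX//; have := ltn_ord j.
  by rewrite ltnS -(leq_add2l r) /m subnKC.
have tail : `|\sum_(i < n) coef r (m.+1 + i) * (g (r + (m.+1 + i))%N)%:R| <=
    8 * moment_const r * Q ^- m.
  apply: (le_trans (ler_norm_sum _ _ _)).
  apply: (le_trans (_ : _ <= \sum_(i < n) moment_const r * (4 * Q ^- m.+1) * (Q^-1) ^+ i)).
    apply: ler_sum => i _; apply: (le_trans (bound _)).
    by rewrite exprD invfM exprVn !mulrA.
  have y0 : 0 <= Q^-1 <= 2^-1 by rewrite invr_ge0 (ltW Q0)/= lef_pV2 ?posrE.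
  have g2 := geo_le n y0; have m0 := moment_const_ge0 r.
  have Qm : 0 <= Q ^- m.+1 <= Q ^- m.
    rewrite invr_ge0 exprn_ge0 ?(ltW Q0)//= lef_pV2 ?posrE ?exprn_gt0//.
    by rewrite exprS ler_peMl ?exprn_ge0 ?(ltW Q0) ?(ltW Q1).
  have /andP[Qm0 Qm1] := Qm.
  rewrite -mulr_sumr.
  apply: (le_trans (_ : _ <= moment_const r * (4 * Q ^- m.+1) * 2)).
    by apply: ler_wpM2l => //; rewrite !mulr_ge0.
  have : 0 <= moment_const r * (Q ^- m - Q ^- m.+1) by rewrite mulr_ge0// subr_ge0.
  by nra.
rewrite PE split.
have b := eulerF_bound m Q2; have m0 := moment_const_ge0 r.
have -> : moment_const r * eulerF Q m.+1 (- Q^-1) +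
    \sum_(i < n) coef r (m.+1 + i) * (g (r + (m.+1 + i))%N)%:R -
    moment_const r * (qpoch Q m / qpoch (Q ^+ 2) m) =
   moment_const r * (eulerF Q m.+1 (- Q^-1) - qpoch Q m / qpoch (Q ^+ 2) m) +
   \sum_(i < n) coef r (m.+1 + i) * (g (r + (m.+1 + i))%N)%:R by ring.
apply: (le_trans (ler_normD _ _)); rewrite normrM ger0_norm//.
have := ler_wpM2l m0 b; move: tail; set u := `|\sum_(i < n) _|; nra.
Qed.

End MomentInversion.

Section Limits.
Variable R : realType.
Implicit Type x : R.

Lemma qpoch_is_cvg x : 1 < x -> cvgn (qpoch x).
Proof.
move=> x1; apply: nonincreasing_is_cvgn.
  apply/nonincreasing_seqP => n; rewrite qpochS.
  have /andP[h1 h2] := invX_lt1 n x1; have h3 := qpoch_gt0 n x1.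
  by rewrite ler_piMr ?(ltW h3)//; lra.
by exists 0 => _ [n _ <-]; exact/ltW/qpoch_gt0.
Qed.

Lemma qpoch_oo_ge x : 2 <= x -> 4^-1 <= qpoch_oo x.
Proof.
move=> x2; have x1 : 1 < x by lra.
apply: limr_ge; first exact: qpoch_is_cvg.
by apply: nearW => n; exact: qpoch_ge.
Qed.

Lemma limn_of_bound (P : nat -> R) (Q c C : R) r : 2 <= Q ->
  (forall n, (r <= n)%N ->
    `|P n - c * (qpoch Q (n - r) / qpoch (Q ^+ 2) (n - r))| <= C * Q ^- (n - r)) ->
  limn P = c * (qpoch_oo Q / qpoch_oo (Q ^+ 2)).
Proof.
move=> Q2 h; have Q1 : 1 < Q by lra.
have Qs2 : 2 <= Q ^+ 2 by rewrite expr2; nra.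
have Qs1 : 1 < Q ^+ 2 by lra.
apply: cvg_lim => //; rewrite -(cvg_shiftn r)/=.
pose w n := c * (qpoch Q n / qpoch (Q ^+ 2) n).
have cw : w @ \oo --> c * (qpoch_oo Q / qpoch_oo (Q ^+ 2)).
  apply: cvgMr; apply: cvgM; first exact: qpoch_is_cvg.
  apply: cvgV; last exact: qpoch_is_cvg.
  by apply: lt0r_neq0; have := qpoch_oo_ge Qs2; lra.
have cz : (fun n => P (n + r)%N - w n) @ \oo --> 0.
  have cg : (fun n => C * Q ^- n) @ \oo --> 0.
    rewrite -[X in _ --> X](mulr0 C); apply: cvgMr.
    rewrite (_ : (fun n => Q ^- n) = (fun n => Q^-1 ^+ n)); last by apply/funext => n;
      rewrite exprVn.
    apply: cvg_expr; rewrite ger0_norm ?invr_ge0; last lra.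
    by rewrite invf_lt1//; lra.
  apply: (@squeeze_cvgr _ _ _ _ (fun n => - (C * Q ^- n)) (fun n => C * Q ^- n)) => //.
    apply: nearW => n; rewrite -ler_norml.
    by have := h (n + r)%N (leq_addl _ _); rewrite addnK.
  by rewrite -oppr0; exact: cvgN.
rewrite [X in X @ _ --> _](_ : _ = (fun n => (P (n + r)%N - w n) + w n)); last first.
  by apply/funext => n /=; rewrite subrK.
by have := cvgD cz cw; rewrite add0r; exact.
Qed.

End Limits.

Lemma esum_fiber (R : realType) (I : choiceType) (C : finType) (cls : C -> I) (v : C -> R) :
  (forall c, 0 <= v c) ->
  (\esum_(i in [set: I]) (\sum_(c | cls c == i) v c)%:E = (\sum_c v c)%:E)%E.
Proof.
move=> v0.
transitivity (\esum_(i in [set: I]) \sum_(c : C | true) (if cls c == i then (v c)%:E else 0)%E)%E.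
  by apply: eq_esum => i _; rewrite -sumEFin big_mkcond.
rewrite esum_sum => [|i c _ _]; last by case: ifP; rewrite // lee_fin.
rewrite -sumEFin; apply: eq_bigr => c _.
rewrite -[RHS](@esum_set1 _ _ (cls c) (fun=> (v c)%:E)) ?lee_fin//.
rewrite [RHS]esum_mkcond; apply: eq_esum => i _.
have [<-|ne] := eqVneq (cls c) i; first by rewrite mem_set.
by rewrite memNset// => /= e; rewrite e eqxx in ne.
Qed.

Lemma nneseries_geometric (R : realType) (b : nat -> R) (a y : R) :
  0 <= y < 1 -> 0 <= a -> 0 <= b 0%N -> (forall j, b j.+1 = a * y ^+ j) ->
  (\sum_(0 <= j <oo) (b j)%:E = (b 0%N + a / (1 - y))%:E)%E.
Proof.
move=> /andP[y0 y1] a0 b0 bE.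
apply: cvg_lim => //; rewrite -(cvg_shiftn 1%N)/=.
rewrite [X in X @ _ --> _](_ : _ = (fun n => (b 0%N + series (geometric a y) n)%:E)).
  apply: cvg_EFin; first exact: nearW.
  apply: cvgD; first exact: cvg_cst.
  by apply: cvg_geometric_series; rewrite ger0_norm.
apply/funext => n; rewrite addn1 big_nat_recl// EFinD; congr (_ + _)%E.
by rewrite sumEFin /series/=; congr (_%:E); apply: eq_bigr => j _; rewrite bE.
Qed.

Section Law.
Variable R : realType.
Variable K : fieldExtType rat.
Local Notation O := (ringint K).
Variable p : prime_idealr O.
Hypothesis p_neq0 : exists2 a, a \in p & a != 0.
Variables (F : finFieldType) (tau : {rmorphism {ideal_quot p} -> F}).
Hypothesis tau_bij : bijective tau.

Local Notation q := #|F|.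
Local Notation Q := (q%:R : R).
Local Notation res := (resmap tau).
Local Notation rk := (res_rank p res).

Let q_gt1 : (1 < q)%N. Proof. exact: card_finNzRing_gt1. Qed.
Let Q2 : 2 <= Q. Proof. by rewrite ler_nat. Qed.
Let Q1 : 1 < Q. Proof. by have := Q2; lra. Qed.

Lemma card_Aut_gt0 (G : finLmodType O) : (0 < card_Aut G)%N.
Proof.
have lin1 : linear ((1%g : {perm G}) : G -> G) by move=> a x y; rewrite !perm1.
by apply/card_gt0P; exists 1%g; rewrite -topredE/=; exact/asboolT.
Qed.

Lemma Pmf_formula (G : finLmodType O) r f : (0 < f)%N -> pkills p f.-1 G -> rk G r ->
  Pmf p R 1 f G = qpoch_oo Q / qpoch_oo (Q ^+ 2) *
    (qpoch Q r * Q ^+ 'C(r, 2) / (card_Aut G)%:R).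
Proof.
move=> f0 kG rG.
have [S [kappa [rho [t [kb ut hr]]]]] := local_ring p_neq0 tau_bij f0.
have surj y : exists a, (kappa \o piX p f : {rmorphism O -> S}) a = y.
  by have [k kk kk'] := kb; have [a ea] := piX_surj (k y); exists a; rewrite /= ea kk'.
have s0 a : ((kappa \o piX p f : {rmorphism O -> S}) a == 0) = (a \in idealX p f).
  by rewrite /= -(rmorph0 kappa) (bij_eq kb) piX_eq0.
have kGf : pkills p f G by apply: pkills_le kG; exact: leq_pred.
have [M [e dG]] := descends_exists surj ((pkills_scale _ s0).1 kGf).
have formula n := ker_freq_formula tau_bij R kb ut hr dG n kG rG.
have aut0 : 0 < (card_Aut G)%:R :> R by rewrite ltr0n card_Aut_gt0.
set A := (card_Aut G)%:R in formula aut0 *.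
pose D : R := Q ^+ (r * r) * qpoch Q r ^+ 2 / A.
have D0 : 0 <= D.
  by rewrite mulr_ge0 ?invr_ge0 ?(ltW aut0)// mulr_ge0// exprn_ge0// ltW// qpoch_gt0.
have -> : Pmf p R 1 f G = moment_const R q r * D * (qpoch_oo Q / qpoch_oo (Q ^+ 2)).
  apply: (limn_of_bound (C := 24 * moment_const R q r * D) (r := r) Q2) => n rn.
  rewrite formula.
  have J0 : (0 < #|isom (stdJ F n)|)%N.
    by apply/card_gt0P; exists 1%:M; rewrite -topredE/= /isom trmx1 mulmx1 mul1mx.
  have := moment_bound R q_gt1 J0 (fun a => leq_subr (\rank (a - 1%:M)%R) _) rn
    (fun k => sum_isom_fixed (stdJ_unit F n) (@stdJ_alt F n) k)
    (fun k => card_grams_le (@stdJ_alt F n) k) (fun k kn => card_grams F kn).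
  rewrite (@eq_card _ [pred a | isom (stdJ F n) a & (n + n - \rank (a - 1%:M)%R)%N == r]
    [pred a | isom (stdJ F n) a & (r + \rank (a - 1%:M)%R)%N == (n + n)%N]).
    move=> h; rewrite [leRHS]mulrAC; apply: (le_trans _ (ler_wpM2r D0 h)).
    rewrite -[X in _ <= _ * X](ger0_norm D0) -normrM.
    by rewrite le_eqVlt; apply/orP; left; apply/eqP; congr (`|_|); rewrite -/D; ring.
  move=> a; rewrite !inE; congr (_ && _); have := rank_leq_row (a - 1%:M).
  by move: (\rank _) => k kn; apply/eqP/eqP => h; move: kn h; lia.
(* What remains is r^2 = C(r,2) + C(r+1,2) in the exponent of q. *)
rewrite [LHS]mulrC; congr (_ * _).
rewrite /moment_const /D; have := bin2_shift r 0.
rewrite !addn0 muln0 addn0 => erc; rewrite -{}erc exprD.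
have := qpoch_gt0 r Q1; have : Q ^+ 'C(r.+1, 2) != 0 by rewrite expf_neq0// gt_eqF// (lt_trans
  ltr01).
move: (Q ^+ 'C(r.+1, 2)) (Q ^+ 'C(r, 2)) (qpoch Q r) => x y z x0 z0.
by field; rewrite ?x0 ?gt_eqF.
Qed.

End Law.

(** * The recursion in u *)

Section ULaw.
Variables (R : realType) (Q : R).
Hypothesis Q1 : 1 < Q.

(** The claimed value with |G| and |Aut G| replaced by free reals, since the recursion pairs the
    order of H with the automorphisms of G. *)
Definition ulaw (u r : nat) (N A : R) : R :=
  qpoch (Q ^+ 2) u * qpoch_oo Q / (qpoch Q u * qpoch_oo (Q ^+ 2)) *
  (qpoch Q (r + u) * Q ^+ 'C(r, 2) / (qpoch Q u * N ^+ u * A)).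

Lemma ulaw_scale u r N A j : N != 0 ->
  ulaw u r (Q ^+ j * N) A / (Q ^+ j * N) = Q ^- u.+1 ^+ j * (ulaw u r N A / N).
Proof.
move=> N0; rewrite /ulaw.
have Qj : Q ^+ j != 0 by rewrite expf_neq0// gt_eqF// (lt_trans ltr01).
have -> : Q ^- u.+1 ^+ j = ((Q ^+ j) ^+ u * Q ^+ j)^-1 by rewrite exprVn -exprSr -!exprM mulnC.
by rewrite exprMn !invfM; ring.
Qed.

(** The first term is the level j = 0; the levels j > 0 are averaged over columns, Q^-r being the
    share with rank r + 1, and summed as a geometric series of ratio y. *)
Lemma ulaw_step u r N A : N != 0 -> A != 0 ->
  let y := Q ^- u.+1 in
  ulaw u r N A / N +
    y * (Q ^- r * (ulaw u r.+1 N A / N) + (1 - Q ^- r) * (ulaw u r N A / N)) / (1 - y) =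
  ulaw u.+1 r N A.
Proof.
move=> N0 A0; cbv zeta; rewrite /ulaw addSn addnS !qpochS binS bin1 exprD.
have Q0 : Q != 0 by rewrite gt_eqF// (lt_trans ltr01).
have e2 : Q ^+ 2 ^- u.+1 = Q ^- u.+1 * Q ^- u.+1 by rewrite -invfM -exprMn expr2.
have er : Q ^- (r + u).+1 = Q ^- r * Q ^- u.+1 by rewrite -addnS exprD invfM.
have eN : N ^+ u.+1 = N ^+ u * N by rewrite exprSr.
rewrite e2 er eN.
have Nu : N ^+ u != 0 by rewrite expf_neq0.
have P0 : qpoch Q u != 0 by rewrite gt_eqF ?qpoch_gt0.
have y1 : 1 - Q ^- u.+1 != 0 by have /andP[_ h] := invX_lt1 u Q1; rewrite gt_eqF// subr_gt0.
have r0 : Q ^+ r != 0 by rewrite expf_neq0.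
have -> : Q ^+ r = (Q ^- r)^-1 by rewrite invrK.
have z0 : Q ^- r != 0 by rewrite invr_eq0.
move: (Q ^- u.+1) (Q ^- r) (N ^+ u) (qpoch Q u) y1 z0 Nu P0 => y z n P y1 z0 n0 P0.
rewrite !invfM; move: (qpoch_oo Q) ((qpoch_oo (Q ^+ 2))^-1) => c d.
by field; rewrite A0 N0 n0 y1 P0 z0.
Qed.

Lemma ulaw_aut u r N A B : A != 0 -> B != 0 -> ulaw u r N A = ulaw u r N B * (B / A).
Proof.
move=> A0 B0; rewrite /ulaw !invfM.
move: (qpoch (Q ^+ 2) u * qpoch_oo Q * _) (qpoch Q (r + u) * _) => x z.
by move: (qpoch Q u)^-1 (N ^+ u)^-1 => v w; field; rewrite A0.
Qed.

Lemma ulaw_ge0 u r N A : 2 <= Q -> 0 <= N -> 0 <= A -> 0 <= ulaw u r N A.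
Proof.
move=> Q2 N0 A0; have Q0 := ltW (lt_trans ltr01 Q1).
have h x k : 1 < x -> 0 <= qpoch x k by move=> x1; exact/ltW/qpoch_gt0.
have g x : 2 <= x -> 0 <= qpoch_oo x.
  by move=> x2; apply: le_trans (qpoch_oo_ge x2); rewrite invr_ge0.
have Qs : 2 <= Q ^+ 2 by rewrite expr2; nra.
by rewrite /ulaw !(mulr_ge0, invr_ge0, exprn_ge0, h, g)// exprn_egt1.
Qed.

End ULaw.
Section Recursion.
Variable R : realType.
Variable K : fieldExtType rat.
Local Notation O := (ringint K).
Variable p : prime_idealr O.
Hypothesis p_neq0 : exists2 a, a \in p & a != 0.
Variables (F : finFieldType) (tau : {rmorphism {ideal_quot p} -> F}).
Hypothesis tau_bij : bijective tau.
Variable f : finLmodType O -> nat.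
Hypothesis f_levels : levels p 1 f.
Variables (I : choiceType) (M : I -> finLmodType O).
Hypothesis M_reps : representatives p M.

Local Notation q := #|F|.
Local Notation Q := (q%:R : R).
Local Notation rk := (res_rank p (resmap tau)).

(** Induction on u for all G at once, as every extension H enters with its own rank. The
    representatives are sorted by order, and the sum over each level is turned into an average over
    the columns of [extension_classes]. *)
Lemma udist_formula u (G : finLmodType O) r : ptorsion p G -> rk G r ->
  udist M (Pmq p R 1 f) u G = (ulaw Q u r #|G|%:R (card_Aut G)%:R)%:E.
Proof.
have q1 : (1 < q)%N by exact: card_finNzRing_gt1.
have Q1 : 1 < Q by rewrite ltr1n.
have Q0 : 0 < Q by rewrite (lt_trans ltr01).
have card0 (H : finLmodType O) : (0 < #|H|)%N by apply/card_gt0P; exists 0.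
have card_neq0 (H : finLmodType O) : #|H|%:R != 0 :> R by rewrite pnatr_eq0 -lt0n.
have aut_neq0 (H : finLmodType O) : (card_Aut H)%:R != 0 :> R.
  by rewrite pnatr_eq0 -lt0n card_Aut_gt0.
have [M_tors M_ex] := M_reps.
elim: u G r => [|u IH] G r tG rG /=.
  have [f1 kG] := f_levels tG.
  rewrite /Pmq (Pmf_formula R p_neq0 tau_bij f1 kG rG) /ulaw !qpoch0 addn0.
  by rewrite expr0 !mul1r.
have [rkM rkMP] := choice (fun i => rank_exists p_neq0 tau_bij (M_tors i)).
pose a i : R := (quot_count G (M i))%:R *
  (ulaw Q u (rkM i) #|M i|%:R (card_Aut (M i))%:R / #|M i|%:R).
have law_ge0 s (H : finLmodType O) : 0 <= ulaw Q u s #|H|%:R (card_Aut H)%:R / #|H|%:R.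
  by rewrite mulr_ge0 ?invr_ge0// ulaw_ge0// ler_nat.
have a_ge0 i : (0 <= (a i)%:E)%E by rewrite lee_fin mulr_ge0.
transitivity (\esum_(i in [set: I]) (a i)%:E)%E.
  apply: eq_esum => i _; rewrite (IH _ (rkM i))// -EFinM sumEFin; congr (_%:E).
  by rewrite /a /quot_count mulr_natl -[RHS]sumr_const; exact: eq_bigl.
pose L j := [set i | #|M i| = (q ^ j * #|G|)%N].
have L_disj : trivIset setT L.
  apply/trivIsetP => j k _ _ jk; apply/seteqP; split=> // i []; rewrite /L/= => ej ek.
  by move: ek jk; rewrite ej => /eqP; rewrite eqn_pmul2r// eqn_exp2l// => ->.
(* Outside the levels no quotient by a cyclic submodule is G, so the summand is 0. *)
transitivity (\esum_(i in \bigcup_n L n) (a i)%:E)%E.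
  rewrite [RHS]esum_mkcond; apply: eq_esum => i _; case: ifPn => // /negP iL.
  congr (_%:E); rewrite /a (_ : quot_count _ _ = 0%N) ?mul0r//.
  apply: eq_card0 => y; rewrite !inE; apply/asboolP => iso; apply: iL.
  by have [j [cj _]] := quot_card p_neq0 tau_bij tG (M_tors i) iso; rewrite inE; exists j.
rewrite nneseries_sum_bigcup//.
pose y : R := Q ^- u.+1.
pose w s : R := ulaw Q u s #|G|%:R (card_Aut G)%:R / #|G|%:R.
pose b j : R := y ^+ j * (if j is _.+1 then Q ^- r * w r.+1 + (1 - Q ^- r) * w r else w r).
have w_ge0 s : 0 <= w s by exact: law_ge0.
have /andP[/ltW y0 y1] : 0 < y < 1 by exact: invX_lt1.
have level j : (\esum_(i in L j) (a i)%:E = (b j)%:E)%E.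
  have [C [cls [z [C0 zC cM rM clsM]]]] := extension_classes p_neq0 tau_bij M_reps j tG rG.
  pose v c : R := y ^+ j * w (r + ((0 < j)%N && z c))%N / #|C|%:R.
  transitivity (\esum_(i in [set: I]) (\sum_(c | cls c == i) v c)%:E)%E.
    rewrite esum_mkcond; apply: eq_esum => i _; case: ifPn => [|/negP iL]; last first.
      rewrite big_pred0// => c; apply/negP => /eqP ec; apply: iL.
      by rewrite inE -ec /L/= cM.
    rewrite inE /L/= => iL; congr (_%:E).
    have vE c : cls c == i -> v c =
        ulaw Q u (rkM i) #|M i|%:R (card_Aut G)%:R / #|M i|%:R / #|C|%:R.
      move=> /eqP ec; have := rM c; rewrite ec => rc.
      rewrite (rank_uniq p_neq0 tau_bij (M_tors i) (rkMP i) rc) iL natrM natrX.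
      by rewrite ulaw_scale.
    rewrite (eq_bigr _ vE) (sumr_const [pred c | cls c == i]) -[RHS]mulr_natl /a.
    have C0' : #|C|%:R != 0 :> R by rewrite pnatr_eq0 -lt0n.
    have := congr1 (fun n => n%:R : R) (clsM i iL); rewrite /= !natrM.
    (* Trading |Aut H| for |Aut G| is exactly what the double count allows: the number of y becomes
       a proportion of columns. *)
    rewrite (ulaw_aut Q u (rkM i) #|M i|%:R (aut_neq0 (M i)) (aut_neq0 G)).
    move: (ulaw _ _ _ _ _) (aut_neq0 (M i)) (aut_neq0 G) (card_neq0 (M i)) C0'.
    move: (card_Aut G)%:R (card_Aut (M i))%:R (quot_count G (M i))%:R (#|M i|%:R : R).
    move: (#|C|%:R : R) (#|[pred c | cls c == i]|%:R : R) => c k A B N m U B0 A0 m0 c0 e.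
    have -> : k = N * (A * c) / B by rewrite e mulfK.
    by field; rewrite B0 m0 c0.
  rewrite esum_fiber; last first.
    move=> c; apply: mulr_ge0; last by rewrite invr_ge0.
    exact: mulr_ge0 (exprn_ge0 _ y0) (w_ge0 _).
  have C0' : #|C|%:R != 0 :> R by rewrite pnatr_eq0 -lt0n.
  congr (_%:E); rewrite /v -mulr_suml -mulr_sumr -mulrA; congr (_ * _).
  case: j {cM rM clsM v} => [|j] /=.
    by rewrite sumr_const addn0 -[w r *+ _]mulr_natr mulfK.
  rewrite (eq_bigr (fun c => w r + (if z c then w r.+1 - w r else 0))); last first.
    by move=> c _; case: (z c); rewrite ?addn1 ?addn0 ?addr0// addrC subrK.
  rewrite big_split/= -big_mkcond/= !sumr_const -[w r *+ _]mulr_natr.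
  rewrite -[(w r.+1 - w r) *+ _]mulr_natr.
  have := congr1 (fun n => n%:R : R) zC; rewrite /= natrM natrX => zCR.
  have Qr : Q ^+ r != 0 by rewrite expf_neq0// gt_eqF.
  move: C0'; rewrite -zCR => C0'.
  have z0 : #|z|%:R != 0 :> R by apply: contraNneq C0' => ->; rewrite mul0r.
  by move: (w r) (w r.+1) => w0 w1; field; rewrite z0 Qr.
rewrite (eq_eseriesr (fun j _ => level j)).
rewrite (@nneseries_geometric _ b (b 1%N) y).
- by rewrite /b expr0 mul1r expr1 -ulaw_step.
- by rewrite y0.
- apply: mulr_ge0; first exact: exprn_ge0.
  have z0 : 0 <= Q ^- r by rewrite invr_ge0 exprn_ge0// ltW.
  have z1 : Q ^- r <= 1 by rewrite invf_le1 ?exprn_gt0// exprn_ege1// ltW.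
  by rewrite addr_ge0// mulr_ge0// subr_ge0.
- by rewrite /b expr0 mul1r.
- by move=> j; rewrite /b expr1 exprS mulrAC.
Qed.

End Recursion.

Theorem theorem4p6 (R : realType) (K : fieldExtType rat)
    (p : prime_idealr (ringint K)) (p_neq0 : exists2 a, a \in p & a != 0)
    (f : finLmodType (ringint K) -> nat) (f_levels : levels p 1 f)
    (I : choiceType) (M : I -> finLmodType (ringint K))
    (M_reps : representatives p M)
    (G : finLmodType (ringint K)) (r : nat)
    (G_torsion : ptorsion p G) (G_rank : has_prank p G r) (u : nat) :
  let q : R := (set_card [set: {ideal_quot p}])%:R in
  udist M (Pmq p R 1 f) u G =
    (qpoch (q ^+ 2) u * qpoch_oo q / (qpoch q u * qpoch_oo (q ^+ 2)) *
     (qpoch q (r + u) * q ^+ 'C(r, 2) /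
      (qpoch q u * #|G|%:R ^+ u * (card_Aut G)%:R)))%:E.
Proof.
move=> q; have [F [tau tau_bij]] := residue_field p_neq0.
have qE : q = #|F|%:R by rewrite /q -(card_residue p_neq0 tau_bij).
rewrite qE; apply: (udist_formula R p_neq0 tau_bij f_levels M_reps u G_torsion).
exact: has_prank_rank.
Qed.
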